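(* Let $d\in\{2,3\}$, let $m,c,\alpha>0$ and $T>0$. Let $U\colon\mathbb{R}\times(\mathbb{R}^d\setminus\{0\})\to\mathbb{R}$ be a continuous function, $T$-periodic with respect to the first variable and two times continuously differentiable with respect to the second variable. Then, for every integer $N\ge1$ there exists $\varepsilon_N^*>0$ such that, if $|\varepsilon|<\varepsilon_N^*$, the equation $$\frac{\mathrm d}{\mathrm dt}\left(\frac{m\dot x}{\sqrt{1-|\dot x|^2/c^2}}\right)=-\alpha\frac{x}{|x|^3}+\varepsilon\,\nabla_xU(t,x),\qquad x\in\mathbb{R}^d\setminus\{0\},$$ has at least $4N$ $T$-periodic solutions.
   Context: Solutions are understood in the classical sense, with $|\dot x(t)|<c$ and $x(t)\ne0$ for all $t$. $T$-periodic means $x(t+T)=x(t)$ for all $t$ ($T$ need not be the minimal period). Solutions are counted as distinct functions of $t$. *)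

(* Defs.v *)
From mathcomp Require Import all_boot all_order all_algebra.
From mathcomp Require Import all_classical all_reals all_analysis.
Import Order.TTheory GRing.Theory Num.Theory.
Import numFieldNormedType.Exports.

Set Implicit Arguments.
Unset Strict Implicit.
Unset Printing Implicit Defensive.

Local Open Scope classical_set_scope.
Local Open Scope ring_scope.

(* The library norm `|v| on row vectors is the sup norm. *)
Definition enorm (R : realType) (d : nat) (v : 'rV[R]_d) : R :=
  Num.sqrt (\sum_(i < d) v 0 i ^+ 2).

Definition partial (R : realType) (d : nat) (i : 'I_d) (f : 'rV[R]_d -> R)
  (x : 'rV[R]_d) : R := 'D_(delta_mx 0 i) f x.

Definition gradient (R : realType) (d : nat) (f : 'rV[R]_d -> R)
  (x : 'rV[R]_d) : 'rV[R]_d := \row_(i < d) partial i f x.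

(* Functions on R * (R^d \ {0}) are represented by total functions; no
   hypothesis constrains their values at x = 0. *)
Definition continuous_off0 (R : realType) (d : nat)
  (F : R -> 'rV[R]_d -> R) : Prop :=
  forall p : R * 'rV[R]_d, p.2 != 0 ->
    {for p, continuous (fun q : R * 'rV[R]_d => F q.1 q.2)}.

(* The derivatives in x are continuous jointly in (t, x). Continuity in x alone,
   for each fixed t, would not even make t |-> gradient (U t) (x t) continuous
   along a continuous curve x. *)
Definition C2_in_space (R : realType) (d : nat)
  (U : R -> 'rV[R]_d -> R) : Prop :=
  [/\ forall t x, x != 0 -> differentiable (U t) x,
      forall i : 'I_d, continuous_off0 (fun t => partial i (U t)),
      forall (i : 'I_d) t x, x != 0 -> differentiable (partial i (U t)) x
    & forall i j : 'I_d,
        continuous_off0 (fun t => partial j (partial i (U t)))].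

Definition rel_momentum (R : realType) (d : nat) (m c : R) (v : 'rV[R]_d) :
  'rV[R]_d := (m / Num.sqrt (1 - enorm v ^+ 2 / c ^+ 2)) *: v.

Definition perturbed_kepler_force (R : realType) (d : nat) (alpha eps : R)
  (U : R -> 'rV[R]_d -> R) (t : R) (x : 'rV[R]_d) : 'rV[R]_d :=
  - (alpha / enorm x ^+ 3) *: x + eps *: gradient (U t) x.

(* derive1 is total, so derivability has to be required separately. *)
Definition kepler_solution (R : realType) (d : nat) (m c alpha eps : R)
  (U : R -> 'rV[R]_d -> R) (x : R -> 'rV[R]_d) : Prop :=
  forall t : R,
    let p := fun s : R => rel_momentum m c (derive1 x s) in
    [/\ x t != 0,
        derivable x t 1,
        enorm (derive1 x t) < c,
        derivable p t 1
      & derive1 p t = perturbed_kepler_force alpha eps U t (x t)].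

Definition periodic_in_time (R : realType) (A : Type) (T : R) (x : R -> A) :
  Prop := forall t : R, x (t + T) = x t.

(* Main.v *)
(* As N is arbitrary, it suffices to find one T-periodic solution near the circular orbit of
   frequency 2 k pi / T for every large k; the radii of these orbits are pairwise distinct. In
   units where radius, frequency and momentum are 1, the linearization in the rotating frame is
   invertible on T-periodic functions modulo rotations iff cos (2 k pi kappa) <> 1, where
   kappa = sqrt (1 - v^2 / c^2). As k grows, k kappa increases strictly to a finite limit, so
   this holds for all large k.

   For each O in O(d), a contraction then solves the problem with the perturbation rotated by O
   up to a constant torque L in so(d), transverse to the isotropy algebra of the orbit, and the
   solution depends on O in a Lipschitz way. Choose O minimizing the action over the compact
   group O(d). Moving O along the Cayley curve of L changes the action at first order by the
   torque times the integral of |x L|^2, which is close to its positive value on the circular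
   orbit; hence L = 0 at the minimum, and the constrained solution is a true one. *)

Require Import Defs.
From mathcomp Require Import all_boot all_order all_algebra.
From mathcomp Require Import all_classical all_reals all_analysis.
From mathcomp Require Import ring lra.
Import Order.TTheory GRing.Theory Num.Theory.
Import numFieldNormedType.Exports.

Set Implicit Arguments.
Unset Strict Implicit.
Unset Printing Implicit Defensive.

Local Open Scope classical_set_scope.
Local Open Scope ring_scope.

(** * Derivatives, continuity and primitives on the line *)

Section Calculus.
Context {R : realType}.
Implicit Types (f g h F H : R -> R) (a b s t M : R).

(** The equation is treated as a first-order system for position and momentum. Velocity is then a
    smooth function of momentum with norm below [c], so the speed bound never has to be imposed, and
    solving the linear problem costs no derivative, so the contraction runs in the sup norm. A phase
    shift of a circular orbit is a rotation of its plane, so rotations account for the whole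
    degeneracy. The kernel is removed by linear constraints, mean of [<X, orbit A>] equal to 0 for
    skew [A], and the cokernel by the torque force [orbit L]. No differentiability in [O] is
    required. Along a Cayley curve [N], the first variation of the action integrates by parts to
    pairings with the torque force; the constraints at [O] and at [N O] cancel these up to [2 s]
    times the mean of [<orbit L, X L>]. Lipschitz dependence of the solution on [O] makes everything
    else quadratic in [s]. Minimizing over all of O(d), rather than over orbits modulo isotropy,
    gives compactness from polynomial equations alone. *)

Lemma der_add f g t a b : is_derive t 1 f a -> is_derive t 1 g b ->
  is_derive t 1 (fun s => f s + g s) (a + b).
Proof. exact: is_deriveD. Qed.

Lemma der_sub f g t a b : is_derive t 1 f a -> is_derive t 1 g b ->
  is_derive t 1 (fun s => f s - g s) (a - b).
Proof. exact: is_deriveB. Qed.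

Lemma der_opp f t a : is_derive t 1 f a -> is_derive t 1 (fun s => - f s) (- a).
Proof. exact: is_deriveN. Qed.

Lemma der_mul f g t a b : is_derive t 1 f a -> is_derive t 1 g b ->
  is_derive t 1 (fun s => f s * g s) (f t * b + g t * a).
Proof. exact: is_deriveM. Qed.

Lemma der_cst t a : is_derive t 1 (fun _ : R => a) 0.
Proof. exact: is_derive_cst. Qed.

Lemma der_id t : is_derive t 1 (fun s : R => s) 1.
Proof. exact: is_derive_id. Qed.

Lemma der_eq f t a b : is_derive t 1 f a -> a = b -> is_derive t 1 f b.
Proof. by move=> h <-. Qed.

Lemma der_mull t a : is_derive t 1 ( *%R a) a.
Proof.
by apply: der_eq (der_mul (der_cst t a) (der_id t)) _; rewrite mulr1 mulr0 addr0.
Qed.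

Lemma der_addl t a : is_derive t 1 ( +%R a) 1.
Proof. by apply: der_eq (der_add (der_cst t a) (der_id t)) _; rewrite add0r. Qed.

Lemma der_comp f g t a b : is_derive (g t) 1 f a -> is_derive t 1 g b ->
  is_derive t 1 (fun s => f (g s)) (a * b).
Proof. by move=> hf hg; exact: (@is_derive1_comp _ f g). Qed.

Lemma der_continuous f g : (forall t, is_derive t 1 f (g t)) -> continuous f.
Proof.
move=> h t; apply/differentiable_continuous/derivable1_diffP.
by have [] := h t.
Qed.

Lemma der_lip_seg f g a b M : a <= b ->
  (forall t, a <= t <= b -> is_derive t 1 f (g t)) ->
  (forall t, a <= t <= b -> `|g t| <= M) ->
  `|f b - f a| <= M * (b - a).
Proof.
move=> ab df gM.
have [||c cab ->] := @MVT_segment R f g a b ab.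
- by move=> x /itvP xab; apply: df; rewrite !xab.
- apply: derivable_within_continuous => x; rewrite in_itv /= => xab.
  by have [] := df x xab.
rewrite normrM (ger0_norm (_ : 0 <= b - a)) ?subr_ge0 // ler_wpM2r ?subr_ge0 //.
by apply: gM; move: cab; rewrite in_itv.
Qed.

Lemma der_lip f g M : (forall t, is_derive t 1 f (g t)) ->
  (forall t, `|g t| <= M) -> forall s t, `|f t - f s| <= M * `|t - s|.
Proof.
move=> df gM.
have main s t : s <= t -> `|f t - f s| <= M * `|t - s|.
  move=> st; rewrite (ger0_norm (_ : 0 <= t - s)) ?subr_ge0 //.
  by apply: (@der_lip_seg f g).
move=> s t; have [/main //|/ltW/main] := leP s t.
by rewrite distrC (distrC s).
Qed.

Lemma der0_cst f : (forall t, is_derive t 1 f 0) -> forall s t, f s = f t.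
Proof.
move=> df s t; apply/eqP; rewrite -subr_eq0 -normr_eq0 eq_le normr_ge0 andbT.
by have := @der_lip f (fun=> 0) 0 df (fun=> ltac:(by rewrite normr0)) t s; rewrite mul0r.
Qed.

Lemma der_shift f g T : (forall t, is_derive t 1 f (g t)) ->
  forall t, is_derive t 1 (fun s => f (s + T)) (g (t + T)).
Proof.
move=> df t; have -> : g (t + T) = g (t + T) * (1 + 0) by ring.
by apply: (@der_comp f (fun s => s + T)).
Qed.

(** The integral starts at [- n - 1], and this base must move left with the argument: [nn x] bounds
    [|x|]. Two branches differ by a constant wherever both apply, so subtracting the value at 0
    glues them. *)
Lemma prim_exists h : continuous h ->
  exists H, (forall t, is_derive t 1 H (h t)) /\ H 0 = 0.
Proof.
move=> hc.
pose Fn (n : nat) (x : R) := (\int[lebesgue_measure]_(t in [set` `[- n%:R - 1, x]]) (h t))%R.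
have dFn n (x : R) : - n%:R - 1 < x -> is_derive x 1 (Fn n) (h x).
  move=> nx.
  have int : (@lebesgue_measure R).-integrable [set` `[(- n%:R - 1), (x + 1)]] (EFin \o h).
    by apply: continuous_compact_integrable; [exact: segment_compact|exact: continuous_subspaceT].
  have [d e] := @continuous_FTC1_closed R h (- n%:R - 1) x (x+1) ltac:(by rewrite ltrDl) int nx (hc x).
  by rewrite -e derive1E; apply/derivableP.
pose nn (x : R) := Num.bound (`|x|).
have nnP (x : R) : - (nn x)%:R - 1 < x.
  have := archi_boundP (normr_ge0 x); rewrite -/(nn x) => h1.
  have := ler_norm (- x); rewrite normrN; lra.
pose H x := Fn (nn x) x - Fn (nn x) 0.
have FnE n (x : R) : - n%:R - 1 < x -> H x = Fn n x - Fn n 0.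
  move=> nx; rewrite /H.
  set m := nn x; have mx := nnP x; rewrite -/m in mx.
  have key (a b : R) : a <= b -> - m%:R - 1 < a -> - n%:R - 1 < a ->
      (Fn m b - Fn n b) - (Fn m a - Fn n a) = 0.
    move=> ab ma na; apply/eqP; rewrite -normr_eq0 eq_le normr_ge0 andbT.
    rewrite -(mul0r (b - a)).
    apply: (@der_lip_seg (fun x => Fn m x - Fn n x) (fun=> 0)) => // [t /andP[at_ _]|t _]; last by rewrite normr0.
    rewrite -(subrr (h t)); apply: der_sub; apply: dFn.
      exact: lt_le_trans ma at_.
    exact: lt_le_trans na at_.
  have m0 : - m%:R - 1 < 0 :> R by have := ler0n R m; lra.
  have n0 : - n%:R - 1 < 0 :> R by have := ler0n R n; lra.
  have [x0|/ltW x0] := leP x 0.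
    have := key _ _ x0 mx nx; lra.
  have := key _ _ x0 m0 n0; lra.
exists H; split; last by rewrite /H subrr.
move=> t.
pose n := (nn t).+1.
have nt : - n%:R - 1 < t - 1 by have := nnP t; rewrite /n -natr1; lra.
have -> : h t = h t - 0 by rewrite subr0.
apply: (@near_eq_is_derive _ _ _ (fun x => Fn n x - Fn n 0)).
- near=> x; apply/esym/FnE; apply: lt_trans nt _; near: x.
  by apply: lt_nbhsr; lra.
- by apply: der_sub; apply: dFn; lra.
Unshelve. all: by end_near. Qed.


Lemma cont_add f g : continuous f -> continuous g -> continuous (fun s => f s + g s).
Proof. by move=> cf cg t; apply: continuousD; [exact: cf|exact: cg]. Qed.

Lemma cont_sub f g : continuous f -> continuous g -> continuous (fun s => f s - g s).
Proof. by move=> cf cg t; apply: continuousB; [exact: cf|exact: cg]. Qed.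

Lemma cont_mul f g : continuous f -> continuous g -> continuous (fun s => f s * g s).
Proof. by move=> cf cg t; apply: continuousM; [exact: cf|exact: cg]. Qed.

Lemma cont_opp f : continuous f -> continuous (fun s => - f s).
Proof. by move=> cf t; apply: continuousN; exact: cf. Qed.

Lemma cont_cst a : continuous (fun _ : R => a).
Proof. by move=> t; apply: cvg_cst. Qed.

Lemma cont_eq f g : f =1 g -> continuous g -> continuous f.
Proof. by move=> /funext ->. Qed.

Lemma cont_mull a : continuous ( *%R a).
Proof. exact: der_continuous (fun t => der_mull t a). Qed.

Lemma cont_addl a : continuous ( +%R a).
Proof. exact: der_continuous (fun t => der_addl t a). Qed.

Lemma cont_id : continuous (fun s : R => s).
Proof. by move=> t; apply: cvg_id. Qed.

End Calculus.

Ltac cont := repeat first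
  [ eassumption
  | match goal with
    | |- continuous (fun s => _ + _) => apply: cont_add
    | |- continuous (fun s => _ - _) => apply: cont_sub
    | |- continuous (fun s => _ * _) => apply: cont_mul
    | |- continuous (fun s => - _) => apply: cont_opp
    | |- continuous (fun s => sin s) => exact: continuous_sin
    | |- continuous (fun s => cos s) => exact: continuous_cos
    | |- continuous (GRing.mul _) => exact: cont_mull
    | |- continuous (Algebra.add _) => exact: cont_addl
    | |- continuous sin => exact: continuous_sin
    | |- continuous cos => exact: continuous_cos
    | |- continuous (fun s => s) => exact: cont_id
    | |- continuous (fun _ => ?a) => exact: cont_cst
    end].

Ltac der := repeat first
  [ match goal with
    | |- is_derive _ _ (fun s => _ + _) _ => notypeclasses refine (der_add _ _)
    | |- is_derive _ _ (fun s => _ - _) _ => notypeclasses refine (der_sub _ _)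
    | |- is_derive _ _ (fun s => _ * _) _ => notypeclasses refine (der_mul _ _)
    | |- is_derive _ _ (fun s => - _) _ => notypeclasses refine (der_opp _)
    | |- is_derive _ _ (fun s => sin s) _ => exact: is_derive_sin
    | |- is_derive _ _ (fun s => cos s) _ => exact: is_derive_cos
    | |- is_derive _ _ (GRing.mul _) _ => notypeclasses refine (der_mull _ _)
    | |- is_derive _ _ (Algebra.add _) _ => notypeclasses refine (der_addl _ _)
    | |- is_derive _ _ sin _ => exact: is_derive_sin
    | |- is_derive _ _ cos _ => exact: is_derive_cos
    | |- is_derive _ _ (fun s => s) _ => notypeclasses refine (der_id _)
    | |- is_derive _ _ (fun _ => ?a) _ => notypeclasses refine (der_cst _ _)
    | H : _ |- is_derive _ _ _ _ => first [notypeclasses refine H | notypeclasses refine (H _)]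
    end].

(** Leaves the value of the derivative as an equation, for [ring] or [field] to close. *)
Ltac derE := notypeclasses refine (der_eq _ _); [solve [der]|cbv beta].

(** * Primitives and means of periodic functions *)

Section Primitive.
Context {R : realType}.
Implicit Types (f g h F H : R -> R) (a b s t M : R).

(** The default for a discontinuous [h] is the zero function, so that [prim0] holds for every
    [h]. *)
Definition prim h : R -> R :=
  if pselect (continuous h) is left hc then sval (cid (prim_exists hc)) else 0.

Lemma prim_der h : continuous h -> forall t, is_derive t 1 (prim h) (h t).
Proof.
by move=> hc; rewrite /prim; case: pselect => // hc'; case: (svalP (cid (prim_exists hc'))).
Qed.

Lemma prim0 h : prim h 0 = 0.
Proof.
by rewrite /prim; case: pselect => // hc'; case: (svalP (cid (prim_exists hc'))).
Qed.

Lemma cont_prim h : continuous h -> continuous (prim h).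
Proof. by move=> /prim_der /der_continuous. Qed.

Lemma primE H h : (forall t, is_derive t 1 H (h t)) -> continuous h ->
  forall t, prim h t = H t - H 0.
Proof.
move=> dH ch t.
have d0 s : is_derive s 1 (fun s => prim h s - H s) 0.
  have dp := prim_der ch.
  by derE; rewrite subrr.
by have := der0_cst d0 t 0; rewrite /= prim0; lra.
Qed.

End Primitive.

Section Mean.
Context {R : realType} (T : R) (T0 : 0 < T).
Implicit Types (f g h F H : R -> R) (a b s t M : R).

Definition Tperiodic f := forall t, f (t + T) = f t.

(** Passing through the primitive reduces the properties of the mean to statements about
    derivatives. *)
Definition mean h : R := prim h T / T.

Lemma mean_prim H h : (forall t, is_derive t 1 H (h t)) -> continuous h ->
  mean h = (H T - H 0) / T.
Proof. by move=> dH ch; rewrite /mean (primE dH). Qed.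

Lemma mean_der H h : (forall t, is_derive t 1 H (h t)) -> continuous h ->
  Tperiodic H -> mean h = 0.
Proof. by move=> dH ch pH; rewrite (mean_prim dH) // -{1}(add0r T) pH subrr mul0r. Qed.

Lemma mean_add f g : continuous f -> continuous g ->
  mean (fun s => f s + g s) = mean f + mean g.
Proof.
move=> cf cg; have df := prim_der cf; have dg := prim_der cg.
rewrite (@mean_prim (fun s => prim f s + prim g s)).
- by rewrite /mean !prim0 !addr0 subr0 mulrDl.
all: first [by cont | by move=> t; der].
Qed.

Lemma mean_sub f g : continuous f -> continuous g ->
  mean (fun s => f s - g s) = mean f - mean g.
Proof.
move=> cf cg; have df := prim_der cf; have dg := prim_der cg.
rewrite (@mean_prim (fun s => prim f s - prim g s)).
- by rewrite /mean !prim0 !subr0 mulrBl.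
all: first [by cont | by move=> t; der].
Qed.

Lemma mean_scale a f : continuous f -> mean (fun s => a * f s) = a * mean f.
Proof.
move=> cf; have df := prim_der cf.
rewrite (@mean_prim (fun s => a * prim f s)).
- by rewrite /mean !prim0 mulr0 subr0 mulrA.
all: first [by cont | by move=> t; derE; rewrite /=; ring].
Qed.

Lemma mean_cst a : mean (fun=> a) = a.
Proof.
have da t : is_derive t 1 (fun s => s * a) a by derE; rewrite mulr0 mulr1 add0r.
by rewrite (mean_prim da (@cont_cst R a)) mul0r subr0 mulrC mulKf // gt_eqF.
Qed.

Lemma mean_bound f M : continuous f -> (forall t, `|f t| <= M) -> `|mean f| <= M.
Proof.
move=> cf fM; rewrite /mean normrM normfV (gtr0_norm T0) ler_pdivrMr //.
by have := der_lip (prim_der cf) fM 0 T; rewrite prim0 !subr0 (gtr0_norm T0).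
Qed.

Lemma prim_periodic f : continuous f -> Tperiodic f -> mean f = 0 -> Tperiodic (prim f).
Proof.
move=> cf pf m0 t; have df := prim_der cf.
have pT : prim f T = 0.
  by move: m0; rewrite /mean => /eqP; rewrite mulf_eq0 invr_eq0 (gt_eqF T0) orbF => /eqP.
have d0 s : is_derive s 1 (fun s => prim f (s + T) - prim f s) 0.
  have dT := fun t => @der_shift _ _ _ T df t.
  by derE; rewrite pf subrr.
have := der0_cst d0 t 0; rewrite /= prim0 add0r pT; lra.
Qed.

Lemma antiderivative_exists f : continuous f -> Tperiodic f ->
  exists F, [/\ forall t, is_derive t 1 F (f t - mean f), Tperiodic F & mean F = 0].
Proof.
move=> cf pf; pose g := fun s => f s - mean f.
have cg : continuous g by rewrite /g; cont.
have pg : Tperiodic g by move=> t; rewrite /g pf.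
have mg : mean g = 0 by rewrite /g mean_sub ?mean_cst ?subrr//; exact: cont_cst.
have cG := cont_prim cg; have dg := prim_der cg.
exists (fun s => prim g s - mean (prim g)); split.
- by move=> t; derE; rewrite /g subr0.
- by move=> t; rewrite prim_periodic.
- by rewrite mean_sub ?mean_cst ?subrr//; exact: cont_cst.
Qed.

(** Periodicity brings any two points into [[0, T]], where the mean value inequality bounds the
    difference of the values by [M * T]; averaging over one of the points keeps the bound. *)
Lemma mean_osc F f M : (forall t, is_derive t 1 F (f t)) -> Tperiodic F ->
  (forall t, `|f t| <= M) -> forall t, `|F t - mean F| <= M * T.
Proof.
move=> dF pF fM t; have cF := der_continuous dF.
have M0 : 0 <= M by apply: le_trans (fM 0).
have red s : exists s', 0 <= s' <= T /\ F s' = F s.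
  have pz (n : nat) x : F (x + n%:R * T) = F x.
    elim: n x => [|n ih] x; first by rewrite mul0r addr0.
    by rewrite -natr1 mulrDl mul1r addrA pF ih.
  have pz' (z : int) x : F (x + z%:~R * T) = F x.
    case: z => n; first exact: pz.
    by rewrite NegzE -(pz n.+1) mulrNz -addrA mulNr addNr addr0.
  exists (s - (Num.floor (s / T))%:~R * T); split; last first.
    by rewrite -mulNr -mulrNz pz'.
  have h1 := Num.Theory.floor_le (s / T); have h2 := floorD1_gt (s / T).
  rewrite intrD in h2.
  rewrite ler_pdivlMr // in h1; rewrite ltr_pdivrMr // mulrDl mul1r in h2.
  by apply/andP; split; lra.
have osc s u : `|F s - F u| <= M * T.
  have [s' [/andP[? ?] <-]] := red s; have [u' [/andP[? ?] <-]] := red u.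
  apply: le_trans (der_lip dF fM u' s') _; rewrite ler_wpM2l // ler_norml; lra.
have -> : F t - mean F = - mean (fun s => F s - F t).
  by rewrite mean_sub ?mean_cst ?opprB//; exact: cont_cst.
rewrite normrN; apply: mean_bound => //; by cont.
Qed.

End Mean.

Section Bounds.
Context {R : realDomainType}.
Implicit Types a b A B c t x y M : R.

Lemma norm_add_le a b A B : `|a| <= A -> `|b| <= B -> `|a + b| <= A + B.
Proof. by move=> ha hb; apply: le_trans (ler_normD _ _) _; exact: lerD. Qed.

Lemma norm_sub_le a b A B : `|a| <= A -> `|b| <= B -> `|a - b| <= A + B.
Proof. by move=> ha hb; apply: norm_add_le => //; rewrite normrN. Qed.

Lemma norm_mul_le a b A B : `|a| <= A -> `|b| <= B -> `|a * b| <= A * B.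
Proof. by move=> ha hb; rewrite normrM; apply: ler_pM. Qed.

End Bounds.

(** * Periodic solutions of a forced oscillator *)

Section Oscillator.
Context {R : realType}.
Implicit Types (f g u w : R -> R) (M t T k : R).

Lemma norm_cos_le1 (t : R) : `|cos t| <= 1.
Proof. by rewrite ler_norml cos_geN1 cos_le1. Qed.

Lemma norm_sin_le1 (t : R) : `|sin t| <= 1.
Proof. by rewrite ler_norml sin_geN1 sin_le1. Qed.

Lemma norm_mul_cos_le (a t A : R) : `|a| <= A -> `|a * cos t| <= A.
Proof. by move=> h; rewrite -(mulr1 A); apply: norm_mul_le => //; exact: norm_cos_le1. Qed.

Lemma norm_mul_sin_le (a t A : R) : `|a| <= A -> `|a * sin t| <= A.
Proof. by move=> h; rewrite -(mulr1 A); apply: norm_mul_le => //; exact: norm_sin_le1. Qed.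

Lemma cosM_der k t : is_derive t 1 (fun s => cos (k * s)) (- sin (k * t) * k).
Proof.
have dk : is_derive t 1 (fun s : R => k * s) k.
  by apply: der_eq (der_mul (der_cst t k) (der_id t)) _; rewrite mulr1 mulr0 addr0.
exact: (@der_comp _ cos (fun s => k * s)).
Qed.

Lemma sinM_der k t : is_derive t 1 (fun s => sin (k * s)) (cos (k * t) * k).
Proof.
have dk : is_derive t 1 (fun s : R => k * s) k.
  by apply: der_eq (der_mul (der_cst t k) (der_id t)) _; rewrite mulr1 mulr0 addr0.
exact: (@der_comp _ sin (fun s => k * s)).
Qed.

Definition oscillates k f g u w := forall t,
  is_derive t 1 u (k * w t + f t) /\ is_derive t 1 w (- (k * u t) + g t).

Lemma rot_der k f g u w : oscillates k f g u w -> forall t,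
  is_derive t 1 (fun s => u s * cos (k * s) - w s * sin (k * s))
    (f t * cos (k * t) - g t * sin (k * t)) /\
  is_derive t 1 (fun s => u s * sin (k * s) + w s * cos (k * s))
    (f t * sin (k * t) + g t * cos (k * t)).
Proof.
move=> o t; have [du dw] := o t; have dc := cosM_der k t; have ds := sinM_der k t.
by split; derE; rewrite /=; ring.
Qed.

Lemma resolvent_denom_gt0 (c s : R) : c != 1 -> 0 < (c - 1) ^+ 2 + s ^+ 2.
Proof.
move=> c1; rewrite ltr_wpDr ?sqr_ge0 // lt_def sqr_ge0 andbT.
by rewrite expf_neq0 // subr_eq0.
Qed.

(** Rotating by the angle [k t] leaves a pure integration for [(b1, b2)]. As [u] and [w] are
    periodic, the increment of [(b1, b2)] over a period is the rotation by [k T] minus the identity,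
    applied to it; the determinant [D = (c - 1)^2 + s^2] of this matrix is positive off
    resonance. *)
Lemma oscillator_bound k T : 0 < T -> cos (k * T) != 1 ->
  exists2 C, 0 <= C & forall f g u w M, oscillates k f g u w ->
   Tperiodic T u -> Tperiodic T w ->
   (forall t, `|f t| <= M) -> (forall t, `|g t| <= M) ->
   forall t, `|u t| <= C * M /\ `|w t| <= C * M.
Proof.
move=> T0 c1; set c := cos (k * T); set s := sin (k * T).
have D0 := resolvent_denom_gt0 (sin (k * T)) c1.
set D := (cos _ - 1) ^+ 2 + _ in D0.
have D0' : 0 <= D by apply: ltW.
(* Increments are at most [2 M T]. As [|c - 1| <= 2] and [|s| <= 1], each of [b1], [b2] is at most
   [6 M T / D], and [u], [w] are sums of two such terms. *)
exists (12%:R * T / D); first by rewrite divr_ge0 // mulr_ge0 // ltW.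
move=> f g u w M o pu pw fM gM t.
pose b1 s := u s * cos (k * s) - w s * sin (k * s).
pose b2 s := u s * sin (k * s) + w s * cos (k * s).
have db1 (s : R) : is_derive s 1 b1 (f s * cos (k * s) - g s * sin (k * s)) := (rot_der o s).1.
have db2 (s : R) : is_derive s 1 b2 (f s * sin (k * s) + g s * cos (k * s)) := (rot_der o s).2.
have cT : cos (k * (t + T)) = cos (k * t) * c - sin (k * t) * s by rewrite mulrDr cosD.
have sT : sin (k * (t + T)) = sin (k * t) * c + cos (k * t) * s by rewrite mulrDr sinD.
pose e1 := b1 (t + T) - b1 t; pose e2 := b2 (t + T) - b2 t.
have e1M : `|e1| <= (M + M) * T.
  have := @der_lip _ b1 _ (M + M) db1 _ t (t + T).
  rewrite (_ : t + T - t = T) ?(gtr0_norm T0); last (by ring); apply => r.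
  by apply: norm_sub_le; [apply: norm_mul_cos_le|apply: norm_mul_sin_le].
have e2M : `|e2| <= (M + M) * T.
  have := @der_lip _ b2 _ (M + M) db2 _ t (t + T).
  rewrite (_ : t + T - t = T) ?(gtr0_norm T0); last (by ring); apply => r.
  by apply: norm_add_le; [apply: norm_mul_sin_le|apply: norm_mul_cos_le].
have E1 : e1 = (c - 1) * b1 t - s * b2 t by rewrite /e1 /b1 /b2 pu pw cT sT; ring.
have E2 : e2 = s * b1 t + (c - 1) * b2 t by rewrite /e2 /b1 /b2 pu pw cT sT; ring.
have c2 : `|c - 1| <= 1 + 1 by apply: norm_sub_le; rewrite ?norm_cos_le1 ?normr1.
have s1 : `|s| <= 1 by exact: norm_sin_le1.
have B1 : `|b1 t| <= 6 * M * T / D.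
  have -> : b1 t = ((c - 1) * e1 + s * e2) / D.
    by rewrite E1 E2; apply/(mulIf (lt0r_neq0 D0)); rewrite divfK ?gt_eqF // /D -/c -/s; ring.
  rewrite normrM normfV (gtr0_norm D0) ler_pM2r ?invr_gt0 //.
  apply: le_trans (norm_add_le (norm_mul_le c2 e1M) (norm_mul_le s1 e2M)) _.
  by rewrite le_eqVlt; apply/orP; left; apply/eqP; ring.
have B2 : `|b2 t| <= 6 * M * T / D.
  have -> : b2 t = ((c - 1) * e2 - s * e1) / D.
    by rewrite E1 E2; apply/(mulIf (lt0r_neq0 D0)); rewrite divfK ?gt_eqF // /D -/c -/s; ring.
  rewrite normrM normfV (gtr0_norm D0) ler_pM2r ?invr_gt0 //.
  apply: le_trans (norm_sub_le (norm_mul_le c2 e2M) (norm_mul_le s1 e1M)) _.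
  by rewrite le_eqVlt; apply/orP; left; apply/eqP; ring.
have cs := cos2Dsin2 (k * t).
have -> : u t = b1 t * cos (k * t) + b2 t * sin (k * t).
  by rewrite /b1 /b2 -[LHS]mulr1 -cs; ring.
have -> : w t = b2 t * cos (k * t) - b1 t * sin (k * t).
  by rewrite /b1 /b2 -[LHS]mulr1 -cs; ring.
have -> : 12%:R * T / D * M = 6 * M * T / D + 6 * M * T / D by ring.
split.
  by apply: norm_add_le; [apply: norm_mul_cos_le|apply: norm_mul_sin_le].
by apply: norm_sub_le; [apply: norm_mul_cos_le|apply: norm_mul_sin_le].
Qed.

Lemma oscillator_exists k T f g : 0 < T -> cos (k * T) != 1 ->
  continuous f -> continuous g -> Tperiodic T f -> Tperiodic T g ->
  exists u w, [/\ oscillates k f g u w, Tperiodic T u & Tperiodic T w].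
Proof.
move=> T0 c1 cf cg pf pg; set c := cos (k * T); set s := sin (k * T).
have D0 := resolvent_denom_gt0 (sin (k * T)) c1.
set D := (cos _ - 1) ^+ 2 + _ in D0.
have Dn : D != 0 by rewrite gt_eqF.
have cc : continuous (fun t => cos (k * t)) by exact: der_continuous (cosM_der k).
have cs : continuous (fun t => sin (k * t)) by exact: der_continuous (sinM_der k).
pose h1 t := f t * cos (k * t) - g t * sin (k * t).
pose h2 t := f t * sin (k * t) + g t * cos (k * t).
have ch1 : continuous h1 by rewrite /h1; cont.
have ch2 : continuous h2 by rewrite /h2; cont.
have dH1 := prim_der ch1; have dH2 := prim_der ch2.
(* [A], [B] are the values at [T] of the solution that starts at 0; [a], [b] are the initial values
   that close up the period. *)
pose A := prim h1 T * c + prim h2 T * s.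
pose B := - (prim h1 T * s) + prim h2 T * c.
pose a := (- (A * (c - 1)) + B * s) / D.
pose b := (- (B * (c - 1)) - A * s) / D.
pose u t := (prim h1 t + a) * cos (k * t) + (prim h2 t + b) * sin (k * t).
pose w t := (prim h2 t + b) * cos (k * t) - (prim h1 t + a) * sin (k * t).
have o : oscillates k f g u w.
  move=> t; have dc := cosM_der k t; have ds := sinM_der k t.
  have csE := cos2Dsin2 (k * t).
  have h1E : h1 t = f t * cos (k * t) - g t * sin (k * t) by [].
  have h2E : h2 t = f t * sin (k * t) + g t * cos (k * t) by [].
  split; rewrite /u /w; derE; rewrite h1E h2E.
    rewrite -[X in _ = _ + X]mulr1 -csE; ring.
  rewrite -[X in _ = _ + X]mulr1 -csE; ring.
exists u, w.
have u0 : u T = u 0.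
  rewrite /u mulr0 cos0 sin0 !prim0 !add0r mulr1 mulr0 addr0 -/c -/s.
  apply/(mulIf Dn); have aD : a * D = - (A * (c - 1)) + B * s by rewrite /a divfK.
  have bD : b * D = - (B * (c - 1)) - A * s by rewrite /b divfK.
  have -> : ((prim h1 T + a) * c + (prim h2 T + b) * s) * D = A * D + a * D * c + b * D * s.
    by rewrite /A; ring.
  rewrite aD bD /D -/c -/s.
  by move: (A) (B); clear; move=> A B; ring.
have w0 : w T = w 0.
  rewrite /w mulr0 cos0 sin0 !prim0 !add0r mulr1 mulr0 subr0 -/c -/s.
  apply/(mulIf Dn); have aD : a * D = - (A * (c - 1)) + B * s by rewrite /a divfK.
  have bD : b * D = - (B * (c - 1)) - A * s by rewrite /b divfK.
  have -> : ((prim h2 T + b) * c - (prim h1 T + a) * s) * D = B * D + b * D * c - a * D * s.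
    by rewrite /B; ring.
  rewrite aD bD /D -/c -/s.
  by move: (A) (B); clear; move=> A B; ring.
(* The shift difference solves the homogeneous equation and vanishes at 0, hence everywhere. *)
pose U t := u (t + T) - u t; pose W t := w (t + T) - w t.
have oU : oscillates k (fun=> 0) (fun=> 0) U W.
  move=> t; have [du dw] := o t; have [duT dwT] := o (t + T).
  have dut x := @der_shift _ u _ T (fun t => (o t).1) x.
  have dwt x := @der_shift _ w _ T (fun t => (o t).2) x.
  by split; rewrite /U /W; derE; rewrite ?pf ?pg; ring.
have r1 t : U t * cos (k * t) - W t * sin (k * t) = 0.
  have d0 (x : R) : is_derive x 1 (fun x => U x * cos (k * x) - W x * sin (k * x)) 0.
    by apply: der_eq (rot_der oU x).1 _; rewrite !mul0r subrr.
  by rewrite (der0_cst d0 t 0) mulr0 cos0 sin0 /U /W !add0r u0 w0; ring.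
have r2 t : U t * sin (k * t) + W t * cos (k * t) = 0.
  have d0 (x : R) : is_derive x 1 (fun x => U x * sin (k * x) + W x * cos (k * x)) 0.
    by apply: der_eq (rot_der oU x).2 _; rewrite !mul0r addr0.
  by rewrite (der0_cst d0 t 0) mulr0 cos0 sin0 /U /W !add0r u0 w0; ring.
split=> // t; apply/eqP; rewrite -subr_eq0.
  have -> : u (t + T) - u t = (U t * cos (k * t) - W t * sin (k * t)) * cos (k * t)
    + (U t * sin (k * t) + W t * cos (k * t)) * sin (k * t).
    by rewrite -[LHS]mulr1 -(cos2Dsin2 (k * t)) -/(U t); ring.
  by rewrite r1 r2 !mul0r addr0.
have -> : w (t + T) - w t = - (U t * cos (k * t) - W t * sin (k * t)) * sin (k * t)
    + (U t * sin (k * t) + W t * cos (k * t)) * cos (k * t).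
  by rewrite -[LHS]mulr1 -(cos2Dsin2 (k * t)) -/(W t); ring.
by rewrite r1 r2 oppr0 !mul0r addr0.
Qed.

End Oscillator.

(** * Linearization at the circular orbit *)

Section LinearSolver.
Context {R : realType}.
Implicit Types (f g u w x y z : R -> R) (M t T k a b lam : R).

(* The linearization at the circular orbit in the rotating frame, with a torque multiplier [lam]. *)
Definition planar_system k f1 f2 g1 g2 x1 x2 y1 y2 lam := forall t,
  [/\ is_derive t 1 x1 (x2 t + y1 t + f1 t),
      is_derive t 1 x2 (- x1 t + k ^+ 2 * y2 t + f2 t),
      is_derive t 1 y1 (y2 t + 2 * x1 t + g1 t)
    & is_derive t 1 y2 (- y1 t - x2 t + g2 t - lam)].

(** The sum [x1 + y2], the linearized angular momentum, has derivative [f1 + g2 - lam]; given it,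
    [x1] and [(x2 + y1) / k] form a forced oscillator of frequency [k]. What remains free is a
    constant in [x2], the rotation within the plane, fixed by [mean T x2 = 0]. *)
Lemma planar_bound k T : 0 < T -> 0 < k < 1 -> cos (k * T) != 1 ->
  exists2 C, 0 <= C & forall f1 f2 g1 g2 x1 x2 y1 y2 lam M,
   planar_system k f1 f2 g1 g2 x1 x2 y1 y2 lam ->
   [/\ Tperiodic T x1, Tperiodic T x2, Tperiodic T y1 & Tperiodic T y2] ->
   [/\ continuous f1, continuous f2, continuous g1 & continuous g2] ->
   mean T x2 = 0 ->
   (forall t, [/\ `|f1 t| <= M, `|f2 t| <= M, `|g1 t| <= M & `|g2 t| <= M]) ->
   (forall t, [/\ `|x1 t| <= C * M, `|x2 t| <= C * M, `|y1 t| <= C * M & `|y2 t| <= C * M])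
   /\ `|lam| <= C * M.
Proof.
move=> T0 /andP[k0 k1] ck.
have [C1 C10 oB] := oscillator_bound T0 ck.
(* Per unit of [M], [cI] bounds [x1 + y2], [M'] the forcing of the oscillator, [c1] its solution and
   [c2] the component [x2]. *)
pose cI := 4 * T + 5.
pose M' := 2 * cI / k + 2 / k.
pose c1 := C1 * (1 + M').
pose c2 := (cI + 2 * c1 + 1) * T.
have T0' := ltW T0.
have cI0 : 0 <= cI by rewrite /cI; lra.
have ki0 : 0 < k^-1 by rewrite invr_gt0.
have M'0 : 0 <= M'.
  by rewrite /M' addr_ge0 // mulr_ge0 // ?(ltW ki0) // mulr_ge0.
have c10 : 0 <= c1 by rewrite /c1 mulr_ge0 //; lra.
have c20 : 0 <= c2 by rewrite /c2 mulr_ge0 //; lra.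
exists (2 + cI + 2 * c1 + c2); first lra.
move=> f1 f2 g1 g2 x1 x2 y1 y2 lam M sys [px1 px2 py1 py2] [cf1 cf2 cg1 cg2] mx2 fM.
have dx1 t := let: And4 h _ _ _ := sys t in h.
have dx2 t := let: And4 _ h _ _ := sys t in h.
have dy1 t := let: And4 _ _ h _ := sys t in h.
have dy2 t := let: And4 _ _ _ h := sys t in h.
have cx1 := der_continuous dx1; have cx2 := der_continuous dx2.
have cy1 := der_continuous dy1; have cy2 := der_continuous dy2.
have M0 : 0 <= M by have [h _ _ _] := fM 0; apply: le_trans h.
have lamM : `|lam| <= M + M.
  have -> : lam = mean T (fun t => f1 t + g2 t).
    have := @mean_der _ T (fun t => x1 t + y2 t) (fun t => f1 t + g2 t - lam).
    rewrite mean_sub ?mean_cst //; try by cont.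
    move=> h; apply/esym/eqP; rewrite -subr_eq0; apply/eqP; apply: h.
    - by move=> t; derE; ring.
    - by cont.
    - by move=> t; rewrite px1 py2.
  by apply: mean_bound => //; [cont|move=> t; have [? ? ? ?] := fM t; apply: norm_add_le].
pose I t := x1 t + y2 t.
have dI t : is_derive t 1 I (f1 t + g2 t - lam) by rewrite /I; derE; ring.
have cI' := der_continuous dI.
have pI : Tperiodic T I by move=> t; rewrite /I px1 py2.
have oI := mean_osc T0 dI pI (M := 4 * M).
have mI : `|mean T I| <= 5 * M.
  (* The derivatives of [x2] and of [x2 + y1] have mean 0: two equations for the means of [I] and
     [x1], with determinant [(1 + k^2)^2 - k^4 = 1 + 2 k^2]. *)
  have e1 : k ^+ 2 * mean T I - (1 + k ^+ 2) * mean T x1 + mean T f2 = 0.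
    rewrite -!mean_scale // -mean_sub -?mean_add //; try by cont.
    by apply: (@mean_der _ T x2) => //; [move=> t; apply: der_eq (dx2 t) _; rewrite /I; ring|cont].
  have e2 : - k ^+ 2 * mean T x1 + (1 + k ^+ 2) * mean T I + mean T (fun t => f2 t + g1 t) = 0.
    rewrite -!mean_scale // -!mean_add //; try by cont.
    apply: (@mean_der _ T (fun t => x2 t + y1 t)); first by move=> t; derE; rewrite /I; ring.
      by cont.
    by move=> t; rewrite px2 py1.
  have e3 : (1 + 2 * k ^+ 2) * mean T I = k ^+ 2 * mean T f2 - (1 + k ^+ 2) * mean T (fun t => f2 t + g1 t).
    have -> : mean T f2 = - (k ^+ 2 * mean T I - (1 + k ^+ 2) * mean T x1) by lra.
    have -> : mean T (fun t => f2 t + g1 t) = - (- k ^+ 2 * mean T x1 + (1 + k ^+ 2) * mean T I) by lra.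
    ring.
  have k2 : 0 <= k ^+ 2 <= 1 by rewrite sqr_ge0 expr_le1 // ltW.
  have /andP[k20 k21] := k2.
  have m2 : `|mean T f2| <= M by apply: mean_bound => // t; have [] := fM t.
  have m3 : `|mean T (fun t => f2 t + g1 t)| <= M + M.
    by apply: mean_bound => //; [cont|move=> t; have [? ? ? ?] := fM t; apply: norm_add_le].
  have h1 : `|(1 + 2 * k ^+ 2) * mean T I| <= 1 * M + (1 + 1) * (M + M).
    by rewrite e3; apply: norm_sub_le; apply: norm_mul_le => //; rewrite ger0_norm //; move: k20 k21; clear; lra.
  have : `|mean T I| <= `|(1 + 2 * k ^+ 2) * mean T I|.
    by rewrite [leRHS]normrM ler_peMl // ger0_norm; move: k20; clear; lra.
  move: h1; clear; lra.
have IM t : `|I t| <= cI * M.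
  have -> : I t = (I t - mean T I) + mean T I by ring.
  have -> : cI * M = 4 * M * T + 5 * M by rewrite /cI; ring.
  apply: norm_add_le => //; apply: oI => s; have [? ? ? ?] := fM s.
  have -> : 4 * M = M + M + (M + M) by ring.
  by apply: norm_sub_le => //; apply: norm_add_le.
have osc : oscillates k f1 (fun t => ((1 + k ^+ 2) * I t + f2 t + g1 t) / k) x1
    (fun t => (x2 t + y1 t) / k).
  have kn : k != 0 by rewrite gt_eqF.
  move=> t; split; first by apply: der_eq (dx1 t) _; rewrite mulrC divfK.
  by derE; rewrite /I; field.
have k21 : k ^+ 2 <= 1 by rewrite expr_le1 // ltW.
have M1 : M <= (1 + M') * M by rewrite ler_peMl //; lra.
have xw t : `|x1 t| <= c1 * M /\ `|(x2 t + y1 t) / k| <= c1 * M.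
  have -> : c1 * M = C1 * ((1 + M') * M) by rewrite /c1; ring.
  apply: (oB _ _ _ _ _ osc) => //.
  - by move=> s; rewrite px2 py1.
  - by move=> s; have [h _ _ _] := fM s; apply: le_trans h M1.
  move=> s; have [? ? ? ?] := fM s.
  apply: le_trans (_ : M' * M <= _); last by rewrite ler_wpM2r //; lra.
  have -> : M' * M = (2 * (cI * M) + M + M) * k^-1 by rewrite /M'; ring.
  rewrite normrM (gtr0_norm ki0) ler_pM2r //.
  apply: norm_add_le => //; apply: norm_add_le => //.
  apply: norm_mul_le => //; by rewrite ger0_norm; have := sqr_ge0 k; move: k21; clear; lra.
have x2M t : `|x2 t| <= c2 * M.
  have -> : x2 t = x2 t - mean T x2 by rewrite mx2 subr0.
  have -> : c2 * M = (cI * M + 2 * (c1 * M) + M) * T by rewrite /c2; ring.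
  apply: (mean_osc T0 (f := fun t => k ^+ 2 * I t - (1 + k ^+ 2) * x1 t + f2 t)) => //.
    by move=> s; apply: der_eq (dx2 s) _; rewrite /I; ring.
  move=> s; have [? ? ? ?] := fM s.
  apply: norm_add_le => //.
  apply: norm_sub_le.
    rewrite -(mul1r (cI * M)); apply: norm_mul_le => //.
    by rewrite ger0_norm ?sqr_ge0.
  apply: norm_mul_le; last by have [] := xw s.
  by rewrite ger0_norm; have := sqr_ge0 k; move: k21; clear; lra.
have cIM : 0 <= cI * M by rewrite mulr_ge0.
have c1M : 0 <= c1 * M by rewrite mulr_ge0.
have c2M : 0 <= c2 * M by rewrite mulr_ge0.
have CE : (2 + cI + 2 * c1 + c2) * M = (M + M) + cI * M + (c1 * M + c1 * M) + c2 * M by ring.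
rewrite CE; split; last lra.
move=> t; have [hx1 hw] := xw t; have hx2 := x2M t; have hI := IM t.
split; [move: hx1 cIM c1M c2M M0; clear; lra|move: hx2 cIM c1M c2M M0; clear; lra| |].
  have -> : y1 t = (x2 t + y1 t) / k * k - x2 t by rewrite divfK ?gt_eqF //; ring.
  have : `|(x2 t + y1 t) / k * k - x2 t| <= c1 * M * 1 + c2 * M.
    apply: norm_sub_le => //; apply: norm_mul_le => //.
    by rewrite ger0_norm ltW.
  move: cIM c1M c2M M0; clear; lra.
have -> : y2 t = I t - x1 t by rewrite /I; ring.
have := norm_sub_le hI hx1; move: cIM c1M c2M M0; clear; lra.
Qed.

Lemma planar_exists k T f1 f2 g1 g2 : 0 < T -> 0 < k < 1 -> cos (k * T) != 1 ->
  [/\ continuous f1, continuous f2, continuous g1 & continuous g2] ->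
  [/\ Tperiodic T f1, Tperiodic T f2, Tperiodic T g1 & Tperiodic T g2] ->
  exists x1 x2 y1 y2 lam, [/\ planar_system k f1 f2 g1 g2 x1 x2 y1 y2 lam,
   [/\ Tperiodic T x1, Tperiodic T x2, Tperiodic T y1 & Tperiodic T y2] &
   mean T x2 = 0].
Proof.
move=> T0 /andP[k0 k1] ck [cf1 cf2 cg1 cg2] [pf1 pf2 pg1 pg2].
have kn : k != 0 by rewrite gt_eqF.
pose h t := f1 t + g2 t.
have ch : continuous h by rewrite /h; cont.
have ph : Tperiodic T h by move=> t; rewrite /h pf1 pg2.
have [J [dJ pJ mJ]] := antiderivative_exists T0 ch ph.
have cJ := der_continuous dJ.
pose g t := ((1 + k ^+ 2) * J t + f2 t + g1 t) / k.
have cg : continuous g by rewrite /g; cont.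
have pg : Tperiodic T g by move=> t; rewrite /g pJ pf2 pg1.
have [u [w [osc pu pw]]] := oscillator_exists T0 ck cf1 cg pf1 pg.
have du t := (osc t).1; have dw t := (osc t).2.
have cu := der_continuous du; have cw := der_continuous dw.
pose q t := k ^+ 2 * J t - (1 + k ^+ 2) * u t + f2 t.
(* [c] is the mean of [x1 + y2]. It moves the equilibrium of [x1] by [(1 + k^2) / k^2 * c], and this
   value is the one for which the derivative [r] of [x2] has mean 0. *)
pose c := k ^+ 2 / (1 + 2 * k ^+ 2) * mean T q.
have cq : continuous q by rewrite /q; cont.
pose r t := q t + (k ^+ 2 - (1 + k ^+ 2) ^+ 2 / k ^+ 2) * c.
have cr : continuous r by rewrite /r; cont.
have pr : Tperiodic T r by move=> t; rewrite /r /q pJ pu pf2.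
have mr : mean T r = 0.
  rewrite /r mean_add ?mean_cst //; try by cont.
  rewrite /c; have : 1 + 2 * k ^+ 2 != 0 by rewrite gt_eqF //; have := sqr_ge0 k; lra.
  by move: (mean T q) => m dn; field; rewrite dn.
have [x2 [dx2 px2 mx2]] := antiderivative_exists T0 cr pr.
pose x1 t := u t + (1 + k ^+ 2) / k ^+ 2 * c.
pose y1 t := k * w t - x2 t.
pose y2 t := J t + c - x1 t.
exists x1, x2, y1, y2, (mean T h); split=> //; last first.
  by split=> // t; rewrite /x1 /y1 /y2 /x1 ?pu ?pw ?px2 ?pJ.
move=> t; split.
- by rewrite /x1; derE; rewrite /y1; ring.
- by derE; rewrite mr /r /q /x1 /y2 /x1; field.
- by rewrite /y1; derE; rewrite mr /r /q /g /y2 /x1; field.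
- by rewrite /y2 /x1; derE; rewrite /h /y1; ring.
Qed.

(** Motion out of the plane has frequency 1, that of the orbit, and is always resonant. The torque
    components [a], [b], which tilt the plane, absorb the resonant part of the forcing. *)
Definition vertical_system f g z y a b := forall t,
  is_derive t 1 z (y t + f t) /\
  is_derive t 1 y (- z t + g t - a * cos t - b * sin t).

Lemma mean_trig T : 0 < T -> Tperiodic T (@cos R) -> Tperiodic T (@sin R) ->
  [/\ mean T (fun t : R => cos t * cos t) = 1 / 2, mean T (fun t : R => sin t * sin t) = 1 / 2
    & mean T (fun t : R => sin t * cos t) = 0].
Proof.
move=> T0 pc ps.
have m1 : mean T (fun t : R => cos t * cos t - 1 / 2) = 0.
  apply: (@mean_der _ T (fun t => 1 / 2 * (sin t * cos t))); try by cont.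
    by move=> t; derE; have := cos2Dsin2 t; rewrite !expr2; lra.
  by move=> t; rewrite pc ps.
have m3 : mean T (fun t : R => sin t * cos t) = 0.
  apply: (@mean_der _ T (fun t => 1 / 2 * (sin t * sin t))); try by cont.
    by move=> t; derE; rewrite /=; lra.
  by move=> t; rewrite ps.
have cc : mean T (fun t : R => cos t * cos t) = 1 / 2.
  move: m1; rewrite mean_sub ?mean_cst //; try by cont.
  lra.
split=> //.
have -> : (fun t : R => sin t * sin t) = (fun t => 1 - cos t * cos t).
  by apply/funext => t; have := cos2Dsin2 t; rewrite !expr2; lra.
by rewrite mean_sub ?mean_cst // ?cc; [lra|cont|cont].
Qed.

Lemma vertical_rot_der f g z y a b : vertical_system f g z y a b -> forall t,
  is_derive t 1 (fun s => z s * cos s - y s * sin s)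
    (f t * cos t - g t * sin t + a * (sin t * cos t) + b * (sin t * sin t)) /\
  is_derive t 1 (fun s => z s * sin s + y s * cos s)
    (f t * sin t + g t * cos t - a * (cos t * cos t) - b * (sin t * cos t)).
Proof.
move=> o t; have [du dw] := o t.
by split; derE; rewrite /=; ring.
Qed.

(** In the frame rotating by [t] the system is a pure integration: vanishing means of the
    derivatives determine [a] and [b], and the two constants of integration, tilts of the plane, are
    fixed by the conditions on [z]. *)
Lemma vertical_bound T : 0 < T -> Tperiodic T (@cos R) -> Tperiodic T (@sin R) ->
  exists2 C, 0 <= C & forall f g z y a b M, vertical_system f g z y a b ->
   Tperiodic T z -> Tperiodic T y -> continuous f -> continuous g ->
   mean T (fun t => z t * cos t) = 0 -> mean T (fun t => z t * sin t) = 0 ->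
   (forall t, `|f t| <= M /\ `|g t| <= M) ->
   (forall t, `|z t| <= C * M /\ `|y t| <= C * M) /\ (`|a| <= C * M /\ `|b| <= C * M).
Proof.
move=> T0 pc ps; have [mcc mss msc] := mean_trig T0 pc ps.
have cc : continuous (fun t : R => cos t * cos t) by cont.
have css : continuous (fun t : R => sin t * sin t) by cont.
have csc : continuous (fun t : R => sin t * cos t) by cont.
(* [4 M] bounds [a] and [b]. The rotated coordinates oscillate by [10 M T] about means of size
   [40 M T], so [z] and [y] are at most [2 * 50 M T]. *)
exists (4 + 100 * T); first by lra.
move=> f g z y a b M o pz py cf cg mzc mzs fM.
have M0 : 0 <= M by have [h _] := fM 0; apply: le_trans h.
have dz t := (o t).1; have dy t := (o t).2.
have cz := der_continuous dz; have cy := der_continuous dy.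
pose A t := z t * cos t - y t * sin t; pose B t := z t * sin t + y t * cos t.
have dA t : is_derive t 1 A _ := (vertical_rot_der o t).1.
have dB t : is_derive t 1 B _ := (vertical_rot_der o t).2.
have cA := der_continuous dA; have cB := der_continuous dB.
have pA : Tperiodic T A by move=> t; rewrite /A pz py pc ps.
have pB : Tperiodic T B by move=> t; rewrite /B pz py pc ps.
have bE : b = - 2 * mean T (fun t => f t * cos t - g t * sin t).
  have := mean_der dA ltac:(by cont) pA.
  rewrite !mean_add ?mean_scale ?mss ?msc //; try by cont.
  lra.
have aE : a = 2 * mean T (fun t => f t * sin t + g t * cos t).
  have := mean_der dB ltac:(by cont) pB.
  rewrite !(mean_sub,mean_scale) ?mcc ?msc //; try by cont.
  lra.
have bM : `|b| <= 2 * (M + M).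
  rewrite bE; apply: norm_mul_le; first by rewrite normrN ger0_norm.
  apply: mean_bound => //; [by cont|move=> t; have [? ?] := fM t].
  by apply: norm_sub_le; [exact: norm_mul_cos_le|exact: norm_mul_sin_le].
have aM : `|a| <= 2 * (M + M).
  rewrite aE; apply: norm_mul_le; first by rewrite ger0_norm.
  apply: mean_bound => //; [by cont|move=> t; have [? ?] := fM t].
  by apply: norm_add_le; [exact: norm_mul_sin_le|exact: norm_mul_cos_le].
have oA t : `|A t - mean T A| <= 10 * M * T.
  apply: (mean_osc T0 dA pA) => s; have [? ?] := fM s.
  have -> : 10 * M = M + M + 2 * (M + M) + 2 * (M + M) by ring.
  rewrite !(mulrA _ (sin s)).
  by do !(apply: norm_sub_le || apply: norm_add_le || apply: norm_mul_cos_le || apply: norm_mul_sin_le).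
have oB t : `|B t - mean T B| <= 10 * M * T.
  apply: (mean_osc T0 dB pB) => s; have [? ?] := fM s.
  have -> : 10 * M = M + M + 2 * (M + M) + 2 * (M + M) by ring.
  rewrite !(mulrA _ (sin s)) !(mulrA _ (cos s)).
  by do !(apply: norm_sub_le || apply: norm_add_le || apply: norm_mul_cos_le || apply: norm_mul_sin_le).
have zE t : z t = A t * cos t + B t * sin t.
  by rewrite /A /B -[LHS]mulr1 -(cos2Dsin2 t); ring.
have yE t : y t = B t * cos t - A t * sin t.
  by rewrite /A /B -[LHS]mulr1 -(cos2Dsin2 t); ring.
(* As [z] is [mean A * cos + mean B * sin + r], pairing it with [cos] and with [sin] expresses the
   means of [A] and [B] through [r]. *)
pose r t := (A t - mean T A) * cos t + (B t - mean T B) * sin t.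
have cr : continuous r by rewrite /r; cont.
have osc2 s : `|r s| <= 20 * M * T.
  have -> : 20 * M * T = 10 * M * T + 10 * M * T by ring.
  by apply: norm_add_le; [exact: norm_mul_cos_le|exact: norm_mul_sin_le].
have half (m c e : R) : m * (1 / 2) + c * 0 + e = 0 -> m = - 2 * e by lra.
have mAM : `|mean T A| <= 40 * M * T.
  have h : mean T (fun t => mean T A * (cos t * cos t) + mean T B * (sin t * cos t) +
      r t * cos t) = 0.
    by rewrite -mzc; congr mean; apply/funext => t; rewrite (zE t) /r; ring.
  rewrite mean_add in h; [|cont|cont].
  rewrite mean_add in h; [|cont|cont].
  rewrite (mean_scale _ _ cc) (mean_scale _ _ csc) mcc msc in h.
  rewrite (half _ _ _ h); have -> : 40 * M * T = 2 * (20 * M * T) by ring.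
  apply: norm_mul_le; first by rewrite normrN ger0_norm.
  apply: mean_bound => //; [by cont|by move=> s; apply: norm_mul_cos_le].
have mBM : `|mean T B| <= 40 * M * T.
  have h : mean T (fun t => mean T B * (sin t * sin t) + mean T A * (sin t * cos t) +
      r t * sin t) = 0.
    by rewrite -mzs; congr mean; apply/funext => t; rewrite (zE t) /r; ring.
  rewrite mean_add in h; [|cont|cont].
  rewrite mean_add in h; [|cont|cont].
  rewrite (mean_scale _ _ css) (mean_scale _ _ csc) mss msc in h.
  rewrite (half _ _ _ h); have -> : 40 * M * T = 2 * (20 * M * T) by ring.
  apply: norm_mul_le; first by rewrite normrN ger0_norm.
  apply: mean_bound => //; [by cont|by move=> s; apply: norm_mul_sin_le].
have AM t : `|A t| <= 50 * M * T.
  have -> : A t = (A t - mean T A) + mean T A by ring.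
  have -> : 50 * M * T = 10 * M * T + 40 * M * T by ring.
  exact: norm_add_le.
have BM t : `|B t| <= 50 * M * T.
  have -> : B t = (B t - mean T B) + mean T B by ring.
  have -> : 50 * M * T = 10 * M * T + 40 * M * T by ring.
  exact: norm_add_le.
have MT : 0 <= M * T by rewrite mulr_ge0 // ltW.
have CE : (4 + 100 * T) * M = 4 * M + (50 * M * T + 50 * M * T) by ring.
rewrite CE; split; last by split; lra.
move=> t; split.
  have := norm_add_le (norm_mul_cos_le t (AM t)) (norm_mul_sin_le t (BM t)); rewrite -zE; lra.
have := norm_sub_le (norm_mul_cos_le t (BM t)) (norm_mul_sin_le t (AM t)); rewrite -yE; lra.
Qed.

Lemma vertical_exists T f g : 0 < T -> Tperiodic T (@cos R) -> Tperiodic T (@sin R) ->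
  continuous f -> continuous g -> Tperiodic T f -> Tperiodic T g ->
  exists z y a b, [/\ vertical_system f g z y a b, Tperiodic T z, Tperiodic T y,
    mean T (fun t => z t * cos t) = 0 & mean T (fun t => z t * sin t) = 0].
Proof.
move=> T0 pc ps cf cg pf pg; have [mcc mss msc] := mean_trig T0 pc ps.
have cc : continuous (fun t : R => cos t * cos t) by cont.
have css : continuous (fun t : R => sin t * sin t) by cont.
have csc : continuous (fun t : R => sin t * cos t) by cont.
pose b := - 2 * mean T (fun t => f t * cos t - g t * sin t).
pose a := 2 * mean T (fun t => f t * sin t + g t * cos t).
pose h1 t := f t * cos t - g t * sin t + a * (sin t * cos t) + b * (sin t * sin t).
pose h2 t := f t * sin t + g t * cos t - a * (cos t * cos t) - b * (sin t * cos t).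
have ch1 : continuous h1 by rewrite /h1; cont.
have ch2 : continuous h2 by rewrite /h2; cont.
have ph1 : Tperiodic T h1 by move=> t; rewrite /h1 pf pg pc ps.
have ph2 : Tperiodic T h2 by move=> t; rewrite /h2 pf pg pc ps.
have mh1 : mean T h1 = 0.
  rewrite /h1 mean_add; [|cont|cont].
  rewrite mean_add; [|cont|cont].
  rewrite (mean_scale _ _ css) (mean_scale _ _ csc) mss msc /b.
  by move: (mean T _); clear; move=> m; lra.
have mh2 : mean T h2 = 0.
  rewrite /h2 mean_sub; [|cont|cont].
  rewrite mean_sub; [|cont|cont].
  rewrite (mean_scale _ _ cc) (mean_scale _ _ csc) mcc msc /a.
  by move: (mean T _); clear; move=> m; lra.
have [A [dA pA mA]] := antiderivative_exists T0 ch1 ph1.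
have [B [dB pB mB]] := antiderivative_exists T0 ch2 ph2.
have cA := der_continuous dA; have cB := der_continuous dB.
pose q t := A t * cos t + B t * sin t.
have cq : continuous q by rewrite /q; cont.
(* Adding the homogeneous solution [A0 * cos + B0 * sin] cancels the pairings of [q] with [cos] and
   [sin]. *)
pose A0 := - 2 * mean T (fun t => q t * cos t).
pose B0 := - 2 * mean T (fun t => q t * sin t).
exists (fun t => (A t + A0) * cos t + (B t + B0) * sin t),
  (fun t => (B t + B0) * cos t - (A t + A0) * sin t), a, b; split.
- move=> t; have csE := cos2Dsin2 t; split; derE; rewrite mh1 mh2 /h1 /h2.
    by rewrite -[X in _ = _ + X]mulr1 -csE; ring.
  apply/eqP; rewrite -subr_eq0; apply/eqP.
  transitivity ((g t - a * cos t - b * sin t) * (cos t ^+ 2 + sin t ^+ 2 - 1)).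
    by ring.
  by rewrite csE subrr mulr0.
- by move=> t; rewrite pA pB pc ps.
- by move=> t; rewrite pA pB pc ps.
- have -> : (fun t => ((A t + A0) * cos t + (B t + B0) * sin t) * cos t) =
     (fun t => A0 * (cos t * cos t) + B0 * (sin t * cos t) + q t * cos t).
    by apply/funext => t; rewrite /q; ring.
  rewrite mean_add; [|cont|cont].
  rewrite mean_add; [|cont|cont].
  rewrite (mean_scale _ _ cc) (mean_scale _ _ csc) mcc msc {1}/A0.
  by move: (mean T _); clear; move=> m; lra.
- have -> : (fun t => ((A t + A0) * cos t + (B t + B0) * sin t) * sin t) =
     (fun t => A0 * (sin t * cos t) + B0 * (sin t * sin t) + q t * sin t).
    by apply/funext => t; rewrite /q; ring.
  rewrite mean_add; [|cont|cont].
  rewrite mean_add; [|cont|cont].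
  rewrite (mean_scale _ _ css) (mean_scale _ _ csc) mss msc {1}/B0.
  by move: (mean T _); clear; move=> m; lra.
Qed.

End LinearSolver.

(** * Fixed points in the sup norm *)

Section Contraction.
Context {R : realType} (Z : Type).
Implicit Types (u v : Z -> R).

Lemma geometric_lt (B e : R) : 0 < e -> exists n : nat, B / 2 ^+ n < e.
Proof.
move=> e0; have [n hn] : exists n : nat, `|B| / e < n%:R.
  by exists (Num.bound (`|B| / e)); apply: archi_boundP; rewrite divr_ge0 // ltW.
exists n; have n2 : n%:R <= (2 ^+ n : R).
  by rewrite -natrX ler_nat ltnW // ltn_expl.
rewrite ltr_pdivrMr ?exprn_gt0 // (le_lt_trans (ler_norm B)) //.
by rewrite ltr_pdivrMr // in hn; apply: (lt_le_trans hn); rewrite mulrC ler_pM2l.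
Qed.

(** Iterating the step drives the a priori bound [B] to the fixed point [2 K] of [M |-> M / 2 + K].
    It serves to compare the fixed points of two nearby maps. *)
Lemma halving_bound u (K B : R) : (forall z, `|u z| <= B) ->
  (forall M, (forall z, `|u z| <= M) -> forall z, `|u z| <= M / 2 + K) ->
  forall z, `|u z| <= 2 * K.
Proof.
move=> uB step z; rewrite leNgt; apply/negP => uK.
have H n : forall z, `|u z| <= B / 2 ^+ n + 2 * K * (1 - 2^-1 ^+ n).
  elim: n => [|n ih] y; first by rewrite !expr0 divr1 subrr mulr0 addr0.
  apply: le_trans (step _ ih y) _; rewrite !exprS exprVn invfM.
  by rewrite le_eqVlt; apply/orP; left; apply/eqP; field; rewrite expf_neq0.
have [n hn] := @geometric_lt (B - 2 * K) (`|u z| - 2 * K) ltac:(by rewrite subr_gt0).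
have := H n z; rewrite exprVn; move: hn; rewrite mulrBl; lra.
Qed.

(** Banach's theorem with pointwise bounds in place of a norm: [D] is closed under uniform limits,
    and its diameter [B] starts the geometric decay. *)
Lemma sup_contraction (D : (Z -> R) -> Prop) (F : (Z -> R) -> Z -> R) u0 (B : R) :
  D u0 -> (forall u, D u -> D (F u)) ->
  (forall (un : nat -> Z -> R) u, (forall n, D (un n)) ->
     (forall e, 0 < e -> exists N, forall n, (N <= n)%N -> forall z, `|un n z - u z| <= e) -> D u) ->
  (forall u v, D u -> D v -> forall z, `|u z - v z| <= B) ->
  (forall u v M, D u -> D v -> (forall z, `|u z - v z| <= M) ->
     forall z, `|F u z - F v z| <= M / 2) ->
  exists2 u, D u & F u = u.
Proof.
move=> D0 DF Dcl DB ctr.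
pose un n := iter n F u0.
have Dn n : D (un n) by elim: n => //= n ih; exact: DF.
have near n k z : `|un (n + k)%N z - un n z| <= B / 2 ^+ n.
  elim: n z => [|n ih] z; first by rewrite expr0 divr1; apply: DB.
  rewrite exprS invfM mulrCA mulrC.
  by apply: (ctr (un (n + k)%N) (un n)) => // y; exact: ih.
have cv z : cvgn (fun n => un n z).
  apply/cauchy_cvgP/cauchy_exP => e e0.
  have [n hn] := geometric_lt B e0.
  exists (un n z); exists n => // m /= nm.
  rewrite /ball /= distrC -(subnKC nm); exact: le_lt_trans (near n (m - n)%N z) hn.
pose u z := limn (fun n => un n z).
have un_u n z : `|un n z - u z| <= B / 2 ^+ n.
  rewrite distrC.
  have cl : ((fun k => `|un k z - un n z|) @ \oo --> `|u z - un n z|).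
    apply: cvg_norm; apply: cvgB; [exact: cv|exact: cvg_cst].
  rewrite -(cvg_lim _ cl) //; apply: limr_le; first by apply/cvg_ex; eexists; exact: cl.
  by exists n => // m /= nm; rewrite -(subnKC nm); exact: near.
have Du : D u.
  apply: (Dcl un u Dn) => e e0; have [N hN] := geometric_lt B e0.
  exists N => n Nn z; rewrite -(subnKC Nn).
  have B0 : 0 <= B by apply: le_trans (DB u0 u0 D0 D0 z).
  apply: le_trans (un_u _ z) _; apply: le_trans (ltW hN).
  by rewrite ler_wpM2l // lef_pV2 ?posrE ?exprn_gt0 // ler_weXn2l ?leq_addr // ler1n.
exists u => //; apply/funext => z; apply/eqP; rewrite -subr_eq0 -normr_le0.
apply/ler_addgt0Pl => e e0; rewrite addr0.
have [n hn] := @geometric_lt B (e / 2) ltac:(by rewrite divr_gt0).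
have h1 := un_u n.+1 z.
have h2 : `|F u z - un n.+1 z| <= B / 2 ^+ n / 2.
  by apply: (ctr u (un n)) => // y; rewrite distrC.
have -> : F u z - u z = (F u z - un n.+1 z) + (un n.+1 z - u z) by ring.
apply: le_trans (norm_add_le h2 h1) _.
have -> : B / 2 ^+ n.+1 = B / 2 ^+ n / 2 by rewrite exprS invfM mulrCA mulrC.
lra.
Qed.

End Contraction.

(** * Radial profiles near 1 *)

Section Radial.
Context {R : realType}.
Implicit Types (phi k : R -> R) (b r t : R).

(** The mean value inequality for [phi - phi'(1) x], whose derivative is small near 1. Both points
    are free because the contraction compares two arbitrary nearby curves. *)
Lemma strict_derivative phi (phi' : R -> R) (r0 : R) : 0 < r0 ->
  (forall s, `|s - 1| < r0 -> is_derive s 1 phi (phi' s)) ->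
  {for 1, continuous phi'} ->
  forall e, 0 < e -> exists2 r, 0 < r & forall s t, `|s - 1| <= r -> `|t - 1| <= r ->
    `|phi s - phi t - phi' 1 * (s - t)| <= e * `|s - t|.
Proof.
move=> r00 dphi cphi e e0.
have H : \forall x \near nbhs (1 : R), `|phi' 1 - phi' x| <= e.
  exact: (@cvgr_dist_le _ _ _ _ _ _ _ cphi e e0).
have [r1 /= r10 hr1] := (nbhs_ballP _ _).1 H.
pose r := Num.min (r0 / 2) (r1 / 2).
have rr0 : r < r0 by rewrite gt_min; apply/orP; left; lra.
have rr1 : r < r1 by rewrite gt_min; apply/orP; right; lra.
exists r; first by rewrite lt_min !divr_gt0.
have main s t : s <= t -> `|s - 1| <= r -> `|t - 1| <= r ->
    `|phi t - phi s - phi' 1 * (t - s)| <= e * `|t - s|.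
  move=> st sr tr; rewrite (ger0_norm (_ : 0 <= t - s)) ?subr_ge0 //.
  pose g x := phi x - phi' 1 * x.
  have -> : phi t - phi s - phi' 1 * (t - s) = g t - g s by rewrite /g; ring.
  have rng x : s <= x <= t -> `|x - 1| <= r.
    by move=> /andP[? ?]; move: sr tr; rewrite !ler_norml => /andP[? ?] /andP[? ?]; lra.
  apply: (@der_lip_seg _ g (fun x => phi' x - phi' 1)) => // x /rng xr.
    have dx : is_derive x 1 phi (phi' x) by apply: dphi; apply: le_lt_trans rr0.
    by rewrite /g; derE; ring.
  by rewrite distrC; apply: hr1; rewrite /ball /= distrC; apply: le_lt_trans rr1.
move=> s t sr tr; have [st|/ltW ts] := leP s t; last exact: main.
have -> : phi s - phi t - phi' 1 * (s - t) = - (phi t - phi s - phi' 1 * (t - s)) by ring.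
by rewrite normrN (distrC s); exact: main.
Qed.

(* [x |-> phi (|x|^2) x] is the gradient of [x |-> k (|x|^2)], because k' = phi / 2. *)
Definition radial_profile phi k b := phi 1 = 1 /\ exists phi' r0, [/\ phi' 1 = b,
  {for 1, continuous phi'}, 0 < r0 &
  forall s, `|s - 1| < r0 -> is_derive s 1 phi (phi' s) /\ is_derive s 1 k (phi s / 2)].

Lemma radial_profile_kinetic (a : R) : 0 < a < 1 ->
  radial_profile (fun s => (Num.sqrt (a + (1 - a) * s))^-1)
    (fun s => Num.sqrt (a + (1 - a) * s) / (1 - a)) (- ((1 - a) / 2)).
Proof.
move=> /andP[a0 a1].
have q1 : Num.sqrt (a + (1 - a) * 1) = 1 :> R by rewrite mulr1 addrC subrK sqrtr1.
split; first by rewrite q1 invr1.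
pose q (s : R) : R := Num.sqrt (a + (1 - a) * s).
have cq : continuous q.
  move=> s; apply: continuous_comp; last exact: sqrt_continuous.
  by apply: (_ : continuous (fun s => a + (1 - a) * s)); cont.
exists (fun s => - (q s)^-1 ^+ 2 * ((1 - a) * (2 * q s)^-1)), 1; split=> //.
- by rewrite /q q1 mulr1 invr1 expr1n; ring.
- have qn : q 1 != 0 by rewrite /q q1 oner_neq0.
  rewrite /=; apply: (@continuousM _ _ (fun s => - (q s)^-1 ^+ 2) (fun s => (1 - a) * (2 * q s)^-1)).
    apply: continuousN; apply: (@continuous_comp _ _ _ (fun s => (q s)^-1) (fun s => s ^+ 2)).
      by apply: continuousV => //; exact: cq.
    exact: exprn_continuous.
  apply: (@continuousM _ _ (cst (1 - a))); first exact: cst_continuous.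
  apply: continuousV; first by rewrite mulf_neq0.
  by apply: (@continuousM _ _ (cst 2)); [exact: cst_continuous|exact: cq].
move=> s s1.
have s0 : 0 < a + (1 - a) * s.
  move: s1; rewrite ltr_norml => /andP[s1 s2].
  have : 0 < (1 - a) * s by rewrite mulr_gt0 //; lra.
  lra.
have dl : is_derive s 1 (fun s => a + (1 - a) * s) (1 - a) by derE; ring.
have dq : is_derive s 1 q ((2 * q s)^-1 * (1 - a)).
  have ds := is_derive1_sqrt s0.
  exact: (@der_comp _ Num.sqrt _ s _ _ ds dl).
have qs0 : 0 < q s by rewrite sqrtr_gt0.
split.
  apply: der_eq (is_deriveV (lt0r_neq0 qs0) dq) _.
  by rewrite exprVn /GRing.scale /=; ring.
have a1n : 1 - a != 0 by lra.
by rewrite -/(q s); derE; field; rewrite a1n gt_eqF.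
Qed.

Lemma radial_profile_kepler :
  radial_profile (fun s : R => (s * Num.sqrt s)^-1) (fun s : R => - (Num.sqrt s)^-1) (- (3 / 2)).
Proof.
split; first by rewrite sqrtr1 mulr1 invr1.
pose q (s : R) : R := Num.sqrt s.
have cq : continuous q by move=> s; exact: sqrt_continuous.
exists (fun s : R => - (s * q s)^-1 ^+ 2 * (q s + s * (2 * q s)^-1)), 1; split=> //.
- by rewrite /q sqrtr1; lra.
- have qn : q 1 != 0 by rewrite /q sqrtr1 oner_neq0.
  rewrite /=; apply: (@continuousM _ _ (fun s : R => - (s * q s)^-1 ^+ 2) (fun s : R => q s + s * (2 * q s)^-1)).
    apply: continuousN; apply: (@continuous_comp _ _ _ (fun s : R => (s * q s)^-1) (fun s : R => s ^+ 2)).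
      apply: continuousV; first by rewrite mul1r.
      by apply: (_ : continuous (fun s : R => s * q s)); cont.
    exact: exprn_continuous.
  apply: (@continuousD _ _ _ q); first exact: cq.
  apply: (@continuousM _ _ id); first exact: cvg_id.
  apply: continuousV; first by rewrite mulf_neq0.
  by apply: (@continuousM _ _ (cst 2)); [exact: cst_continuous|exact: cq].
move=> s s1.
have s0 : 0 < s by move: s1; rewrite ltr_norml => /andP[s1 s2]; lra.
have dq : is_derive s 1 q (2 * q s)^-1 by exact: is_derive1_sqrt.
have qs0 : 0 < q s by rewrite sqrtr_gt0.
have sn : s != 0 by rewrite gt_eqF.
have qn : q s != 0 by rewrite gt_eqF.
have dp : is_derive s 1 (fun s : R => s * q s) (q s + s * (2 * q s)^-1) by derE; ring.
have pn : s * q s != 0 by rewrite mulf_neq0.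
split.
  have dV := @is_deriveV R (fun s : R => s * q s) s _ 1 pn dp.
  by apply: (der_eq dV); rewrite exprVn.
have dV := der_opp (@is_deriveV R q s _ 1 qn dq).
apply: (der_eq dV).
have qq : s = q s ^+ 2 by rewrite sqr_sqrtr // ltW.
rewrite -/(q s) /GRing.scale /=.
by move: (q s) qq qn {dp dV dq sn pn qs0} => w -> wn; field.
Qed.

End Radial.

(** * Inner product and coordinatewise estimates *)

Section Dot.
Context {R : realType} (d : nat).
Implicit Types (x y z e : 'rV[R]_d) (A : 'M[R]_d) (a b M : R).

Definition dot x y : R := (x *m y^T) 0 0.

Lemma dotE x y : dot x y = \sum_i x 0 i * y 0 i.
Proof. by rewrite /dot mxE; apply: eq_bigr => i _; rewrite mxE. Qed.

Lemma dotC x y : dot x y = dot y x.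
Proof. by rewrite !dotE; apply: eq_bigr => i _; rewrite mulrC. Qed.

Lemma dotDl x y z : dot (x + y) z = dot x z + dot y z.
Proof. by rewrite /dot mulmxDl mxE. Qed.

Lemma dotNl x y : dot (- x) y = - dot x y.
Proof. by rewrite /dot mulNmx mxE. Qed.

Lemma dotBl x y z : dot (x - y) z = dot x z - dot y z.
Proof. by rewrite dotDl dotNl. Qed.

Lemma dotZl a x y : dot (a *: x) y = a * dot x y.
Proof. by rewrite /dot -scalemxAl mxE. Qed.

Lemma dotDr x y z : dot x (y + z) = dot x y + dot x z.
Proof. by rewrite !(dotC x) dotDl. Qed.

Lemma dotBr x y z : dot x (y - z) = dot x y - dot x z.
Proof. by rewrite !(dotC x) dotBl. Qed.

Lemma dotNr x y : dot x (- y) = - dot x y.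
Proof. by rewrite !(dotC x) dotNl. Qed.

Lemma dotZr a x y : dot x (a *: y) = a * dot x y.
Proof. by rewrite !(dotC x) dotZl. Qed.

Lemma dot_mulmx x y A : dot (x *m A) y = dot x (y *m A^T).
Proof. by rewrite /dot trmx_mul trmxK mulmxA. Qed.

Lemma dot_ge0 x : 0 <= dot x x.
Proof. by rewrite dotE sumr_ge0 // => i _; rewrite -expr2 sqr_ge0. Qed.

Lemma sqr_coord_le x i : x 0 i ^+ 2 <= dot x x.
Proof.
rewrite dotE (bigD1 i) //= -expr2 lerDl sumr_ge0 // => j _.
by rewrite -expr2 sqr_ge0.
Qed.

Lemma unit_coord_le1 e : dot e e = 1 -> forall i, `|e 0 i| <= 1.
Proof.
move=> e1 i; rewrite -(@expr_le1 _ 2) // real_normK ?num_real // -e1.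
exact: sqr_coord_le.
Qed.

Lemma norm_sum_le n (f : 'I_n -> R) a : (forall i, `|f i| <= a) ->
  `|\sum_i f i| <= n%:R * a.
Proof.
move=> fa; apply: le_trans (ler_norm_sum _ _ _) _.
apply: le_trans (ler_sum _ (fun i _ => fa i)) _.
by rewrite sumr_const card_ord -[X in X <= _]mulr_natl.
Qed.

(** Vectors are estimated by their largest coordinate throughout, at the price of a factor [d] for
    each sum. *)
Lemma norm_dot_le x y a b : (forall i, `|x 0 i| <= a) -> (forall i, `|y 0 i| <= b) ->
  `|dot x y| <= d%:R * (a * b).
Proof. by move=> xa yb; rewrite dotE; apply: norm_sum_le => i; apply: norm_mul_le. Qed.

Lemma norm_mulmx_le x A a b : (forall i, `|x 0 i| <= a) ->
  (forall i j, `|A i j| <= b) -> forall j, `|(x *m A) 0 j| <= d%:R * (a * b).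
Proof. by move=> xa yb j; rewrite mxE; apply: norm_sum_le => i; apply: norm_mul_le. Qed.

End Dot.

(** * Radial vector fields near the unit sphere *)

Section RadialVector.
Context {R : realType} (d : nat).
Implicit Types (x y z e : 'rV[R]_d) (a b M : R) (phi k : R -> R).

Lemma dot_sub_dot x y : dot x x - dot y y = dot (x - y) (x + y).
Proof. by rewrite dotBl !dotDr (dotC y x); ring. Qed.

Lemma near_unit_bound e x r : dot e e = 1 -> r <= 1 ->
  (forall i, `|x 0 i - e 0 i| <= r) -> forall i, `|x 0 i| <= 2.
Proof.
move=> e1 r1 h i; rewrite -(subrK (e 0 i) (x 0 i)).
apply: le_trans (norm_add_le (h i) (unit_coord_le1 e1 i)) _; lra.
Qed.

Lemma near_unit_normsq e x r : dot e e = 1 -> r <= 1 ->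
  (forall i, `|x 0 i - e 0 i| <= r) -> `|dot x x - 1| <= d%:R * (r * 3).
Proof.
move=> e1 r1 h; have -> : dot x x - 1 = dot (x - e) (x + e) by rewrite -dot_sub_dot e1.
apply: norm_dot_le => i; rewrite !mxE //.
have -> : x 0 i + e 0 i = x 0 i - e 0 i + (e 0 i + e 0 i) by ring.
have ei := unit_coord_le1 e1 i.
by apply: le_trans (norm_add_le (h i) (norm_add_le ei ei)) _; lra.
Qed.

Lemma near_unit_normsq_sub e x y r M : dot e e = 1 -> r <= 1 ->
  (forall i, `|x 0 i - e 0 i| <= r) -> (forall i, `|y 0 i - e 0 i| <= r) ->
  (forall i, `|x 0 i - y 0 i| <= M) -> `|dot x x - dot y y| <= d%:R * (M * 4).
Proof.
move=> e1 r1 hx hy h; rewrite dot_sub_dot; apply: norm_dot_le => i; rewrite !mxE //.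
have := norm_add_le (near_unit_bound e1 r1 hx i) (near_unit_bound e1 r1 hy i).
by move=> /le_trans; apply; lra.
Qed.

(** At a unit vector [e] the derivative of [x |-> phi (|x|^2) x] is [h |-> h + 2 b <e, h> e]. One
    [r] serves all [e], as is required along a whole orbit. *)
Lemma radial_strict phi k b : radial_profile phi k b -> forall del, 0 < del ->
  exists r, [/\ 0 < r, r <= 1 & forall e, dot e e = 1 -> forall x y M,
   (forall i, `|x 0 i - e 0 i| <= r) -> (forall i, `|y 0 i - e 0 i| <= r) ->
   (forall i, `|x 0 i - y 0 i| <= M) -> forall i,
   `|phi (dot x x) * x 0 i - phi (dot y y) * y 0 i
     - ((x 0 i - y 0 i) + 2 * b * dot e (x - y) * e 0 i)| <= del * M].
Proof.
move=> [phi1 [phi' [r0 [<- cphi r00 dphi]]]] del del0.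
set bb := phi' 1; have D0 : 0 <= d%:R :> R by exact: ler0n.
(* The strict differentiability of [phi] contributes [8 d del' M], at most half of [del * M]; [Q]
   collects the coefficients of the terms with a factor [r], which fit into the other half. *)
pose del' := del / (1 + 24 * d%:R).
have del'0 : 0 < del' by rewrite divr_gt0 //; lra.
have [r1 r10 hr1] := strict_derivative r00 (fun s h => (dphi s h).1) cphi del'0.
pose Q := d%:R * ((del' + `|bb|) * 9 + 10 * `|bb|) + 1.
have Q0 : 0 < Q by rewrite /Q ltr_pwDr // mulr_ge0 // addr_ge0 // mulr_ge0 // addr_ge0 // ltW.
pose r := Num.min 1 (Num.min (r1 / (3 * d%:R + 1)) (del / 2 / Q)).
have r0' : 0 < r by rewrite !lt_min ltr01 !divr_gt0 //; lra.
have rle1 : r <= 1 by rewrite ge_min lexx.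
have rle2 : r * (3 * d%:R + 1) <= r1 by rewrite -ler_pdivlMr; [rewrite !ge_min lexx /= orbT|lra].
have rle3 : r * Q <= del / 2 by rewrite -ler_pdivlMr // !ge_min lexx /= !orbT.
exists r; split=> // e e1 x y M hx hy hM i.
have M0 : 0 <= M by apply: le_trans (hM i).
have Ax := near_unit_normsq e1 rle1 hx; have Ay := near_unit_normsq e1 rle1 hy.
have small (s : R) : s <= d%:R * (r * 3) -> s <= r1.
  move=> /le_trans; apply; apply: le_trans rle2.
  rewrite [X in X <= _](_ : _ = r * (3 * d%:R)); last by ring.
  by rewrite [leRHS]mulrDr mulr1 lerDl ltW.
have Axr := small _ Ax; have Ayr := small _ Ay.
have AB := near_unit_normsq_sub e1 rle1 hx hy hM.
set A := dot x x in Ax Axr AB *; set B := dot y y in Ay Ayr AB *.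
have s1 : `|phi A - phi B - bb * (A - B)| <= del' * (d%:R * (M * 4)).
  by apply: le_trans (hr1 _ _ Axr Ayr) _; rewrite ler_wpM2l // ltW.
have s2 : `|phi A - 1| <= (del' + `|bb|) * (d%:R * (r * 3)).
  have h := hr1 A 1 Axr ltac:(by rewrite subrr normr0 ltW).
  rewrite phi1 -/bb in h.
  have -> : phi A - 1 = (phi A - 1 - bb * (A - 1)) + bb * (A - 1) by ring.
  apply: le_trans (norm_add_le h (lexx _)) _.
  by rewrite normrM -mulrDl ler_wpM2l // addr_ge0 // ltW.
have yi := near_unit_bound e1 rle1 hy i.
have ei := unit_coord_le1 e1.
have s3 : `|A - B - 2 * dot e (x - y)| <= d%:R * (M * (r + r)).
  have -> : A - B - 2 * dot e (x - y) = dot (x - y) ((x - e) + (y - e)).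
    by rewrite /A /B dot_sub_dot (dotC e) !(dotDr (x - y)) !dotNr; ring.
  by apply: norm_dot_le => j; rewrite !mxE //; exact: norm_add_le.
have s4 : `|dot e (x - y)| <= d%:R * (1 * M).
  by apply: norm_dot_le => // j; rewrite !mxE.
have -> : phi A * x 0 i - phi B * y 0 i - (x 0 i - y 0 i + 2 * bb * dot e (x - y) * e 0 i)
  = (phi A - 1) * (x 0 i - y 0 i) + (phi A - phi B - bb * (A - B)) * y 0 i
    + bb * (A - B - 2 * dot e (x - y)) * y 0 i + 2 * bb * dot e (x - y) * (y 0 i - e 0 i) by ring.
have n2b : `|2 * bb| <= 2 * `|bb| by rewrite normrM ger0_norm.
apply: le_trans (norm_add_le (norm_add_le (norm_add_le (norm_mul_le s2 (hM i))
  (norm_mul_le s1 yi)) (norm_mul_le (norm_mul_le (lexx `|bb|) s3) yi))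
  (norm_mul_le (norm_mul_le n2b s4) (hy i))) _.
have e1' : del' * (1 + 24 * d%:R) = del by rewrite /del' divfK //; lra.
have d8 : 8 * del' * d%:R <= del / 2 by rewrite -e1'; have := mulr_ge0 (ltW del'0) D0; lra.
set nb := `|bb|; have nb0 : 0 <= nb by exact: normr_ge0.
have := ler_wpM2r M0 rle3; have := ler_wpM2r M0 d8; rewrite /Q -/nb.
have p1 : 0 <= d%:R * del' * r * M by rewrite !mulr_ge0 // ltW.
have p2 : 0 <= d%:R * nb * r * M by rewrite !mulr_ge0 // ltW.
have p3 : 0 <= r * M by rewrite mulr_ge0 // ltW.
move: p1 p2 p3; clear.
move: (d%:R : R) => D; nra.
Qed.

(** The contraction needs a small Lipschitz constant; the action needs these cruder bounds, above
    all the quadratic Taylor remainder of [k (|x|^2)], which follows from a Lipschitz bound on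
    [phi]. *)
Lemma radial_estimates phi k b : radial_profile phi k b ->
  exists r C, [/\ 0 < r, r <= 1, 0 <= C & forall e, dot e e = 1 -> forall x y M,
   (forall i, `|x 0 i - e 0 i| <= r) -> (forall i, `|y 0 i - e 0 i| <= r) ->
   (forall i, `|x 0 i - y 0 i| <= M) ->
   [/\ forall i, `|phi (dot x x) * x 0 i| <= C,
       forall i, `|phi (dot x x) * x 0 i - phi (dot y y) * y 0 i| <= C * M
     & `|k (dot x x) - k (dot y y) - phi (dot y y) * dot y (x - y)| <= C * M ^+ 2]].
Proof.
move=> prof; have [phi1 [phi' [r0 [bE cphi r00 dphi]]]] := prof.
have D0 : 0 <= d%:R :> R by exact: ler0n.
have [ra [ra0 ra1 hra]] := radial_strict prof ltr01.
have [r1 r10 hr1] := strict_derivative r00 (fun s h => (dphi s h).1) cphi ltr01.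
pose L := 1 + `|phi' 1|.
have L0 : 0 <= L by rewrite addr_ge0.
have phiL (s t : R) : `|s - 1| <= r1 -> `|t - 1| <= r1 -> `|phi s - phi t| <= L * `|s - t|.
  move=> sr tr; have -> : phi s - phi t = (phi s - phi t - phi' 1 * (s - t)) + phi' 1 * (s - t) by ring.
  apply: le_trans (norm_add_le (hr1 s t sr tr) (lexx _)) _.
  by rewrite normrM /L mulrDl.
pose rr := Num.min r1 (Num.min 1 (r0 / 2)).
have rr0 : 0 < rr by rewrite !lt_min r10 ltr01 divr_gt0.
have rr1 : rr <= r1 by rewrite ge_min lexx.
have rr2 : rr <= 1 by rewrite !ge_min lexx orbT.
have rr3 : rr < r0 by rewrite !gt_min; apply/orP; right; apply/orP; right; lra.
have kT (s t : R) : `|s - 1| <= rr -> `|t - 1| <= rr ->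
    `|k s - k t - phi t / 2 * (s - t)| <= L * `|s - t| ^+ 2.
  (* [c] is the point of expansion; it may be either end of the interval, which covers both orders
     of [s] and [t]. *)
  have main (u v c : R) : u <= v -> `|u - 1| <= rr -> `|v - 1| <= rr -> `|c - 1| <= rr ->
      u <= c <= v -> `|(k v - phi c / 2 * v) - (k u - phi c / 2 * u)| <= L * (v - u) * (v - u).
    move=> uv ur vr cr /andP[uc cv].
    pose g (x : R) : R := k x - phi c / 2 * x.
    rewrite -/(g v) -/(g u); apply: (@der_lip_seg R g (fun x : R => phi x / 2 - phi c / 2)) => // z /andP[uz zv].
      have zr : `|z - 1| < r0.
        apply: le_lt_trans rr3.
        by move: ur vr; rewrite !ler_norml => /andP[? ?] /andP[? ?]; lra.
      by have dk := (dphi z zr).2; rewrite /g; derE; ring.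
    have zr : `|z - 1| <= r1.
      by apply: le_trans rr1; move: ur vr; rewrite !ler_norml => /andP[? ?] /andP[? ?]; lra.
    have := phiL z c zr (le_trans cr rr1).
    rewrite -mulrBl normrM (ger0_norm (_ : 0 <= 2^-1)) ?invr_ge0 //.
    have : `|z - c| <= v - u by rewrite ler_norml; lra.
    move=> /(ler_wpM2l L0) h1 h2; have := le_trans h2 h1.
    have : 0 <= L * (v - u) by rewrite mulr_ge0 // subr_ge0.
    lra.
  move=> sr tr; have [st|/ltW ts] := leP s t.
    have -> : k s - k t - phi t / 2 * (s - t) = - ((k t - phi t / 2 * t) - (k s - phi t / 2 * s)) by ring.
    rewrite normrN (distrC s t) (ger0_norm (_ : 0 <= t - s)) ?subr_ge0 // expr2 mulrA.
    by apply: main => //; rewrite st lexx.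
  have -> : k s - k t - phi t / 2 * (s - t) = (k s - phi t / 2 * s) - (k t - phi t / 2 * t) by ring.
  rewrite (ger0_norm (_ : 0 <= s - t)) ?subr_ge0 // expr2 mulrA.
  by apply: main => //; rewrite ts lexx.
pose r := Num.min ra (rr / (3 * d%:R + 1)).
have r_gt0 : 0 < r by rewrite lt_min ra0 divr_gt0 //; lra.
have rra : r <= ra by rewrite ge_min lexx.
have rle1 : r <= 1 by apply: le_trans ra1.
have rle2 : r * (3 * d%:R + 1) <= rr by rewrite -ler_pdivlMr; [rewrite !ge_min lexx /= orbT|lra].
pose nb := `|b|; have nb0 : 0 <= nb by exact: normr_ge0.
pose C1 := 2 + 2 * nb * d%:R.
pose C2 := (1 + L) * 2.
pose C3 := L * (d%:R * 4) ^+ 2 + (1 + L) * d%:R.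
have C10 : 0 <= C1 by rewrite /C1 addr_ge0 // !mulr_ge0.
have C20 : 0 <= C2 by rewrite /C2 mulr_ge0 // addr_ge0.
have C30 : 0 <= C3 by rewrite /C3 addr_ge0 // mulr_ge0 // ?sqr_ge0 // addr_ge0.
exists r, (C1 + C2 + C3); split=> //; first by apply: addr_ge0 => //; apply: addr_ge0.
move=> e e1 x y M hx hy hM.
have small (s : R) : s <= d%:R * (r * 3) -> s <= rr.
  move=> /le_trans; apply; apply: le_trans rle2.
  rewrite [X in X <= _](_ : _ = r * (3 * d%:R)); last by ring.
  by rewrite [leRHS]mulrDr mulr1 lerDl ltW.
have Axr := small _ (near_unit_normsq e1 rle1 hx).
have Ayr := small _ (near_unit_normsq e1 rle1 hy).
have AB := near_unit_normsq_sub e1 rle1 hx hy hM.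
set A := dot x x in Axr AB *; set B := dot y y in Ayr AB *.
have phiB (s : R) : `|s - 1| <= rr -> `|phi s| <= 1 + L.
  move=> sr; have h := phiL s 1 (le_trans sr rr1) ltac:(by rewrite subrr normr0 ltW).
  rewrite phi1 in h; rewrite -(subrK 1 (phi s)) addrC.
  apply: norm_add_le; first by rewrite normr1.
  by apply: le_trans h _; rewrite ler_piMr //; exact: le_trans sr rr2.
split.
- move=> i; have M0 : 0 <= M by apply: le_trans (hM i).
  apply: le_trans (norm_mul_le (phiB _ Axr) (near_unit_bound e1 rle1 hx i)) _.
  by rewrite -/C2; move: C10 C30; clear; lra.
- move=> i; have M0 : 0 <= M by apply: le_trans (hM i).
  have h := hra e e1 x y M (fun i => le_trans (hx i) rra) (fun i => le_trans (hy i) rra) hM i.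
  have s4 : `|dot e (x - y)| <= d%:R * (1 * M).
    by apply: norm_dot_le => // j; [exact: unit_coord_le1|rewrite !mxE].
  rewrite -[X in `|X|](subrK (x 0 i - y 0 i + 2 * b * dot e (x - y) * e 0 i)).
  have n2b : `|2 * b| <= 2 * nb by rewrite normrM ger0_norm.
  apply: le_trans (norm_add_le h (norm_add_le (hM i) (norm_mul_le (norm_mul_le n2b s4) (unit_coord_le1 e1 i)))) _.
  have -> : 1 * M + (M + 2 * nb * (d%:R * (1 * M)) * 1) = C1 * M by rewrite /C1; ring.
  by rewrite ler_wpM2r //; move: C20 C30; clear; lra.
have M0 : 0 <= M.
  have [i _|no] := pickP (predT : pred 'I_d); first by apply: le_trans (hM i).
  by move: e1; rewrite dotE big1 => [/eqP|i]; [rewrite eq_sym oner_eq0|have := no i].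
have -> : k A - k B - phi B * dot y (x - y) =
   (k A - k B - phi B / 2 * (A - B)) + phi B / 2 * dot (x - y) (x - y).
  have -> : A - B = 2 * dot y (x - y) + dot (x - y) (x - y).
    by rewrite /A /B !(dotBr _ x y) !(dotBl x y) (dotC x y); ring.
  by field.
have AB2 : `|A - B| ^+ 2 <= (d%:R * (M * 4)) ^+ 2 by rewrite ler_pXn2r ?nnegrE // mulr_ge0 // mulr_ge0.
have b2 : `|phi B / 2| <= 1 + L.
  rewrite normrM (ger0_norm (_ : 0 <= 2^-1)) ?invr_ge0 //.
  have := phiB _ Ayr; move: (normr_ge0 (phi B)); lra.
have xy2 : `|dot (x - y) (x - y)| <= d%:R * (M * M) by apply: norm_dot_le => i; rewrite !mxE.
apply: le_trans (norm_add_le (le_trans (kT _ _ Axr Ayr) (ler_wpM2l L0 AB2)) (norm_mul_le b2 xy2)) _.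
have -> : L * (d%:R * (M * 4)) ^+ 2 + (1 + L) * (d%:R * (M * M)) = C3 * M ^+ 2 by rewrite /C3; ring.
by rewrite ler_wpM2r ?sqr_ge0 //; move: C10 C20; clear; lra.
Qed.

End RadialVector.

(** * Rotations of a plane, the circular orbit, orthogonal matrices *)

Section Rotation.
Context {R : realType} (d : nat) (i0 i1 : 'I_d) (i01 : i0 != i1).
Implicit Types (x y z e : 'rV[R]_d) (A O : 'M[R]_d) (a b t M : R).

Definition rot t x : 'rV[R]_d := \row_i
  if i == i0 then x 0 i0 * cos t - x 0 i1 * sin t
  else if i == i1 then x 0 i0 * sin t + x 0 i1 * cos t else x 0 i.

Lemma i10 : (i1 == i0) = false. Proof. by rewrite eq_sym (negbTE i01). Qed.

Lemma rot_i0 t x : rot t x 0 i0 = x 0 i0 * cos t - x 0 i1 * sin t.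
Proof. by rewrite mxE eqxx. Qed.

Lemma rot_i1 t x : rot t x 0 i1 = x 0 i0 * sin t + x 0 i1 * cos t.
Proof. by rewrite mxE i10 eqxx. Qed.

Lemma rot_j t x j : j != i0 -> j != i1 -> rot t x 0 j = x 0 j.
Proof. by move=> j0 j1; rewrite mxE (negbTE j0) (negbTE j1). Qed.

Lemma rot_case (P : 'I_d -> Prop) : P i0 -> P i1 ->
  (forall j, j != i0 -> j != i1 -> P j) -> forall j, P j.
Proof.
move=> p0 p1 pj j; have [->//|j0] := eqVneq j i0.
by have [->//|j1] := eqVneq j i1; exact: pj.
Qed.

Lemma rotB t x y : rot t (x - y) = rot t x - rot t y.
Proof.
by apply/rowP; apply: rot_case => [||j j0 j1]; rewrite !mxE ?i10 ?eqxx ?(negbTE j0) ?(negbTE j1) //; ring.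
Qed.

Lemma rotD t x y : rot t (x + y) = rot t x + rot t y.
Proof.
by apply/rowP; apply: rot_case => [||j j0 j1]; rewrite !mxE ?i10 ?eqxx ?(negbTE j0) ?(negbTE j1) //; ring.
Qed.

Lemma sum_split (f : 'I_d -> R) :
  \sum_i f i = f i0 + f i1 + \sum_(i | (i != i0) && (i != i1)) f i.
Proof. by rewrite (bigD1 i0) //= (bigD1 i1) /= ?addrA // eq_sym. Qed.

Lemma dot_rot t x y : dot (rot t x) (rot t y) = dot x y.
Proof.
rewrite !dotE !sum_split !rot_i0 !rot_i1; congr (_ + _); last first.
  by apply: eq_bigr => j /andP[j0 j1]; rewrite !rot_j.
have := cos2Dsin2 t => cs.
transitivity ((x 0 i0 * y 0 i0 + x 0 i1 * y 0 i1) * (cos t ^+ 2 + sin t ^+ 2)); first by ring.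
by rewrite cs mulr1.
Qed.

Lemma rotK t x : rot (- t) (rot t x) = x.
Proof.
have cs := cos2Dsin2 t.
apply/rowP; apply: rot_case => [||j j0 j1].
- rewrite rot_i0 rot_i0 rot_i1 cosN sinN.
  transitivity (x 0 i0 * (cos t ^+ 2 + sin t ^+ 2)); first by ring.
  by rewrite cs mulr1.
- rewrite rot_i1 rot_i0 rot_i1 cosN sinN.
  transitivity (x 0 i1 * (cos t ^+ 2 + sin t ^+ 2)); first by ring.
  by rewrite cs mulr1.
- by rewrite !rot_j.
Qed.

Lemma rotKV t x : rot t (rot (- t) x) = x.
Proof. by rewrite -{1}(opprK t) rotK. Qed.

Lemma norm_rot_le t x M : (forall i, `|x 0 i| <= M) -> forall i, `|rot t x 0 i| <= 2 * M.
Proof.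
move=> h; have -> : 2 * M = M + M by ring.
apply: rot_case => [||j j0 j1].
- by rewrite rot_i0; apply: norm_sub_le; [exact: norm_mul_cos_le|exact: norm_mul_sin_le].
- by rewrite rot_i1; apply: norm_add_le; [exact: norm_mul_sin_le|exact: norm_mul_cos_le].
- by rewrite rot_j //; apply: le_trans (h j) _; rewrite lerDl (le_trans _ (h j)).
Qed.

Lemma rot_periodic T t x : Tperiodic T (@cos R) -> Tperiodic T (@sin R) -> rot (t + T) x = rot t x.
Proof. by move=> pc ps; apply/rowP => i; rewrite !mxE pc ps. Qed.

Definition e0 : 'rV[R]_d := delta_mx 0 i0.
Definition e1 : 'rV[R]_d := delta_mx 0 i1.

Lemma e0E i : e0 0 i = (i == i0)%:R. Proof. by rewrite mxE eqxx. Qed.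
Lemma e1E i : e1 0 i = (i == i1)%:R. Proof. by rewrite mxE eqxx. Qed.

Lemma dot_e0 x : dot e0 x = x 0 i0.
Proof.
rewrite dotE (bigD1 i0) //= e0E eqxx mul1r big1 ?addr0 // => j jn.
by rewrite e0E (negbTE jn) mul0r.
Qed.

Lemma dot_e1 x : dot e1 x = x 0 i1.
Proof.
rewrite dotE (bigD1 i1) //= e1E eqxx mul1r big1 ?addr0 // => j jn.
by rewrite e1E (negbTE jn) mul0r.
Qed.

Lemma e0_unit : dot e0 e0 = 1. Proof. by rewrite dot_e0 e0E eqxx. Qed.
Lemma e1_unit : dot e1 e1 = 1. Proof. by rewrite dot_e1 e1E eqxx. Qed.

Definition orbit t : 'rV[R]_d := rot t e0.

Lemma orbit_i0 t : orbit t 0 i0 = cos t.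
Proof. by rewrite rot_i0 !e0E eqxx i10 mul1r mul0r subr0. Qed.
Lemma orbit_i1 t : orbit t 0 i1 = sin t.
Proof. by rewrite rot_i1 !e0E eqxx i10 mul1r mul0r addr0. Qed.
Lemma orbit_j t j : j != i0 -> j != i1 -> orbit t 0 j = 0.
Proof. by move=> j0 j1; rewrite rot_j // e0E (negbTE j0). Qed.

Lemma orbit_mulmx t A j : (orbit t *m A) 0 j = cos t * A i0 j + sin t * A i1 j.
Proof.
rewrite mxE sum_split orbit_i0 orbit_i1 big1 ?addr0 // => i /andP[? ?].
by rewrite orbit_j // mul0r.
Qed.

Definition orthogonal O := O *m O^T = 1%:M.

Lemma orthogonal_tr O : orthogonal O -> O^T *m O = 1%:M.
Proof. exact: mulmx1C. Qed.

Lemma dot_orthogonal O x y : orthogonal O -> dot (x *m O) (y *m O) = dot x y.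
Proof. by move=> hO; rewrite dot_mulmx -mulmxA hO mulmx1. Qed.

Lemma orthogonal_le1 O : orthogonal O -> forall i j, `|O i j| <= 1.
Proof.
move=> hO i j.
have hr : dot (row i O) (row i O) = 1.
  have := congr1 (fun A : 'M[R]_d => A i i) hO.
  rewrite !mxE eqxx dotE => h; transitivity (true%:R : R) => //.
  by rewrite -h; apply: eq_bigr => k _; rewrite !mxE.
by have := unit_coord_le1 hr j; rewrite mxE.
Qed.

Lemma orthogonalM O A : orthogonal O -> orthogonal A -> orthogonal (O *m A).
Proof.
by move=> hO hA; rewrite /orthogonal trmx_mul mulmxA -(mulmxA O) hA mulmx1.
Qed.

End Rotation.

(** * The linear problem in all coordinates *)

Section VectorSolver.
Context {R : realType} (d : nat) (i0 i1 : 'I_d) (i01 : i0 != i1).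
Context (k T : R) (T0 : 0 < T) (k01 : 0 < k < 1) (ck : cos (k * T) != 1).
Context (pc : Tperiodic T (@cos R)) (ps : Tperiodic T (@sin R)).
Implicit Types (f g x y : 'I_d -> R -> R) (L A : 'M[R]_d) (M : R).

(* A complement of the isotropy algebra of the reference plane, so that torque
   multipliers in it are determined uniquely. *)
Definition tangent L := L^T = - L /\
  forall i j, i != i0 -> i != i1 -> j != i0 -> j != i1 -> L i j = 0.

Definition rotating_system f g x y L :=
  planar_system k (f i0) (f i1) (g i0) (g i1) (x i0) (x i1) (y i0) (y i1) (L i0 i1) /\
  forall j, j != i0 -> j != i1 -> vertical_system (f j) (g j) (x j) (y j) (L i0 j) (L i1 j).

(** Orthogonality of the displacement to the infinitesimal rotations of the orbit, written in the
    rotating frame. *)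
Definition normalized x := mean T (x i1) = 0 /\ forall j, j != i0 -> j != i1 ->
  mean T (fun t => x j t * cos t) = 0 /\ mean T (fun t => x j t * sin t) = 0.

Lemma rotating_exists f g : (forall i, continuous (f i)) -> (forall i, continuous (g i)) ->
  (forall i, Tperiodic T (f i)) -> (forall i, Tperiodic T (g i)) ->
  exists x y L, [/\ rotating_system f g x y L, normalized x, tangent L,
    forall i, Tperiodic T (x i) & forall i, Tperiodic T (y i)].
Proof.
move=> cf cg pf pg.
have [x0 [x1 [y0 [y1 [lam [sys [px0 px1 py0 py1] mx]]]]]] :=
  planar_exists T0 k01 ck (And4 (cf i0) (cf i1) (cg i0) (cg i1)) (And4 (pf i0) (pf i1) (pg i0) (pg i1)).
have /choice [S hS] : forall j, exists s : (R -> R) * (R -> R) * R * R,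
   [/\ vertical_system (f j) (g j) s.1.1.1 s.1.1.2 s.1.2 s.2, Tperiodic T s.1.1.1, Tperiodic T s.1.1.2,
    mean T (fun t => s.1.1.1 t * cos t) = 0 & mean T (fun t => s.1.1.1 t * sin t) = 0].
  move=> j; have [z [y [a [b h]]]] := vertical_exists T0 pc ps (cf j) (cg j) (pf j) (pg j).
  by exists (z, y, a, b).
pose x i := if i == i0 then x0 else if i == i1 then x1 else (S i).1.1.1.
pose y i := if i == i0 then y0 else if i == i1 then y1 else (S i).1.1.2.
(* [up] holds each multiplier once, in the rows [i0] and [i1]; [L] is its antisymmetrization. *)
pose up i j := if i == i0 then (if j == i0 then 0 else if j == i1 then lam else (S j).1.2)
  else if i == i1 then (if j == i0 then 0 else if j == i1 then 0 else (S j).2) else 0.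
pose L : 'M[R]_d := \matrix_(i, j) (up i j - up j i).
have i10' := i10 i01.
have xj j : j != i0 -> j != i1 -> x j = (S j).1.1.1 by move=> j0 j1; rewrite /x (negbTE j0) (negbTE j1).
have yj j : j != i0 -> j != i1 -> y j = (S j).1.1.2 by move=> j0 j1; rewrite /y (negbTE j0) (negbTE j1).
have xi0 : x i0 = x0 by rewrite /x eqxx.
have xi1 : x i1 = x1 by rewrite /x i10' eqxx.
have yi0 : y i0 = y0 by rewrite /y eqxx.
have yi1 : y i1 = y1 by rewrite /y i10' eqxx.
exists x, y, L; split.
- split.
    have -> : L i0 i1 = lam by rewrite mxE /up !eqxx i10' subr0.
    by rewrite xi0 xi1 yi0 yi1.
  move=> j j0 j1; rewrite xj // yj //.
  have -> : L i0 j = (S j).1.2 by rewrite mxE /up !eqxx (negbTE j0) (negbTE j1) subr0.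
  have -> : L i1 j = (S j).2 by rewrite mxE /up !eqxx i10' (negbTE j0) (negbTE j1) subr0.
  by have [] := hS j.
- split; first by rewrite xi1.
  by move=> j j0 j1; rewrite xj //; have [] := hS j.
- split; first by apply/matrixP => i j; rewrite !mxE opprB.
  by move=> i j /negbTE a /negbTE b /negbTE c /negbTE e; rewrite mxE /up a b c e subrr.
- apply: (@rot_case d i0 i1); rewrite ?xi0 ?xi1 // => j j0 j1.
  by rewrite xj //; have [] := hS j.
- apply: (@rot_case d i0 i1); rewrite ?yi0 ?yi1 // => j j0 j1.
  by rewrite yj //; have [] := hS j.
Qed.

Lemma rotating_bound : exists2 C, 0 <= C & forall f g x y L M,
  rotating_system f g x y L -> normalized x -> tangent L ->
  (forall i, Tperiodic T (x i)) -> (forall i, Tperiodic T (y i)) ->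
  (forall i, continuous (f i)) -> (forall i, continuous (g i)) ->
  (forall i t, `|f i t| <= M) -> (forall i t, `|g i t| <= M) ->
  [/\ forall i t, `|x i t| <= C * M, forall i t, `|y i t| <= C * M
    & forall i j, `|L i j| <= C * M].
Proof.
have [C1 C10 h1] := planar_bound T0 k01 ck.
have [C2 C20 h2] := vertical_bound T0 pc ps.
exists (C1 + C2); first exact: addr_ge0.
move=> f g x y L M [sysp sysv] [mp mv] [La Ls] px py cf cg fM gM.
have M0 : 0 <= M by apply: le_trans (fM i0 0).
have le1 (z : R) : `|z| <= C1 * M -> `|z| <= (C1 + C2) * M.
  by move=> /le_trans; apply; rewrite mulrDl lerDl mulr_ge0.
have le2 (z : R) : `|z| <= C2 * M -> `|z| <= (C1 + C2) * M.
  by move=> /le_trans; apply; rewrite mulrDl lerDr mulr_ge0.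
have [b1 bl] := h1 _ _ _ _ _ _ _ _ _ M sysp (And4 (px i0) (px i1) (py i0) (py i1))
  (And4 (cf i0) (cf i1) (cg i0) (cg i1)) mp (fun t => And4 (fM i0 t) (fM i1 t) (gM i0 t) (gM i1 t)).
have b2 j (j0 : j != i0) (j1 : j != i1) := h2 _ _ _ _ _ _ M (sysv j j0 j1) (px j) (py j) (cf j) (cg j)
  (mv j j0 j1).1 (mv j j0 j1).2 (fun t => conj (fM j t) (gM j t)).
have Lt i j : L j i = - L i j by have := congr1 (fun A : 'M[R]_d => A i j) La; rewrite !mxE.
have L0 i : L i i = 0 by have := Lt i i; lra.
have CM : 0 <= (C1 + C2) * M by rewrite mulr_ge0 // addr_ge0.
have r0 j : `|L i0 j| <= (C1 + C2) * M.
  move: j; apply: (@rot_case d i0 i1) => [||j j0 j1]; first by rewrite L0 normr0.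
    exact: le1.
  by apply: le2; have [_ [? ?]] := b2 j j0 j1.
have r1 j : `|L i1 j| <= (C1 + C2) * M.
  move: j; apply: (@rot_case d i0 i1) => [||j j0 j1]; first by rewrite Lt normrN; exact: le1.
    by rewrite L0 normr0.
  by apply: le2; have [_ [? ?]] := b2 j j0 j1.
split.
- apply: (@rot_case d i0 i1) => [t|t|j j0 j1 t].
  + by apply: le1; have [] := b1 t.
  + by apply: le1; have [] := b1 t.
  + by apply: le2; have [/(_ t) []] := b2 j j0 j1.
- apply: (@rot_case d i0 i1) => [t|t|j j0 j1 t].
  + by apply: le1; have [] := b1 t.
  + by apply: le1; have [] := b1 t.
  + by apply: le2; have [/(_ t) []] := b2 j j0 j1.
move=> i j; move: i; apply: (@rot_case d i0 i1) => // i a b; rewrite Lt normrN.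
move: j; apply: (@rot_case d i0 i1) => // j a' b'; by rewrite Ls // normr0.
Qed.

End VectorSolver.

(** * Continuity and means of composed functions *)

Section Continuity.
Context {R : realType}.

(** Continuity is read off from a Lipschitz bound in finitely many continuous coordinates; the
    nonlinear remainders come with such a bound. *)
Lemma lip_continuous n (F : R -> R) (x : 'I_n -> R -> R) (C : R) :
  (forall i, continuous (x i)) ->
  (forall s t M, 0 <= M -> M <= 1 -> (forall i, `|x i s - x i t| <= M) -> `|F s - F t| <= C * M) ->
  continuous F.
Proof.
move=> cx lip t; apply/cvgrPdist_le => e epos.
pose M := Num.min 1 (e / (`|C| + 1)).
have C1 : 0 < `|C| + 1 by rewrite ltr_wpDl.
have M0 : 0 < M by rewrite lt_min ltr01 divr_gt0.
have Me : `|C| * M <= e.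
  have : M * (`|C| + 1) <= e by rewrite -ler_pdivlMr // ge_min lexx orbT.
  have := ltW M0; have := normr_ge0 C; nra.
near=> s; rewrite distrC.
apply: le_trans (lip s t M (ltW M0) _ _) _; first by rewrite ge_min lexx.
  near: s; apply: filter_forall => i.
  have H : \forall s \near t, `|x i t - x i s| <= M by move/cvgrPdist_le : (cx i t); apply.
  by apply: filterS H => z; rewrite distrC.
by apply: le_trans Me; rewrite ler_pM2r // ler_norm.
Unshelve. all: by end_near. Qed.

Lemma cont_sum (I : Type) (r : seq I) (P : pred I) (f : I -> R -> R) :
  (forall i, continuous (f i)) -> continuous (fun t => \sum_(i <- r | P i) f i t).
Proof.
move=> cf; elim: r => [|i r ih].
  by under eq_fun do rewrite big_nil; exact: cont_cst.
under eq_fun do rewrite big_cons.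
by case: (P i) => //; apply: cont_add.
Qed.

Lemma mean_sum T (I : Type) (r : seq I) (P : pred I) (f : I -> R -> R) : 0 < T ->
  (forall i, continuous (f i)) ->
  mean T (fun t => \sum_(i <- r | P i) f i t) = \sum_(i <- r | P i) mean T (f i).
Proof.
move=> T0 cf; elim: r => [|i r ih].
  by under eq_fun do rewrite big_nil; rewrite big_nil mean_cst.
under eq_fun do rewrite big_cons.
rewrite big_cons; case: (P i) => //; rewrite mean_add ?ih //; exact: cont_sum.
Qed.

Lemma cont_dot d (x y : R -> 'rV[R]_d) :
  (forall i, continuous (fun t => x t 0 i)) -> (forall i, continuous (fun t => y t 0 i)) ->
  continuous (fun t => dot (x t) (y t)).
Proof.
move=> cx cy; under eq_fun do rewrite dotE.
by apply: cont_sum => i; apply: cont_mul.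
Qed.

Lemma cont_mulmx d (x : R -> 'rV[R]_d) (A : 'M[R]_d) :
  (forall i, continuous (fun t => x t 0 i)) -> forall j, continuous (fun t => (x t *m A) 0 j).
Proof.
move=> cx j; under eq_fun do rewrite mxE.
by apply: cont_sum => i; apply: cont_mul => //; exact: cont_cst.
Qed.

End Continuity.

(** * The normalized problem and its perturbation *)

Section Setup.
Context {R : realType} (d : nat) (i0 i1 : 'I_d) (i01 : i0 != i1).
Context (k T : R) (T0 : 0 < T) (k01 : 0 < k < 1) (ck : cos (k * T) != 1).
Context (pc : Tperiodic T (@cos R)) (ps : Tperiodic T (@sin R)).
Implicit Types (x y e : 'rV[R]_d) (L A O : 'M[R]_d) (M r s t : R).

Notation rot := (rot i0 i1).
Notation orbit := (orbit i0 i1).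
Notation e0 := (@e0 R d i0).

(** [phiK (|P|^2) P] is the normalized velocity at momentum [P]; [k] stands for the inverse Lorentz
    factor of the circular orbit. *)
Definition phiK (s : R) := (Num.sqrt (k ^+ 2 + (1 - k ^+ 2) * s))^-1.
Definition kinetic (s : R) := Num.sqrt (k ^+ 2 + (1 - k ^+ 2) * s) / (1 - k ^+ 2).
Definition phiV (s : R) := (s * Num.sqrt s)^-1.
Definition potential (s : R) := - (Num.sqrt s)^-1.
Definition bK : R := - ((1 - k ^+ 2) / 2).
Definition bV : R := - (3 / 2).

Lemma profK : radial_profile phiK kinetic bK.
Proof.
apply: radial_profile_kinetic; move: k01 => /andP[? ?].
by rewrite exprn_gt0 //= expr_lt1 // ltW.
Qed.

Lemma profV : radial_profile phiV potential bV.
Proof. exact: radial_profile_kepler. Qed.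

(* The subtracted term is the affine Taylor polynomial at [e] of [x |-> phi (|x|^2) x];
   [b] stands for phi' 1. *)
Definition remainder (phi : R -> R) (b : R) e x i :=
  phi (dot x x) * x 0 i - (x 0 i + 2 * b * dot e (x - e) * e 0 i).

Lemma remainder_unit phi b kk e i : radial_profile phi kk b -> dot e e = 1 ->
  remainder phi b e e i = 0.
Proof.
move=> [p1 _] ee; rewrite /remainder ee p1 subrr dotE big1; first by ring.
by move=> j _; rewrite mxE mulr0.
Qed.

Lemma remainder_strict phi b kk : radial_profile phi kk b -> forall del, 0 < del ->
  exists r, [/\ 0 < r, r <= 1 & forall e, dot e e = 1 -> forall x y M,
   (forall i, `|x 0 i - e 0 i| <= r) -> (forall i, `|y 0 i - e 0 i| <= r) ->
   (forall i, `|x 0 i - y 0 i| <= M) -> forall i,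
   `|remainder phi b e x i - remainder phi b e y i| <= del * M].
Proof.
move=> pr del d0; have [r [r0 r1 h]] := radial_strict d pr d0.
exists r; split=> // e ee x y M hx hy hM i.
have := h e ee x y M hx hy hM i; congr (`|_| <= _).
rewrite /remainder.
have -> : dot e (x - y) = dot e (x - e) - dot e (y - e) by rewrite -dotBr; congr dot; rewrite opprB addrA subrK.
by ring.
Qed.

(* [W] is a potential of [G]; only its values near the unit sphere matter. *)
Record perturbation (W : R -> 'rV[R]_d -> R) (G : R -> 'rV[R]_d -> 'rV[R]_d) (rho Lip : R) : Prop := {
  pert_rho : 0 < rho;
  pert_lip : 0 <= Lip;
  pert_contW : forall X : R -> 'rV[R]_d, (forall i, continuous (fun t => X t 0 i)) ->
    (forall t, X t != 0) -> continuous (fun t => W t (X t));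
  pert_contG : forall X : R -> 'rV[R]_d, (forall i, continuous (fun t => X t 0 i)) ->
    (forall t, X t != 0) -> forall i, continuous (fun t => G t (X t) 0 i);
  pert_perW : forall t x, x != 0 -> W (t + T) x = W t x;
  pert_perG : forall t x, x != 0 -> G (t + T) x = G t x;
  pert_est : forall t e x y M, dot e e = 1 ->
    (forall i, `|x 0 i - e 0 i| <= rho) -> (forall i, `|y 0 i - e 0 i| <= rho) ->
    (forall i, `|x 0 i - y 0 i| <= M) ->
    [/\ forall i, `|G t x 0 i| <= Lip, forall i, `|G t x 0 i - G t y 0 i| <= Lip * M
      & `|W t x - W t y - dot (G t y) (x - y)| <= Lip * M ^+ 2] }.

Lemma orbit_unit t : dot (orbit t) (orbit t) = 1.
Proof. by rewrite dot_rot // e0_unit. Qed.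

Lemma near_orthogonal t O x r : orthogonal O -> (forall i, `|x 0 i - e0 0 i| <= r) ->
  forall i, `|(rot t x *m O) 0 i - (orbit t *m O) 0 i| <= d%:R * (2 * r).
Proof.
move=> hO h i; have -> : (rot t x *m O) 0 i - (orbit t *m O) 0 i = ((rot t (x - e0)) *m O) 0 i.
  by rewrite rotB // mulmxBl !mxE.
rewrite -(mulr1 (2 * r)); apply: norm_mulmx_le; last exact: orthogonal_le1.
by apply: norm_rot_le => // j; rewrite !mxE -!e0E; have := h j; rewrite e0E.
Qed.

Lemma near_unit_neq0 x e r : dot e e = 1 -> r <= 1 -> d%:R * (r * 3) < 1 ->
  (forall i, `|x 0 i - e 0 i| <= r) -> x != 0.
Proof.
move=> ee r1 dr h; apply/eqP => x0; have := near_unit_normsq ee r1 h.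
rewrite x0 [dot 0 0](_ : _ = 0); last by rewrite /dot mul0mx mxE.
by rewrite sub0r normrN normr1 leNgt dr.
Qed.

Section Pert.
Context (W : R -> 'rV[R]_d -> R) (G : R -> 'rV[R]_d -> 'rV[R]_d) (rho Lip : R).
Hypothesis pert : perturbation W G rho Lip.

(* The perturbing force rotated by [O], seen in the rotating frame. *)
Definition rotated_force O t x := rot (- t) (G t (rot t x *m O) *m O^T).

(** [pert_est] has a single centre, but rotating by [O] and by [O'] gives two. If [M <= rho / 2],
    then [y] is also within [rho] of [e]; otherwise the bound [2 Lip] on the difference is below
    [4 Lip / rho * M]. *)
Lemma pert_lip2 : exists2 L', 0 <= L' & forall t e e' x y M, dot e e = 1 -> dot e' e' = 1 ->
  (forall i, `|x 0 i - e 0 i| <= rho / 2) -> (forall i, `|y 0 i - e' 0 i| <= rho / 2) ->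
  (forall i, `|x 0 i - y 0 i| <= M) -> forall i, `|G t x 0 i - G t y 0 i| <= L' * M.
Proof.
have r0 := pert_rho pert; have L0 := pert_lip pert.
exists (Lip + 4 * Lip / rho); first by rewrite addr_ge0 // divr_ge0 ?mulr_ge0 // ltW.
move=> t e e' x y M ee ee' hx hy hM i.
have M0 : 0 <= M by apply: le_trans (hM i).
have h1 j : `|x 0 j - e 0 j| <= rho by apply: le_trans (hx j) _; lra.
have h2 j : `|y 0 j - e' 0 j| <= rho by apply: le_trans (hy j) _; lra.
have [Mr|Mr] := leP M (rho / 2).
  have h3 j : `|y 0 j - e 0 j| <= rho.
    have -> : y 0 j - e 0 j = (x 0 j - e 0 j) - (x 0 j - y 0 j) by ring.
    by apply: le_trans (norm_sub_le (hx j) (hM j)) _; lra.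
  have [_ h _] := pert_est pert t ee h1 h3 hM.
  apply: le_trans (h i) _; rewrite ler_wpM2r // lerDl divr_ge0 ?mulr_ge0 // ltW //.
have z0 (e'' : 'rV[R]_d) x' : forall i, `|x' 0 i - x' 0 i| <= 0 by move=> j; rewrite subrr normr0.
have [hx1 _ _] := pert_est pert t ee h1 h1 (z0 e x).
have [hy1 _ _] := pert_est pert t ee' h2 h2 (z0 e y).
apply: le_trans (norm_sub_le (hx1 i) (hy1 i)) _.
apply: le_trans (_ : 4 * Lip / rho * M <= _); last by rewrite ler_wpM2r // lerDr.
have -> : Lip + Lip = 4 * Lip / rho * (rho / 2) by field; rewrite gt_eqF.
by rewrite ler_wpM2l ?(ltW Mr) // divr_ge0 ?mulr_ge0 // ltW.
Qed.

Lemma rot_force_bound : exists r C, [/\ 0 < r, r <= 1, 0 <= C &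
  [/\ forall O t x, orthogonal O -> (forall i, `|x 0 i - e0 0 i| <= r) ->
      rot t x *m O != 0 /\ forall i, `|rotated_force O t x 0 i| <= C,
   forall O O' t x y M s, orthogonal O -> orthogonal O' ->
    (forall i, `|x 0 i - e0 0 i| <= r) -> (forall i, `|y 0 i - e0 0 i| <= r) ->
    (forall i, `|x 0 i - y 0 i| <= M) -> (forall i j, `|O i j - O' i j| <= s) ->
    forall i, `|rotated_force O t x 0 i - rotated_force O' t y 0 i| <= C * (M + s)
  & forall O t x, orthogonal O -> (forall i, `|x 0 i - e0 0 i| <= r) ->
    forall i, `|(rot t x *m O) 0 i - (orbit t *m O) 0 i| <= rho]].
Proof.
have r0 := pert_rho pert; have L0 := pert_lip pert.
have [L' L'0 hL'] := pert_lip2.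
have D0 : 0 <= d%:R :> R by exact: ler0n.
pose q := Num.min (rho / 2) (1 / 4).
have q0 : 0 < q by rewrite lt_min !divr_gt0.
have q1 : q <= rho / 2 by rewrite ge_min lexx.
have q2 : q <= 1 / 4 by rewrite ge_min lexx orbT.
(* Rotation and multiplication by [O] enlarge [r] to [2 d r]. This must stay below [rho / 2], and
   small enough to avoid 0; the latter costs another factor [d]. *)
pose r := q / (2 * d%:R ^+ 2 + 2 * d%:R + 1).
have d2 : 0 <= d%:R ^+ 2 :> R by exact: sqr_ge0.
have den : 0 < 2 * d%:R ^+ 2 + 2 * d%:R + 1 :> R by lra.
have r_gt0 : 0 < r by rewrite divr_gt0.
have rq : r * (2 * d%:R ^+ 2 + 2 * d%:R + 1) = q by rewrite /r divfK // gt_eqF.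
have p1 : 0 <= r * d%:R by rewrite mulr_ge0 // ltW.
have p2 : 0 <= r * d%:R ^+ 2 by rewrite mulr_ge0 // ltW.
have r1 : r <= 1 by move: rq p1 p2 q2; lra.
have drq : d%:R * (2 * r) <= q by rewrite -rq; move: p1 p2 r_gt0; lra.
have d3 : d%:R * (d%:R * (2 * r) * 3) < 1.
  have -> : d%:R * (d%:R * (2 * r) * 3) = 3 * (2 * (r * d%:R ^+ 2)) by ring.
  by move: rq p1 p2 r_gt0 q2; lra.
have nearO O t x : orthogonal O -> (forall i, `|x 0 i - e0 0 i| <= r) ->
    forall i, `|(rot t x *m O) 0 i - (orbit t *m O) 0 i| <= rho / 2.
  move=> hO hx i; apply: le_trans (near_orthogonal t hO hx i) _; exact: le_trans q1.
have uO O t : orthogonal O -> dot (orbit t *m O) (orbit t *m O) = 1.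
  by move=> hO; rewrite dot_orthogonal // orbit_unit.
have GB O t x : orthogonal O -> (forall i, `|x 0 i - e0 0 i| <= r) ->
    forall i, `|G t (rot t x *m O) 0 i| <= Lip.
  move=> hO hx.
  have h j : `|(rot t x *m O) 0 j - (orbit t *m O) 0 j| <= rho.
    by apply: le_trans (nearO O t x hO hx j) _; lra.
  have z0 i : `|(rot t x *m O) 0 i - (rot t x *m O) 0 i| <= 0 by rewrite subrr normr0.
  by have [] := pert_est pert t (uO O t hO) h h z0.
have x2 x : (forall i, `|x 0 i - e0 0 i| <= r) -> forall i, `|x 0 i| <= 2.
  by move=> hx; apply: (near_unit_bound _ r1 hx); exact: e0_unit.
pose C := 2 * (d%:R * Lip) + 2 * (d%:R * (L' * (d%:R * 4 + d%:R * 4)) + d%:R * Lip).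
have C0 : 0 <= C by rewrite /C; apply: addr_ge0; rewrite ?mulr_ge0 ?addr_ge0 ?mulr_ge0 ?addr_ge0 ?mulr_ge0.
exists r, C; split=> //; split.
- move=> O t x hO hx; split.
    apply: (near_unit_neq0 (uO O t hO) _ d3); last exact: near_orthogonal.
    by apply: le_trans drq _; lra.
  move=> i.
  have hOt a b : `|O^T a b| <= 1 by rewrite mxE; exact: orthogonal_le1.
  have hm := norm_mulmx_le (GB O t x hO hx) hOt.
  have hr := norm_rot_le i01 (- t) hm i.
  apply: le_trans hr _.
  rewrite mulr1 /C lerDl; apply: mulr_ge0 => //; apply: addr_ge0; apply: mulr_ge0 => //; apply: mulr_ge0 => //; apply: addr_ge0; exact: mulr_ge0.
- move=> O O' t x y M s hO hO' hx hy hM hs i; have M0 : 0 <= M by apply: le_trans (hM i).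
  have s0 : 0 <= s by apply: le_trans (hs i i).
  have -> : rotated_force O t x 0 i - rotated_force O' t y 0 i =
     rot (- t) (G t (rot t x *m O) *m O^T - G t (rot t y *m O') *m O'^T) 0 i.
    by rewrite rotB // [RHS]mxE [X in _ = _ + X]mxE.
  have dist j : `|(rot t x *m O) 0 j - (rot t y *m O') 0 j| <= d%:R * (2 * M) + d%:R * (2 * 2 * s).
    have -> : (rot t x *m O) 0 j - (rot t y *m O') 0 j =
       (rot t (x - y) *m O) 0 j + (rot t y *m (O - O')) 0 j.
      by rewrite rotB // mulmxBl mulmxBr !mxE; ring.
    apply: norm_add_le.
      rewrite -(mulr1 (2 * M)); apply: norm_mulmx_le; last exact: orthogonal_le1.
      by apply: norm_rot_le => // l; rewrite !mxE.
    apply: norm_mulmx_le; first by apply: norm_rot_le => //; exact: x2.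
    by move=> a b; rewrite !mxE.
  have gd := hL' t _ _ _ _ _ (uO O t hO) (uO O' t hO') (nearO O t x hO hx) (nearO O' t y hO' hy) dist.
  apply: le_trans (_ : 2 * (d%:R * (L' * (d%:R * (2 * M) + d%:R * (2 * 2 * s)) * 1) + d%:R * (Lip * s)) <= _).
    apply: norm_rot_le => // j.
    have -> : (G t (rot t x *m O) *m O^T - G t (rot t y *m O') *m O'^T) 0 j =
      ((G t (rot t x *m O) - G t (rot t y *m O')) *m O^T) 0 j + (G t (rot t y *m O') *m (O^T - O'^T)) 0 j.
      by rewrite mulmxBl mulmxBr !mxE; ring.
    apply: norm_add_le; apply: norm_mulmx_le.
    + by move=> l; rewrite !mxE; exact: gd.
    + by move=> a b; rewrite mxE; exact: orthogonal_le1.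
    + exact: GB.
    + by move=> a b; rewrite !mxE.
  have q1' : 0 <= d%:R * (L' * (d%:R * M)) by rewrite !mulr_ge0.
  have q2' : 0 <= d%:R * (L' * (d%:R * s)) by rewrite !mulr_ge0.
  have q3' : 0 <= d%:R * Lip * M by rewrite !mulr_ge0.
  have q4' : 0 <= d%:R * Lip * s by rewrite !mulr_ge0.
  by rewrite /C; move: q1' q2' q3' q4'; lra.
by move=> O t x hO hx i; apply: le_trans (nearO O t x hO hx i) _; lra.
Qed.

End Pert.
End Setup.

(** * Between the rotating and the fixed frame *)

Section Reduction.
Context {R : realType} (d : nat) (i0 i1 : 'I_d) (i01 : i0 != i1).
Context (k T : R) (T0 : 0 < T) (k01 : 0 < k < 1) (ck : cos (k * T) != 1).
Context (pc : Tperiodic T (@cos R)) (ps : Tperiodic T (@sin R)).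
Implicit Types (x y e : 'rV[R]_d) (L A O : 'M[R]_d) (M r s t : R).

Notation rot := (rot i0 i1).
Notation orbit := (orbit i0 i1).
Notation e0 := (@e0 R d i0).
Notation e1 := (@e1 R d i1).
Notation phiK := (phiK k).
Notation phiV := (@phiV R).
Notation bK := (bK k).
Notation bV := (@bV R).

(** Differentiating [rot] yields the Coriolis terms; together with the linear parts of the radial
    fields at [e0] and [e1] they form the linear system, and the remainders complete the fields
    exactly. *)
Lemma frame_change (xi eta h : R -> 'rV[R]_d) L :
  L^T = - L ->
  rotating_system i0 i1 k
    (fun i t => remainder phiK bK e1 (e1 + eta t) i)
    (fun i t => - remainder phiV bV e0 (e0 + xi t) i + h t 0 i)
    (fun i t => xi t 0 i) (fun i t => eta t 0 i) L ->
  let X t := rot t (e0 + xi t) in let P t := rot t (e1 + eta t) in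
  (forall i t, is_derive t 1 (fun s => X s 0 i) (phiK (dot (P t) (P t)) * P t 0 i)) /\
  (forall i t, is_derive t 1 (fun s => P s 0 i)
    (- phiV (dot (X t) (X t)) * X t 0 i + rot t (h t) 0 i - (orbit t *m L) 0 i)).
Proof.
move=> La [sysp sysv] X P.
have i10' := i10 i01.
have i01' : (i0 == i1) = false by rewrite (negbTE i01).
have Lt i j : L j i = - L i j by have := congr1 (fun A : 'M[R]_d => A i j) La; rewrite !mxE.
have L0 i : L i i = 0 by have := Lt i i; lra.
have PP t : dot (P t) (P t) = dot (e1 + eta t) (e1 + eta t) by rewrite dot_rot.
have XX t : dot (X t) (X t) = dot (e0 + xi t) (e0 + xi t) by rewrite dot_rot.
(* Rewriting the remainders through the full fields makes [phiK] and [phiV] atoms, so that [ring]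
   settles the derivative identities. *)
have rK t i : remainder phiK bK e1 (e1 + eta t) i =
    phiK (dot (P t) (P t)) * (e1 + eta t) 0 i - ((e1 + eta t) 0 i - (1 - k ^+ 2) * eta t 0 i1 * e1 0 i).
  rewrite PP /remainder; have -> : e1 + eta t - e1 = eta t by rewrite addrAC subrr add0r.
  by rewrite dot_e1 /bK; field.
have rV t i : remainder phiV bV e0 (e0 + xi t) i =
    phiV (dot (X t) (X t)) * (e0 + xi t) 0 i - ((e0 + xi t) 0 i - 3 * xi t 0 i0 * e0 0 i).
  rewrite XX /remainder; have -> : e0 + xi t - e0 = xi t by rewrite addrAC subrr add0r.
  by rewrite dot_e0 /bV; field.
have X0 t : X t 0 i0 = (1 + xi t 0 i0) * cos t - xi t 0 i1 * sin t.
  by rewrite rot_i0 !mxE !eqxx i10' add0r.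
have X1 t : X t 0 i1 = (1 + xi t 0 i0) * sin t + xi t 0 i1 * cos t.
  by rewrite rot_i1 // !mxE !eqxx i10' add0r.
have P0 t : P t 0 i0 = eta t 0 i0 * cos t - (1 + eta t 0 i1) * sin t.
  by rewrite rot_i0 !mxE !eqxx i01' add0r.
have P1 t : P t 0 i1 = eta t 0 i0 * sin t + (1 + eta t 0 i1) * cos t.
  by rewrite rot_i1 // !mxE !eqxx i01' add0r.
have Xj t j : j != i0 -> j != i1 -> X t 0 j = xi t 0 j.
  by move=> j0 j1; rewrite rot_j // !mxE eqxx (negbTE j0) add0r.
have Pj t j : j != i0 -> j != i1 -> P t 0 j = eta t 0 j.
  by move=> j0 j1; rewrite rot_j // !mxE eqxx (negbTE j1) add0r.
have dx0 t := let: And4 h _ _ _ := sysp t in h.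
have dx1 t := let: And4 _ h _ _ := sysp t in h.
have dy0 t := let: And4 _ _ h _ := sysp t in h.
have dy1 t := let: And4 _ _ _ h := sysp t in h.
split; apply: (@rot_case d i0 i1).
- move=> t; under eq_fun do rewrite X0.
  have dx0t := dx0 t; have dx1t := dx1 t.
  derE; rewrite !rK P0 !mxE !eqxx i01' /=.
  by move: (phiK _) => p; ring.
- move=> t; under eq_fun do rewrite X1.
  have dx0t := dx0 t; have dx1t := dx1 t.
  derE; rewrite !rK P1 !mxE !eqxx i01' /=.
  by move: (phiK _) => p; ring.
- move=> j j0 j1 t; under eq_fun do rewrite Xj //.
  apply: der_eq (sysv j j0 j1 t).1 _.
  by rewrite rK Pj // !mxE eqxx (negbTE j1) /=; ring.
- move=> t; under eq_fun do rewrite P0.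
  have dy0t := dy0 t; have dy1t := dy1 t.
  derE; rewrite rot_i0 orbit_mulmx // L0 (Lt i0 i1) !rV X0 ![(e0 + _) 0 _]mxE !e0E !eqxx i10' /=.
  by move: (phiV _) => p; ring.
- move=> t; under eq_fun do rewrite P1.
  have dy0t := dy0 t; have dy1t := dy1 t.
  derE; rewrite rot_i1 // orbit_mulmx // L0 !rV X1 ![(e0 + _) 0 _]mxE !e0E !eqxx i10' /=.
  by move: (phiV _) => p; ring.
move=> j j0 j1 t; under eq_fun do rewrite Pj //.
apply: der_eq (sysv j j0 j1 t).2 _.
rewrite rot_j // orbit_mulmx // rV Xj // ![(e0 + _) 0 _]mxE !e0E (negbTE j0) /=.
by move: (phiV _) => p; ring.
Qed.

(** Only the rows [i0] and [i1] of [A] meet the orbit, so the normalizations cover every skew [A].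
    Later [A] is also the multiplier of a solution other than the one tested. *)
Lemma normalized_constraint (xi : R -> 'rV[R]_d) A :
  (forall i, continuous (fun t => xi t 0 i)) -> normalized i0 i1 T (fun i t => xi t 0 i) ->
  A^T = - A -> mean T (fun t => dot (rot t (e0 + xi t)) (orbit t *m A)) = 0.
Proof.
move=> cx [mp mv] Aa; have i10' := i10 i01.
have At i j : A j i = - A i j by have := congr1 (fun B : 'M[R]_d => B i j) Aa; rewrite !mxE.
have A0 i : A i i = 0 by have := At i i; lra.
have E t : dot (rot t (e0 + xi t)) (orbit t *m A) = A i0 i1 * xi t 0 i1 +
   \sum_(j | (j != i0) && (j != i1)) (A i0 j * (xi t 0 j * cos t) + A i1 j * (xi t 0 j * sin t)).
  rewrite dotE (sum_split i01); congr (_ + _); last first.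
    apply: eq_bigr => j /andP[j0 j1]; rewrite rot_j // orbit_mulmx //.
    by rewrite [(e0 + _) 0 _]mxE e0E (negbTE j0) /=; ring.
  rewrite !orbit_mulmx // rot_i0 rot_i1 // ![(e0 + _) 0 _]mxE !e0E !eqxx i10' !A0 (At i0 i1).
  rewrite !add0r !mulr0 ?addr0.
  transitivity (A i0 i1 * xi t 0 i1 * (cos t ^+ 2 + sin t ^+ 2)); last by rewrite cos2Dsin2 mulr1.
  by rewrite /=; ring.
under eq_fun do rewrite E.
have cj j : continuous (fun t => A i0 j * (xi t 0 j * cos t) + A i1 j * (xi t 0 j * sin t)).
  by have cxj := cx j; cont.
rewrite mean_add ?mean_scale // ?mp ?mulr0 ?add0r; [|by have cxj := cx i1; cont|exact: cont_sum].
rewrite mean_sum // big1 // => j /andP[j0 j1]; have cxj := cx j.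
have [m1 m2] := mv j j0 j1.
by rewrite mean_add ?mean_scale ?m1 ?m2 ?mulr0 ?addr0 //; cont.
Qed.

Lemma rotating_system_sub (f f' g g' x x' y y' : 'I_d -> R -> R) L L' :
  rotating_system i0 i1 k f g x y L -> rotating_system i0 i1 k f' g' x' y' L' ->
  rotating_system i0 i1 k (fun i t => f i t - f' i t) (fun i t => g i t - g' i t)
    (fun i t => x i t - x' i t) (fun i t => y i t - y' i t) (L - L').
Proof.
move=> [sp sv] [sp' sv']; split.
  move=> t; have [a1 a2 a3 a4] := sp t; have [b1 b2 b3 b4] := sp' t.
  by split; derE; rewrite ?mxE; ring.
move=> j j0 j1 t; have [a1 a2] := sv j j0 j1 t; have [b1 b2] := sv' j j0 j1 t.
by split; derE; rewrite ?mxE; ring.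
Qed.

End Reduction.

(** * Solutions up to a torque *)

Section Family.
Context {R : realType} (d : nat) (i0 i1 : 'I_d) (i01 : i0 != i1).
Context (k T : R) (T0 : 0 < T) (k01 : 0 < k < 1) (ck : cos (k * T) != 1).
Context (pc : Tperiodic T (@cos R)) (ps : Tperiodic T (@sin R)).
Context (W : R -> 'rV[R]_d -> R) (G : R -> 'rV[R]_d -> 'rV[R]_d) (rho Lip : R).
Context (pert : perturbation T W G rho Lip).
Implicit Types (x y e : 'rV[R]_d) (L A O : 'M[R]_d) (M r s t eps : R).

Notation rot := (rot i0 i1).
Notation orbit := (orbit i0 i1).
Notation e0 := (@e0 R d i0).
Notation e1 := (@e1 R d i1).
Notation phiK := (phiK k).
Notation phiV := (@phiV R).
Notation bK := (bK k).
Notation bV := (@bV R).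
Notation rot_force := (rotated_force i0 i1 G).

Lemma cont_rot (y : R -> 'rV[R]_d) : (forall i, continuous (fun t => y t 0 i)) ->
  forall i, continuous (fun t => rot t (y t) 0 i).
Proof.
move=> cy; have c0 := cy i0; have c1 := cy i1; apply: (@rot_case d i0 i1) => [||j j0 j1].
- by apply: cont_eq (fun t => rot_i0 _ _ t (y t)) _; cont.
- by apply: cont_eq (fun t => rot_i1 i01 t (y t)) _; cont.
- by apply: cont_eq (fun t => rot_j t (y t) j0 j1) _; exact: cy.
Qed.

Lemma cont_rotN (y : R -> 'rV[R]_d) : (forall i, continuous (fun t => y t 0 i)) ->
  forall i, continuous (fun t => rot (- t) (y t) 0 i).
Proof.
move=> cy; have c0 := cy i0; have c1 := cy i1; apply: (@rot_case d i0 i1) => [||j j0 j1].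
- have E t : rot (- t) (y t) 0 i0 = y t 0 i0 * cos t + y t 0 i1 * sin t.
    by rewrite rot_i0 cosN sinN; ring.
  by apply: cont_eq E _; cont.
- have E t : rot (- t) (y t) 0 i1 = y t 0 i1 * cos t - y t 0 i0 * sin t.
    by rewrite rot_i1 // cosN sinN; ring.
  by apply: cont_eq E _; cont.
- by apply: cont_eq (fun t => rot_j (- t) (y t) j0 j1) _; exact: cy.
Qed.

Lemma rotZ t a x : rot t (a *: x) = a *: rot t x.
Proof.
apply/rowP; apply: (@rot_case d i0 i1) => [||j j0 j1]; rewrite !mxE ?(i10 i01) ?eqxx ?(negbTE j0) ?(negbTE j1) //; ring.
Qed.

Lemma rotating_continuous (f g x y : 'I_d -> R -> R) L : rotating_system i0 i1 k f g x y L ->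
  (forall i, continuous (x i)) /\ (forall i, continuous (y i)).
Proof.
move=> [sp sv]; split; apply: (@rot_case d i0 i1) => [||j j0 j1].
- by apply: der_continuous => t; have [h _ _ _] := sp t; exact: h.
- by apply: der_continuous => t; have [_ h _ _] := sp t; exact: h.
- by apply: der_continuous => t; have [h _] := sv j j0 j1 t; exact: h.
- by apply: der_continuous => t; have [_ _ h _] := sp t; exact: h.
- by apply: der_continuous => t; have [_ _ _ h] := sp t; exact: h.
- by apply: der_continuous => t; have [_ h] := sv j j0 j1 t; exact: h.
Qed.

Lemma normalized_sub (x x' : 'I_d -> R -> R) : (forall i, continuous (x i)) ->
  (forall i, continuous (x' i)) -> normalized i0 i1 T x -> normalized i0 i1 T x' ->
  normalized i0 i1 T (fun i t => x i t - x' i t).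
Proof.
move=> cx cx' [m v] [m' v']; split; first by rewrite mean_sub ?m ?m' ?subrr.
move=> j j0 j1; have [a b] := v j j0 j1; have [a' b'] := v' j j0 j1.
have cj := cx j; have cj' := cx' j; split.
  have E t : (x j t - x' j t) * cos t = x j t * cos t - x' j t * cos t by ring.
  by rewrite (funext E) mean_sub ?a ?a' ?subrr //; cont.
have E t : (x j t - x' j t) * sin t = x j t * sin t - x' j t * sin t by ring.
by rewrite (funext E) mean_sub ?b ?b' ?subrr //; cont.
Qed.

Lemma tangent_sub L A : tangent i0 i1 L -> tangent i0 i1 A -> tangent i0 i1 (L - A).
Proof.
move=> [a h] [a' h']; split; first by rewrite linearB /= a a' opprD.
by move=> i j *; rewrite !mxE h ?h' // subrr.
Qed.

Lemma cont_unif_lim (u : R -> R) : (forall e : R, 0 < e -> exists2 v : R -> R, continuous v &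
  forall t, `|v t - u t| <= e) -> continuous u.
Proof.
move=> h t; apply/cvgrPdist_le => e epos.
have [v cv hv] := h (e / 3) ltac:(by rewrite divr_gt0).
have e3 : 0 < e / 3 by rewrite divr_gt0.
have H : \forall s \near t, `|v t - v s| <= e / 3 by move/cvgrPdist_le : (cv t); apply.
apply: filterS H => s hs.
have -> : u t - u s = (v t - v s) - (v t - u t) + (v s - u s) by ring.
by apply: le_trans (norm_add_le (norm_sub_le hs (hv t)) (hv s)) _; lra.
Qed.

(** The outcome of a Lyapunov-Schmidt reduction: [L] is the remaining obstruction, and when it
    vanishes [X *m O] solves the true problem. *)
Definition LS_solution eps O r (S : (R -> 'rV[R]_d) * (R -> 'rV[R]_d) * 'M[R]_d) :=
  let X := S.1.1 in let P := S.1.2 in let L := S.2 in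
  [/\ tangent i0 i1 L,
   (forall i t, is_derive t 1 (fun s => X s 0 i) (phiK (dot (P t) (P t)) * P t 0 i)) /\
   (forall i t, is_derive t 1 (fun s => P s 0 i)
     (- phiV (dot (X t) (X t)) * X t 0 i + eps * (G t (X t *m O) *m O^T) 0 i - (orbit t *m L) 0 i)),
   (forall t, X (t + T) = X t) /\ (forall t, P (t + T) = P t),
   forall A, A^T = - A -> mean T (fun t => dot (X t) (orbit t *m A)) = 0
  & forall t i, `|X t 0 i - orbit t 0 i| <= r /\ `|P t 0 i - rot t e1 0 i| <= r].

(** One scalar function on [Z] encodes two curves, [true] marking the position and [false] the
    momentum, as [sup_contraction] expects. *)
Let Z := (bool * 'I_d * R)%type.
Implicit Types u v : Z -> R.

Let xi u t : 'rV[R]_d := \row_i u (true, i, t).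
Let et u t : 'rV[R]_d := \row_i u (false, i, t).

Let ff u i t := remainder phiK bK e1 (e1 + et u t) i.
Let gg eps O u i t :=
  - remainder phiV bV e0 (e0 + xi u t) i + (eps *: rot_force O t (e0 + xi u t)) 0 i.

Let admissible (b : R) u := [/\ forall c i, continuous (fun t => u (c, i, t)),
  forall c i, Tperiodic T (fun t => u (c, i, t)) & forall z, `|u z| <= b].

(** [F O u] solves the linear problem with the nonlinear terms frozen at [u]. The remainders have a
    small Lipschitz constant near the orbit and the perturbation one of order [eps], so [F O]
    contracts a small ball, with constants uniform in [O]. *)
Lemma LS_family r : 0 < r -> exists eps0 C, [/\ 0 < eps0, 0 <= C &
  forall eps, `|eps| <= eps0 -> exists S : 'M[R]_d -> (R -> 'rV[R]_d) * (R -> 'rV[R]_d) * 'M[R]_d,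
    (forall O, orthogonal O -> LS_solution eps O r (S O)) /\
    (forall O O' s, orthogonal O -> orthogonal O' -> (forall i j, `|O i j - O' i j| <= s) ->
      forall t i, `|(S O).1.1 t 0 i - (S O').1.1 t 0 i| <= C * s /\
                  `|(S O).1.2 t 0 i - (S O').1.2 t 0 i| <= C * s)].
Proof.
move=> r0.
have [CS CS0 lin] := rotating_bound i0 i1 T0 k01 ck pc ps.
(* [CS] bounds the linear solution operator, so [2 * CS * del <= 1 / 4]: one [del] is for the
   remainders, the other for the perturbation. *)
pose del := (8 * (CS + 1))^-1.
have del0 : 0 < del by rewrite invr_gt0; lra.
have delE : del * (8 * (CS + 1)) = 1 by rewrite /del mulVf //; lra.
have CSdel : CS * del <= 1 / 8 by move: delE del0; nra.
have [rK [rK0 _ hK]] := remainder_strict d (profK k01) del0.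
have [rV [rV0 _ hV]] := remainder_strict d profV del0.
have [rG [CG [rG0 rG1 CG0 [hG1 hG2 hG3]]]] := rot_force_bound i01 pert.
pose b := Num.min (Num.min rK rV) (Num.min rG (r / 2)).
have b0 : 0 < b by rewrite !lt_min rK0 rV0 rG0 divr_gt0.
have bK' : b <= rK by rewrite !ge_min lexx.
have bV' : b <= rV by rewrite !ge_min lexx orbT.
have bG' : b <= rG by rewrite !ge_min lexx !orbT.
have br : b <= r / 2 by rewrite !ge_min lexx !orbT.
(* [eps0 * CG] must be below [del * b], to preserve the ball of radius [b], and below [del], to
   contract; the divisor [b + 1] yields both. *)
pose eps0 := del * b / (CG + 1) / (b + 1).
have eps00 : 0 < eps0 by rewrite !divr_gt0 ?mulr_gt0 //; lra.
have epsE : eps0 * (CG + 1) * (b + 1) = del * b.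
  by rewrite /eps0; field; rewrite !gt_eqF //; lra.
have eC0 : 0 <= eps0 * CG by rewrite mulr_ge0 // ltW.
have epsC1 : eps0 * CG <= del * b by move: epsE eC0 (ltW eps00) (ltW b0); nra.
have epsC2 : eps0 * CG <= del.
  have h : eps0 * CG * (b + 1) <= del * (b + 1).
    have : 0 <= eps0 * (b + 1) by rewrite mulr_ge0 ?addr_ge0 // ltW.
    by move: epsE del0; nra.
  by rewrite ler_pM2r // in h; lra.
exists eps0, 4; split=> // eps epsle.
have bnd c i u t : admissible b u -> `|u (c, i, t)| <= b by case=> _ _; apply.
have nearK u t : admissible b u -> forall i, `|(e1 + et u t) 0 i - e1 0 i| <= rK.
  by move=> au i; rewrite mxE addrAC subrr add0r mxE; apply: le_trans bK'; exact: bnd.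
have nearV u t : admissible b u -> forall i, `|(e0 + xi u t) 0 i - e0 0 i| <= rV.
  by move=> au i; rewrite mxE addrAC subrr add0r mxE; apply: le_trans bV'; exact: bnd.
have nearG u t : admissible b u -> forall i, `|(e0 + xi u t) 0 i - e0 0 i| <= rG.
  by move=> au i; rewrite mxE addrAC subrr add0r mxE; apply: le_trans bG'; exact: bnd.
have cxi u : admissible b u -> forall i, continuous (fun t => (e0 + xi u t) 0 i).
  move=> [cu _ _] i; have cui := cu true i.
  have E t : (e0 + xi u t) 0 i = e0 0 i + u (true, i, t) by rewrite !mxE.
  by apply: cont_eq E _; cont.
have e1K (e x : 'rV[R]_d) i : (e + x) 0 i - e 0 i = x 0 i by rewrite mxE addrAC subrr add0r.
have eD (e x y : 'rV[R]_d) i : (e + x) 0 i - (e + y) 0 i = x 0 i - y 0 i by rewrite !mxE; ring.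
have fflip u v M t s : admissible b u -> admissible b v ->
    (forall i, `|u (false, i, t) - v (false, i, s)| <= M) ->
    forall i, `|ff u i t - ff v i s| <= del * M.
  move=> au av h i; apply: (hK _ (e1_unit i1)); [exact: nearK|exact: nearK|].
  by move=> j; rewrite eD !mxE.
have gVlip u v M t s : admissible b u -> admissible b v ->
    (forall i, `|u (true, i, t) - v (true, i, s)| <= M) ->
    forall i, `|remainder phiV bV e0 (e0 + xi u t) i - remainder phiV bV e0 (e0 + xi v s) i| <= del * M.
  move=> au av h i; apply: (hV _ (e0_unit i0)); [exact: nearV|exact: nearV|].
  by move=> j; rewrite eD !mxE.
have ffb u t i : admissible b u -> `|ff u i t| <= del * b.
  move=> au; have r1 : 0 < rK by [].
  have h := hK _ (e1_unit i1) (e1 + et u t) e1 b (nearK u t au)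
    (fun j => ltac:(by rewrite subrr normr0 ltW)) (fun j => ltac:(by rewrite e1K mxE; exact: bnd)) i.
  by rewrite (remainder_unit i (profK k01) (e1_unit i1)) subr0 in h.
have gVb u t i : admissible b u -> `|remainder phiV bV e0 (e0 + xi u t) i| <= del * b.
  move=> au; have h := hV _ (e0_unit i0) (e0 + xi u t) e0 b (nearV u t au)
    (fun j => ltac:(by rewrite subrr normr0 ltW)) (fun j => ltac:(by rewrite e1K mxE; exact: bnd)) i.
  by rewrite (remainder_unit i profV (e0_unit i0)) subr0 in h.
have cff u i : admissible b u -> continuous (ff u i).
  move=> au; have [cu _ _] := au.
  apply: (@lip_continuous _ d _ (fun i t => u (false, i, t)) del) => // s t M _ _ h.
  exact: fflip.
have X0n O u t : orthogonal O -> admissible b u -> rot t (e0 + xi u t) *m O != 0.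
  by move=> hO au; have [] := hG1 O t (e0 + xi u t) hO (nearG u t au).
have cgg O u i : orthogonal O -> admissible b u -> continuous (gg eps O u i).
  move=> hO au; have [cu _ _] := au.
  have cV : continuous (fun t => remainder phiV bV e0 (e0 + xi u t) i).
    apply: (@lip_continuous _ d _ (fun i t => u (true, i, t)) del) => // s t M _ _ h.
    exact: gVlip.
  have cF : continuous (fun t => rot_force O t (e0 + xi u t) 0 i).
    apply: cont_rotN => j; apply: cont_mulmx => l.
    apply: (pert_contG pert) => [m|t]; last exact: X0n.
    by apply: cont_mulmx => n; apply: cont_rot; exact: cxi.
  have E t : gg eps O u i t = - remainder phiV bV e0 (e0 + xi u t) i + eps * rot_force O t (e0 + xi u t) 0 i.
    by rewrite /gg; congr (_ + _); rewrite mxE.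
  by apply: cont_eq E _; cont.
have ggE O u i t : gg eps O u i t = - remainder phiV bV e0 (e0 + xi u t) i + eps * rot_force O t (e0 + xi u t) 0 i.
  by rewrite /gg; congr (_ + _); rewrite mxE.
have pxi u t : admissible b u -> xi u (t + T) = xi u t.
  by move=> [_ pu _]; apply/rowP => i; rewrite !mxE; exact: (pu true i t).
have pet u t : admissible b u -> et u (t + T) = et u t.
  by move=> [_ pu _]; apply/rowP => i; rewrite !mxE; exact: (pu false i t).
have pff u i : admissible b u -> Tperiodic T (ff u i) by move=> au t; rewrite /ff pet.
have prot t x : rot (t + T) x = rot t x by apply: rot_periodic.
have protN t x : rot (- (t + T)) x = rot (- t) x.
  by apply/rowP => i; rewrite !mxE !cosN !sinN pc ps.
have pgg O u i : orthogonal O -> admissible b u -> Tperiodic T (gg eps O u i).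
  by move=> hO au t; rewrite /gg pxi // /rotated_force protN prot (pert_perG pert) //; exact: X0n.
(* The zero triple is the default away from orthogonal matrices and admissible functions. *)
have /choice [sol hsol] : forall Ou : 'M[R]_d * (Z -> R), exists s : ('I_d -> R -> R) * ('I_d -> R -> R) * 'M[R]_d,
    orthogonal Ou.1 -> admissible b Ou.2 ->
    [/\ rotating_system i0 i1 k (ff Ou.2) (gg eps Ou.1 Ou.2) s.1.1 s.1.2 s.2,
      normalized i0 i1 T s.1.1, tangent i0 i1 s.2, forall i, Tperiodic T (s.1.1 i) & forall i, Tperiodic T (s.1.2 i)].
  move=> -[Q u] /=.
  have [[hO au]|n] := pselect (orthogonal Q /\ admissible b u); last first.
    by exists (fun _ _ => 0, fun _ _ => 0, 0) => hO au; case: n.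
  have [x [y [L h]]] := rotating_exists i01 T0 k01 ck pc ps (fun i => cff u i au) (fun i => cgg Q u i hO au)
     (fun i => pff u i au) (fun i => pgg Q u i hO au).
  by exists (x, y, L).
pose F O u (z : Z) := if z.1.1 then (sol (O, u)).1.1 z.1.2 z.2 else (sol (O, u)).1.2 z.1.2 z.2.
have est O O' u v M s : orthogonal O -> orthogonal O' -> admissible b u -> admissible b v ->
    (forall z, `|u z - v z| <= M) -> (forall i j, `|O i j - O' i j| <= s) ->
    forall z, `|F O u z - F O' v z| <= M / 4 + s / 8.
  move=> hO hO' au av hM hs; have M0 : 0 <= M by apply: le_trans (hM (true, i0, 0)).
  have s0 : 0 <= s by apply: le_trans (hs i0 i0).
  have [sys n1 t1 px py] := hsol (O, u) hO au; have [sys' n2 t2 px' py'] := hsol (O', v) hO' av.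
  have [cx cy] := rotating_continuous sys; have [cx' cy'] := rotating_continuous sys'.
  have [] := lin _ _ _ _ _ (2 * del * M + del * s) (rotating_system_sub sys sys').
  - by apply: normalized_sub.
  - by apply: tangent_sub.
  - by move=> i t; rewrite px px'.
  - by move=> i t; rewrite py py'.
  - by move=> i; apply: cont_sub; apply: cff.
  - by move=> i; apply: cont_sub; apply: cgg.
  - move=> i t; apply: le_trans (fflip u v M t t au av (fun j => hM (false, j, t)) i) _.
    by have := mulr_ge0 (ltW del0) M0; have := mulr_ge0 (ltW del0) s0; lra.
  - move=> i t /=; have hV' := gVlip u v M t t au av (fun j => hM (true, j, t)) i.
    have hxy j : `|(e0 + xi u t) 0 j - (e0 + xi v t) 0 j| <= M by rewrite eD !mxE.
    have hG' := hG2 O O' t _ _ M s hO hO' (nearG u t au) (nearG v t av) hxy hs i.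
    have hE : `|eps * (rot_force O t (e0 + xi u t) 0 i - rot_force O' t (e0 + xi v t) 0 i)| <= del * (M + s).
      apply: le_trans (norm_mul_le epsle hG') _.
      by rewrite mulrA ler_wpM2r // addr_ge0.
    have -> : gg eps O u i t - gg eps O' v i t =
       eps * (rot_force O t (e0 + xi u t) 0 i - rot_force O' t (e0 + xi v t) 0 i)
       - (remainder phiV bV e0 (e0 + xi u t) i - remainder phiV bV e0 (e0 + xi v t) i).
      by rewrite !ggE; ring.
    by apply: le_trans (norm_sub_le hE hV') _; lra.
  have small : CS * (2 * del * M + del * s) <= M / 4 + s / 8.
    have := ler_wpM2r M0 CSdel; have := ler_wpM2r s0 CSdel; lra.
  move=> hx hy _ [[[] i] t]; [exact: le_trans (hx i t) small|exact: le_trans (hy i t) small].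
have Fadm O u : orthogonal O -> admissible b u -> admissible b (F O u).
  move=> hO au; have [sys n1 t1 px py] := hsol (O, u) hO au.
  have [cx cy] := rotating_continuous sys.
  have [] := lin _ _ _ _ _ (2 * del * b) sys n1 t1 px py.
  - by move=> i; apply: cff.
  - by move=> i; apply: cgg.
  - move=> i t; apply: le_trans (ffb u t i au) _; have := mulr_ge0 (ltW del0) (ltW b0); lra.
  - move=> i t; rewrite ggE.
    have [_ hGb] := hG1 O t _ hO (nearG u t au).
    have -> : 2 * del * b = del * b + del * b by ring.
    apply: norm_add_le; first by rewrite normrN; exact: gVb.
    exact: le_trans (norm_mul_le epsle (hGb i)) _.
  move=> hx hy _.
  have small : CS * (2 * del * b) <= b by have := ler_wpM2r (ltW b0) CSdel; lra.
  split.
  - by case=> i; [exact: cx|exact: cy].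
  - by case=> i; [exact: px|exact: py].
  - move=> [[[] i] t]; [exact: le_trans (hx i t) small|exact: le_trans (hy i t) small].
have adm0 : admissible b (fun=> 0).
  split=> [c i|c i t|z]; [exact: cont_cst|by []|by rewrite normr0 ltW].
have /choice [fp hfp] : forall O, exists u, orthogonal O -> admissible b u /\ F O u = u.
  move=> Q; have [hQ|n] := pselect (orthogonal Q); last by exists (fun=> 0) => h; case: n.
  have [||||u au fu] := @sup_contraction R Z (admissible b) (F Q) (fun=> 0) (b + b) adm0.
  - by move=> u; exact: Fadm.
  - move=> un u Dn lim; split.
    + move=> c i; apply: cont_unif_lim => e epos; have [N hN] := lim e epos.
      exists (fun t => un N (c, i, t)); first by have [] := Dn N.
      by move=> t; exact: hN.
    + move=> c i t; apply/eqP; rewrite -subr_eq0 -normr_le0; apply/ler_addgt0Pl => e epos.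
      have [N hN] := lim (e / 2) ltac:(by rewrite divr_gt0); have [_ pN _] := Dn N.
      have h1 := hN N (leqnn _) (c, i, t + T); have h2 := hN N (leqnn _) (c, i, t).
      rewrite (pN c i t) in h1; have := norm_sub_le h2 h1; rewrite addr0.
      by rewrite (_ : un N (c, i, t) - u (c, i, t) - (un N (c, i, t) - u (c, i, t + T)) = u (c, i, t + T) - u (c, i, t)); [lra|ring].
    + move=> z; apply/ler_addgt0Pl => e epos; have [N hN] := lim e epos.
      have [_ _ bN] := Dn N; have := norm_sub_le (bN z) (hN N (leqnn _) z).
      by rewrite opprB addrCA subrr addr0 addrC.
  - by move=> u v [_ _ bu] [_ _ bv] z; exact: norm_sub_le.
  - move=> u v M au av hM z; have M0 : 0 <= M by apply: le_trans (hM z).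
    have h0 i j : `|Q i j - Q i j| <= 0 by rewrite subrr normr0.
    by apply: le_trans (est Q Q u v M 0 hQ hQ au av hM h0 z) _; lra.
  by exists u.
pose S O := (fun t => rot t (e0 + xi (fp O) t), fun t => rot t (e1 + et (fp O) t), (sol (O, fp O)).2).
exists S; split.
  move=> O hO; have [au fu] := hfp O hO.
  have [sys n1 t1 _ _] := hsol (O, fp O) hO au.
  have sx : (sol (O, fp O)).1.1 = fun i t => xi (fp O) t 0 i.
    by apply/funext => i; apply/funext => t; rewrite mxE -{2}fu.
  have sy : (sol (O, fp O)).1.2 = fun i t => et (fp O) t 0 i.
    by apply/funext => i; apply/funext => t; rewrite mxE -{2}fu.
  rewrite /= sx sy in sys n1.
  have [dX dP] := frame_change i01 t1.1 sys.
  have cxi0 i : continuous (fun t => xi (fp O) t 0 i).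
    have E t : xi (fp O) t 0 i = fp O (true, i, t) by rewrite mxE.
    by apply: cont_eq E _; have [] := au.
  split=> //=.
  - split=> [//|i t]; apply: der_eq (dP i t) _; congr (_ + _ - _).
    by rewrite rotZ // rotKV // mxE.
  - by split=> t; rewrite prot ?pxi ?pet.
  - by move=> A hA; exact: normalized_constraint.
  move=> t i; split.
    have -> : rot t (e0 + xi (fp O) t) 0 i - orbit t 0 i = rot t (xi (fp O) t) 0 i.
      by rewrite rotD // mxE addrAC subrr add0r.
    have h j : `|xi (fp O) t 0 j| <= b by rewrite mxE; exact: bnd.
    by apply: le_trans (norm_rot_le i01 t h i) _; lra.
  have -> : rot t (e1 + et (fp O) t) 0 i - rot t e1 0 i = rot t (et (fp O) t) 0 i.
    by rewrite rotD // mxE addrAC subrr add0r.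
  have h j : `|et (fp O) t 0 j| <= b by rewrite mxE; exact: bnd.
  by apply: le_trans (norm_rot_le i01 t h i) _; lra.
move=> O O' s hO hO' hs; have [au fu] := hfp O hO; have [au' fu'] := hfp O' hO'.
have s0 : 0 <= s by apply: le_trans (hs i0 i0).
(* By [est] a bound [M] on the difference improves to [M / 4 + s / 8], which gives [2 s]; the
   rotation to the fixed frame doubles this to the constant 4. *)
have close z : `|fp O z - fp O' z| <= 2 * s.
  move: z; apply: (@halving_bound _ _ (fun z => fp O z - fp O' z) s (b + b)).
    by move=> z; apply: norm_sub_le; [case: au|case: au'].
  move=> M hM z; have M0 : 0 <= M by apply: le_trans (hM z).
  by rewrite -fu -fu'; apply: le_trans (est O O' _ _ M s hO hO' au au' hM hs z) _; lra.
have -> : 4 * s = 2 * (2 * s) by ring.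
move=> t i; split.
  have -> : (S O).1.1 t 0 i - (S O').1.1 t 0 i = rot t (xi (fp O) t - xi (fp O') t) 0 i.
    by rewrite /S /= rotB // !rotD // !mxE; ring.
  by apply: norm_rot_le => // j; rewrite !mxE.
have -> : (S O).1.2 t 0 i - (S O').1.2 t 0 i = rot t (et (fp O) t - et (fp O') t) 0 i.
  by rewrite /S /= rotB // !rotD // !mxE; ring.
by apply: norm_rot_le => // j; rewrite !mxE.
Qed.

End Family.

(** * Cayley curves and minima on the orthogonal group *)

Section Cayley.
Context {R : realType} (d : nat).
Implicit Types (L O N : 'M[R]_d) (lam s : R).

(** A kernel vector satisfies [v = s v L], while [<v, v L> = 0] by skewness, so [|v|^2 = 0]. This
    holds for every [s]. *)
Lemma skew_unit L s : L^T = - L -> 1%:M - s *: L \in unitmx.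
Proof.
move=> La; rewrite -row_free_unit; apply: inj_row_free => v.
rewrite mulmxBr mulmx1 -scalemxAr => /eqP; rewrite subr_eq0 => /eqP vE.
have v0 : dot v v = 0.
  have h : dot v (v *m L) = - dot v (v *m L).
    by rewrite -{1}dotC dot_mulmx La mulmxN dotNr.
  have h0 : dot v (v *m L) = 0 by lra.
  by rewrite {2}vE dotZr h0 mulr0.
apply/rowP => i; rewrite mxE; apply/eqP; rewrite -sqrf_eq0 eq_le sqr_ge0 andbT.
by rewrite -v0 sqr_coord_le.
Qed.

Lemma norm_mulM_le L N (a b : R) : (forall i j, `|L i j| <= a) -> (forall i j, `|N i j| <= b) ->
  forall i j, `|(L *m N) i j| <= d%:R * (a * b).
Proof. by move=> la nb i j; rewrite mxE; apply: norm_sum_le => l; apply: norm_mul_le. Qed.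

Lemma coord_norm_le n (q : 'rV[R]_n) i : `|q 0 i| <= `|q|.
Proof.
rewrite [leRHS]/Num.Def.normr /= mx_normrE.
exact: (le_bigmax _ (fun ij : 'I_1 * 'I_n => `|q ij.1 ij.2|) (0, i)).
Qed.

(* Cayley transform of [s L]: an orthogonal matrix agreeing with [1 + 2 s L] to first order. *)
Lemma cayley L lam : L^T = - L -> (forall i j, `|L i j| <= lam) ->
  forall s, exists N, [/\ orthogonal N, forall i j, `|(N - 1%:M) i j| <= 2 * d%:R * lam * `|s|
   & forall i j, `|(N - 1%:M - (2 * s) *: L) i j| <= 2 * d%:R ^+ 2 * lam ^+ 2 * s ^+ 2].
Proof.
move=> La Ll s.
have u1 := skew_unit s La; pose B := invmx (1%:M - s *: L).
have BV : B *m (1%:M - s *: L) = 1%:M by rewrite mulVmx.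
have VB : (1%:M - s *: L) *m B = 1%:M by rewrite mulmxV.
pose N := B *m (1%:M + s *: L).
have comm : (1%:M + s *: L) *m (1%:M - s *: L) = (1%:M - s *: L) *m (1%:M + s *: L).
  move: (s *: L) => a.
  by rewrite mulmxBr mulmxDr !mulmx1 !mulmxDl ?mulNmx !mul1mx opprD !addrA addrK subrK.
have Lt i j : L j i = - L i j by have := congr1 (fun A : 'M[R]_d => A i j) La; rewrite !mxE.
have tp : (1%:M + s *: L)^T = 1%:M - s *: L.
  by apply/matrixP => i j; rewrite !mxE Lt eq_sym mulrN.
have tm : (1%:M - s *: L)^T = 1%:M + s *: L.
  by apply/matrixP => i j; rewrite !mxE Lt eq_sym mulrN opprK.
have oN : orthogonal N.
  rewrite /orthogonal /N trmx_mul tp mulmxA -(mulmxA B) comm mulmxA BV mul1mx.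
  by rewrite -tm -trmx_mul BV trmx1.
have BN : 2 *: B = N + 1%:M.
  have -> : N + 1%:M = B *m ((1%:M + s *: L) + (1%:M - s *: L)) by rewrite mulmxDr BV.
  by rewrite addrACA subrr addr0 mulmxDr !mulmx1 scaler_nat mulr2n.
(* [2 B = N + 1] with [N] orthogonal bounds the resolvent [B] without a Neumann series. *)
have B1 i j : `|B i j| <= 1.
  have := congr1 (fun A : 'M[R]_d => A i j) BN; rewrite !mxE => h.
  have hN := orthogonal_le1 oN i j.
  have h1 : `|(i == j)%:R : R| <= 1 by case: eqP; rewrite ?normr1 ?normr0.
  have -> : B i j = (N i j + (i == j)%:R) / 2 by rewrite mxE in h *; lra.
  rewrite normrM (ger0_norm (_ : 0 <= 2^-1)) ?invr_ge0 //.
  have := norm_add_le hN h1; lra.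
have N1 : N - 1%:M = B *m ((2 * s) *: L).
  have -> : N - 1%:M = B *m ((1%:M + s *: L) - (1%:M - s *: L)) by rewrite mulmxBr BV.
  congr (_ *m _); rewrite opprB addrC addrA subrK -scalerDl; congr (_ *: _); ring.
(* Inserting [1 = B (1 - s L)] turns the defect into [2 s^2 B L^2]. *)
have N2 : N - 1%:M - (2 * s) *: L = B *m (2 * s ^+ 2 *: (L *m L)).
  have E : (2 * s) *: L = B *m ((1%:M - s *: L) *m ((2 * s) *: L)) by rewrite mulmxA BV mul1mx.
  rewrite N1 {2}E -mulmxBr; congr (_ *m _).
  by rewrite mulmxBl mul1mx opprB addrC subrK -scalemxAl -scalemxAr scalerA; congr (_ *: _); ring.
exists N; split=> //.
- move=> i j; rewrite N1; have -> : 2 * d%:R * lam * `|s| = d%:R * (1 * (2 * `|s| * lam)) by ring.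
  apply: norm_mulM_le => // a b; rewrite mxE; apply: norm_mul_le => //.
  by rewrite normrM ger0_norm.
move=> i j; rewrite N2; have -> : 2 * d%:R ^+ 2 * lam ^+ 2 * s ^+ 2 = d%:R * (1 * (2 * s ^+ 2 * (d%:R * (lam * lam)))) by ring.
apply: norm_mulM_le => // a b; rewrite mxE; apply: norm_mul_le; last exact: norm_mulM_le.
by rewrite normrM !ger0_norm ?sqr_ge0.
Qed.

(** O(d) is bounded and cut out by quadratic equations, hence compact. Matrices are flattened to row
    vectors for the extreme value theorem, and a Lipschitz bound on nearby orthogonal pairs gives
    continuity on this set. *)
Lemma orthogonal_min (f : 'M[R]_d -> R) (C s0 : R) : 0 < s0 -> 0 <= C ->
  (forall O O' s, orthogonal O -> orthogonal O' -> s <= s0 -> (forall i j, `|O i j - O' i j| <= s) ->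
    `|f O - f O'| <= C * s) ->
  exists2 O, orthogonal O & forall O', orthogonal O' -> f O <= f O'.
Proof.
move=> s00 C0 lip.
pose K : set 'rV[R]_(d * d) := [set q | orthogonal (vec_mx q)].
have K0 : K !=set0 by exists (mxvec 1%:M); rewrite /K /= mxvecK /orthogonal trmx1 mulmx1.
have Kb (q : 'rV[R]_(d * d)) : K q -> `|q| <= 1.
  move=> /orthogonal_le1 h; rewrite [leLHS]/Num.Def.normr /= mx_normrE; apply: bigmax_le => // -[i j] _ /=.
  by rewrite ord1; case/mxvec_indexP: j => a b; have := h a b; rewrite mxE.
have Kc : compact K.
  apply: bounded_closed_compact.
    by exists 1; split=> // M M1 q /Kb /le_trans; apply; apply: ltW.
  have -> : K = \bigcap_(p in [set: 'I_d * 'I_d])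
     [set q | (vec_mx q *m (vec_mx q)^T) p.1 p.2 = (1%:M : 'M[R]_d) p.1 p.2].
    apply/seteqP; split => [q /= hq p _|q /= hq]; first by rewrite /= hq.
    by apply/matrixP => i j; exact: (hq (i, j)).
  apply: closed_bigI => p _.
  pose g (q : 'rV[R]_(d * d)) : R := \sum_l q 0 (mxvec_index p.1 l) * q 0 (mxvec_index p.2 l).
  have gE q : (vec_mx q *m (vec_mx q)^T) p.1 p.2 = g q.
    by rewrite mxE; apply: eq_bigr => l _; rewrite !mxE.
  have cg : continuous g.
    pose gr (r : seq 'I_d) (q : 'rV[R]_(d * d)) : R :=
      \sum_(l <- r) q 0 (mxvec_index p.1 l) * q 0 (mxvec_index p.2 l).
    suff : forall r, continuous (gr r) by apply.
    elim=> [|l r ih].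
      have -> : gr [::] = cst 0 by apply/funext => q; rewrite /gr big_nil.
      exact: cst_continuous.
    pose c (i : 'I_d) (q : 'rV[R]_(d * d)) : R := q 0 (mxvec_index i l).
    have cc i : continuous (c i) by exact: coord_continuous.
    have -> : gr (l :: r) = (c p.1 \* c p.2) + gr r.
      by apply/funext => q; rewrite /gr big_cons.
    move=> q; apply: (@continuousD R R); last exact: ih.
    by apply: (@continuousM R); exact: cc.
  rewrite (_ : [set _ | _] = g @^-1` [set (1%:M : 'M[R]_d) p.1 p.2]); last first.
    by apply/seteqP; split => q h; [rewrite /preimage /= -gE|rewrite /= gE]; exact: h.
  apply: preimage_closed; first by move=> q _; exact: cg.
  exact: closed_eq.
have cf : {within K, continuous (fun q => f (vec_mx q))}.
  apply/subspace_continuousP => q Kq; apply/cvgrPdist_le => e e0.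
  pose s := Num.min s0 (e / (C + 1)).
  have s1 : 0 < s by rewrite lt_min s00 divr_gt0 //; lra.
  have s2 : s <= s0 by rewrite ge_min lexx.
  have s3 : C * s <= e.
    have : s * (C + 1) <= e by rewrite -ler_pdivlMr; [rewrite ge_min lexx orbT|lra].
    have := ltW s1; nra.
  rewrite near_withinE; near=> q' => Kq'.
  apply: le_trans s3; apply: lip => // i j.
  rewrite !mxE; have : ball q s q' by near: q'; exact: nbhsx_ballx.
  by rewrite -ball_normE /= => h; apply: le_trans (ltW h); have := coord_norm_le (q - q') (mxvec_index i j); rewrite !mxE.
have [q qK hq] := EVT_min_rV K0 Kc cf.
rewrite inE in qK; exists (vec_mx q) => // O' hO'.
by have := hq (mxvec O'); rewrite mxvecK; apply; rewrite inE /K /= mxvecK.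
Unshelve. all: by end_near. Qed.

End Cayley.

(** * The action density and its first variation *)

Section Lagrangian.
Context {R : realType} (d : nat) (i0 i1 : 'I_d) (i01 : i0 != i1).
Context (k T : R) (k01 : 0 < k < 1).
Context (W : R -> 'rV[R]_d -> R) (G : R -> 'rV[R]_d -> 'rV[R]_d) (rho Lip : R).
Context (pert : perturbation T W G rho Lip).
Implicit Types (x y e X P : 'rV[R]_d) (L A O N : 'M[R]_d) (M r s t eps : R).

Notation rot := (rot i0 i1).
Notation orbit := (orbit i0 i1).
Notation e1 := (@e1 R d i1).
Notation phiK := (phiK k).
Notation kinetic := (kinetic k).
Notation phiV := (@phiV R).
Notation potential := (@potential R).

(** The velocity as a function of the momentum. *)
Definition psi P := phiK (dot P P) *: P.

(** The two terms in front are the Legendre transform of the kinetic energy, so this is the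
    Lagrangian with the velocity expressed through the momentum. *)
Definition lagrangian eps O t X P := phiK (dot P P) * dot P P - kinetic (dot P P)
  - potential (dot X X) + eps * W t (X *m O).

Definition total_force eps O t X := - phiV (dot X X) *: X + eps *: (G t (X *m O) *m O^T).

Lemma rowBE x y i : (x - y) 0 i = x 0 i - y 0 i.
Proof. by rewrite mxE [X in _ + X]mxE. Qed.

Lemma psiE P i : psi P 0 i = phiK (dot P P) * P 0 i. Proof. by rewrite mxE. Qed.

Lemma dot_mulmx_orth O x y : dot (x *m O^T) y = dot x (y *m O).
Proof. by rewrite dot_mulmx trmxK. Qed.

(** As [psi] is the gradient of the kinetic energy, the first variation of [<P, psi P> - kinetic] is
    [P] paired with the variation of [psi P]. In this form it meets the derivative of a displacement
    of [X] and can be integrated by parts. *)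
Lemma lagr_expand : exists r C, [/\ 0 < r, r <= 1, 0 <= C &
  forall eps t O X P X' P' M, `|eps| <= 1 -> orthogonal O ->
    (forall i, `|X 0 i - orbit t 0 i| <= r) -> (forall i, `|X' 0 i - orbit t 0 i| <= r) ->
    (forall i, `|P 0 i - rot t e1 0 i| <= r) -> (forall i, `|P' 0 i - rot t e1 0 i| <= r) ->
    (forall i, `|X' 0 i - X 0 i| <= M) -> (forall i, `|P' 0 i - P 0 i| <= M) ->
    [/\ `|lagrangian eps O t X' P' - lagrangian eps O t X P
          - (dot P (psi P' - psi P) + dot (total_force eps O t X) (X' - X))| <= C * M ^+ 2,
        `|dot P (psi P' - psi P) + dot (total_force eps O t X) (X' - X)| <= C * M,
        forall i, `|psi P' 0 i - psi P 0 i| <= C * M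
      & forall i, `|P 0 i| <= 2]].
Proof.
have [rK [CK [rK0 rK1 CK0 hK]]] := radial_estimates d (profK k01).
have [rV [CV [rV0 rV1 CV0 hV]]] := radial_estimates d (@profV R).
have rho0 := pert_rho pert; have L0 := pert_lip pert.
have D0 : 0 <= d%:R :> R by exact: ler0n.
pose r := Num.min (Num.min rK rV) (rho / (d%:R + 1)).
have r0 : 0 < r by rewrite !lt_min rK0 rV0 divr_gt0 //; lra.
have rrK : r <= rK by rewrite !ge_min lexx.
have rrV : r <= rV by rewrite !ge_min lexx orbT.
have rrho : d%:R * r <= rho.
  have : r * (d%:R + 1) <= rho by rewrite -ler_pdivlMr; [rewrite !ge_min lexx orbT|lra].
  by have := ltW r0; lra.
have r1 : r <= 1 by apply: le_trans rK1.
pose C := d%:R * CK + CK + CV + Lip * d%:R ^+ 2 + (d%:R * (2 * CK) + d%:R * (CV + d%:R * Lip)) + CK.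
have a1 : 0 <= d%:R * CK by exact: mulr_ge0.
have a2 : 0 <= Lip * d%:R ^+ 2 by rewrite mulr_ge0 // sqr_ge0.
have a3 : 0 <= d%:R * (2 * CK) by rewrite !mulr_ge0.
have a4 : 0 <= d%:R * (CV + d%:R * Lip) by rewrite mulr_ge0 // addr_ge0 // mulr_ge0.
exists r, C; split=> //; first by rewrite /C; lra.
move=> eps t O X P X' P' M eps1 hO hX hX' hP hP' hM hN.
have ou := orbit_unit i01 t.
have pu : dot (rot t e1) (rot t e1) = 1 by rewrite dot_rot // e1_unit.
have [k1 k2 k3] := hK _ pu P' P M (fun i => le_trans (hP' i) rrK) (fun i => le_trans (hP i) rrK) hN.
have [v1 v2 v3] := hV _ ou X' X M (fun i => le_trans (hX' i) rrV) (fun i => le_trans (hX i) rrV) hM.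
have [w1 _ _] := hV _ ou X X 0 (fun i => le_trans (hX i) rrV) (fun i => le_trans (hX i) rrV)
   (fun i => ltac:(by rewrite subrr normr0)).
have M0 : 0 <= M by apply: le_trans (hM i0).
have uO : dot (orbit t *m O) (orbit t *m O) = 1 by rewrite dot_orthogonal.
have nearO (Y : 'rV[R]_d) : (forall i, `|Y 0 i - orbit t 0 i| <= r) ->
    forall i, `|(Y *m O) 0 i - (orbit t *m O) 0 i| <= rho.
  move=> hY i; apply: le_trans rrho; have -> : d%:R * r = d%:R * (r * 1) by ring.
  have -> : (Y *m O) 0 i - (orbit t *m O) 0 i = ((Y - orbit t) *m O) 0 i by rewrite mulmxBl !mxE.
  by apply: norm_mulmx_le; [move=> j; rewrite rowBE|exact: orthogonal_le1].
have XO i : `|(X' *m O) 0 i - (X *m O) 0 i| <= d%:R * (M * 1).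
  have -> : (X' *m O) 0 i - (X *m O) 0 i = ((X' - X) *m O) 0 i by rewrite mulmxBl !mxE.
  by apply: norm_mulmx_le; [move=> j; rewrite rowBE|exact: orthogonal_le1].
have [g1 _ g3] := pert_est pert t uO (nearO X' hX') (nearO X hX) XO.
have [gX _ _] := pert_est pert t uO (nearO X hX) (nearO X hX) (M := 0)
   (fun i => ltac:(by rewrite subrr normr0)).
have psiM i : `|psi P' 0 i - psi P 0 i| <= CK * M by rewrite !psiE.
have P2 : forall i, `|P 0 i| <= 2 := near_unit_bound pu r1 hP.
have CM : CK * M <= C * M by rewrite ler_wpM2r // /C; lra.
split=> //; last by move=> i; apply: le_trans (psiM i) CM.
- have dP : `|dot (P' - P) (psi P' - psi P)| <= d%:R * (M * (CK * M)).
    by apply: norm_dot_le => i; rewrite !rowBE.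
  have g3' : `|eps * (W t (X' *m O) - W t (X *m O) - dot (G t (X *m O)) (X' *m O - X *m O))|
      <= 1 * (Lip * (d%:R * (M * 1)) ^+ 2) by exact: norm_mul_le.
  have -> : lagrangian eps O t X' P' - lagrangian eps O t X P
          - (dot P (psi P' - psi P) + dot (total_force eps O t X) (X' - X)) =
     dot (P' - P) (psi P' - psi P) - (kinetic (dot P' P') - kinetic (dot P P) - phiK (dot P P) * dot P (P' - P))
     - (potential (dot X' X') - potential (dot X X) - phiV (dot X X) * dot X (X' - X))
     + eps * (W t (X' *m O) - W t (X *m O) - dot (G t (X *m O)) (X' *m O - X *m O)).
    have -> : dot (total_force eps O t X) (X' - X) =
       - phiV (dot X X) * dot X (X' - X) + eps * dot (G t (X *m O)) (X' *m O - X *m O).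
      by rewrite /total_force dotDl !dotZl dot_mulmx_orth mulmxBl.
    rewrite /lagrangian.
    rewrite (dotBr (P' - P)) !(dotBl P' P) (dotBr P (psi P')) /psi !dotZr (dotBr P P' P) (dotC P' P).
    by ring.
  apply: le_trans (norm_add_le (norm_sub_le (norm_sub_le dP k3) v3) g3') _.
  have -> : d%:R * (M * (CK * M)) + CK * M ^+ 2 + CV * M ^+ 2 + 1 * (Lip * (d%:R * (M * 1)) ^+ 2)
    = (d%:R * CK + CK + CV + Lip * d%:R ^+ 2) * M ^+ 2 by ring.
  by rewrite ler_wpM2r ?sqr_ge0 // /C; lra.
have hF i : `|total_force eps O t X 0 i| <= CV + d%:R * Lip.
  have -> : total_force eps O t X 0 i = - (phiV (dot X X) * X 0 i) + eps * (G t (X *m O) *m O^T) 0 i.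
    by rewrite /total_force mxE [in LHS]mxE [X in _ + X = _]mxE mulNr.
  apply: norm_add_le; first by rewrite normrN.
  rewrite -(mul1r (d%:R * Lip)); apply: norm_mul_le => //.
  have -> : d%:R * Lip = d%:R * (Lip * 1) by ring.
  by apply: norm_mulmx_le => // a b; rewrite mxE; exact: orthogonal_le1.
have b1 : `|dot P (psi P' - psi P)| <= d%:R * (2 * (CK * M)).
  by apply: norm_dot_le => // i; rewrite rowBE.
have b2 : `|dot (total_force eps O t X) (X' - X)| <= d%:R * ((CV + d%:R * Lip) * M).
  by apply: norm_dot_le => // i; rewrite rowBE.
apply: le_trans (norm_add_le b1 b2) _.
have -> : d%:R * (2 * (CK * M)) + d%:R * ((CV + d%:R * Lip) * M) = (d%:R * (2 * CK) + d%:R * (CV + d%:R * Lip)) * M by ring.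
by rewrite ler_wpM2r // /C; lra.
Qed.

(** Kinetic energy and potential are rotation invariant, so rotating the perturbation by [N] amounts
    to rotating the curve. This makes solutions for different rotations comparable in one action. *)
Lemma lagr_mulmx eps N O t X P : orthogonal N ->
  lagrangian eps (N *m O) t X P = lagrangian eps O t (X *m N) (P *m N).
Proof. by move=> hN; rewrite /lagrangian !dot_orthogonal // mulmxA. Qed.

Lemma psi_mulmx N P : orthogonal N -> psi (P *m N) = psi P *m N.
Proof. by move=> hN; rewrite /psi dot_orthogonal // -scalemxAl. Qed.

End Lagrangian.

(** * Calculus along vector curves *)

Section VectorCalculus.
Context {R : realType} (d : nat).
Implicit Types (x y dx dy : R -> 'rV[R]_d) (N : 'M[R]_d).

Lemma der_sum (I : Type) (r : seq I) (f df : I -> R -> R) (t : R) :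
  (forall i, is_derive t 1 (f i) (df i t)) ->
  is_derive t 1 (fun s => \sum_(i <- r) f i s) (\sum_(i <- r) df i t).
Proof.
move=> h; elim: r => [|i r ih].
  rewrite big_nil (_ : (fun s => _) = fun=> 0); last by apply/funext => s; rewrite big_nil.
  exact: der_cst.
rewrite big_cons (_ : (fun s => _) = fun s => f i s + \sum_(j <- r) f j s).
  exact: der_add.
by apply/funext => s; rewrite big_cons.
Qed.

Lemma der_dot x y dx dy (t : R) : (forall i, is_derive t 1 (fun s => x s 0 i) (dx t 0 i)) ->
  (forall i, is_derive t 1 (fun s => y s 0 i) (dy t 0 i)) ->
  is_derive t 1 (fun s => dot (x s) (y s)) (dot (dx t) (y t) + dot (x t) (dy t)).
Proof.
move=> hx hy.
rewrite (_ : (fun s => _) = fun s => \sum_i x s 0 i * y s 0 i); last by apply/funext => s; rewrite dotE.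
apply: der_eq (@der_sum _ _ _ (fun i s => dx s 0 i * y s 0 i + x s 0 i * dy s 0 i) t _) _.
  by move=> i; apply: der_eq (der_mul (hx i) (hy i)) _; ring.
by rewrite !dotE -big_split.
Qed.

Lemma der_mulmx x dx N (t : R) : (forall i, is_derive t 1 (fun s => x s 0 i) (dx t 0 i)) ->
  forall j, is_derive t 1 (fun s => (x s *m N) 0 j) ((dx t *m N) 0 j).
Proof.
move=> hx j.
rewrite (_ : (fun s => _) = fun s => \sum_i x s 0 i * N i j); last by apply/funext => s; rewrite mxE.
apply: der_eq (@der_sum _ _ _ (fun i s => dx s 0 i * N i j) t _) _; last by rewrite mxE.
by move=> i; apply: der_eq (der_mul (hx i) (der_cst t (N i j))) _; ring.
Qed.

Lemma cont_sqrt (q : R -> R) : continuous q -> continuous (fun t => Num.sqrt (q t)).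
Proof. by move=> cq t; apply: continuous_comp; [exact: cq|exact: sqrt_continuous]. Qed.

Lemma cont_inv (q : R -> R) : (forall t, q t != 0) -> continuous q -> continuous (fun t => (q t)^-1).
Proof. by move=> q0 cq t; apply: continuousV => //; exact: cq. Qed.

(** For small [s] the linear term dominates, and it has opposite signs at [s] and [- s]. *)
Lemma quadratic_ge0 (m C s0 : R) : 0 < s0 ->
  (forall s, `|s| <= s0 -> 0 <= C * s ^+ 2 + 2 * s * m) -> m = 0.
Proof.
move=> s00 h; apply/eqP; rewrite -normr_le0 leNgt; apply/negP => m0.
pose s := Num.min s0 (`|m| / (`|C| + 1)).
have C1 : 0 < `|C| + 1 by rewrite ltr_wpDl.
have s1 : 0 < s by rewrite lt_min s00 divr_gt0.
have s2 : s * (`|C| + 1) <= `|m| by rewrite -ler_pdivlMr // ge_min lexx orbT.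
have s3 : s <= s0 by rewrite ge_min lexx.
have CC := ler_norm C.
have ha : `|s| <= s0 by rewrite gtr0_norm.
have hb : `|- s| <= s0 by rewrite normrN.
have key : C * s ^+ 2 < 2 * s * `|m|.
  have : C * s <= `|C| * s by rewrite ler_pM2r.
  rewrite expr2; nra.
have := h s ha; have := h (- s) hb; rewrite sqrrN.
have [mp|mn] := leP 0 m; [rewrite ger0_norm // in key|rewrite ltr0_norm // in key]; lra.
Qed.

End VectorCalculus.

(** * Vanishing of the torque *)

Section Normalized.
Context {R : realType} (d : nat) (i0 i1 : 'I_d) (i01 : i0 != i1).
Context (k T : R) (T0 : 0 < T) (k01 : 0 < k < 1) (ck : cos (k * T) != 1).
Context (pc : Tperiodic T (@cos R)) (ps : Tperiodic T (@sin R)).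
Context (W : R -> 'rV[R]_d -> R) (G : R -> 'rV[R]_d -> 'rV[R]_d) (rho Lip : R).
Context (pert : perturbation T W G rho Lip).
Implicit Types (x y e : 'rV[R]_d) (L A O N : 'M[R]_d) (M r s t eps : R).

Notation orbit := (orbit i0 i1).

(** On the circular orbit the mean of [|orbit L|^2] is half the sum [q] of the squares in the rows
    [i0] and [i1]. Replacing one factor by [X] changes it by at most [2 d^2 r q], so [q = 0]; for
    [L] in [tangent], [q] bounds the square of every entry. *)
Lemma tangent_multiplier0 (X : R -> 'rV[R]_d) L r : 8 * d%:R ^+ 2 * r < 1 ->
  tangent i0 i1 L -> (forall i, continuous (fun t => X t 0 i)) ->
  (forall t i, `|X t 0 i - orbit t 0 i| <= r) ->
  mean T (fun t => dot (orbit t *m L) (X t *m L)) = 0 -> L = 0.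
Proof.
move=> rsmall [La Ls] cX hX hm.
have Lt i j : L j i = - L i j by have := congr1 (fun A : 'M[R]_d => A i j) La; rewrite !mxE.
pose q := \sum_j (L i0 j ^+ 2 + L i1 j ^+ 2).
have q0 : 0 <= q by apply: sumr_ge0 => j _; rewrite addr_ge0 ?sqr_ge0.
have q_ge j : L i0 j ^+ 2 + L i1 j ^+ 2 <= q.
  rewrite /q (bigD1 j) //= lerDl; apply: sumr_ge0 => l _; by rewrite addr_ge0 ?sqr_ge0.
have L0q j : L i0 j ^+ 2 <= q by apply: le_trans (q_ge j); rewrite lerDl sqr_ge0.
have L1q j : L i1 j ^+ 2 <= q by apply: le_trans (q_ge j); rewrite lerDr sqr_ge0.
have Lq i j : L i j ^+ 2 <= q.
  move: i; apply: (@rot_case d i0 i1) => // i a b; rewrite (Lt j i) sqrrN.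
  move: j; apply: (@rot_case d i0 i1) => // j a' b'; by rewrite Ls // expr0n.
pose lam := Num.sqrt q.
have Llam i j : `|L i j| <= lam by rewrite -sqrtr_sqr ler_wsqrtr.
have lam0 : 0 <= lam by exact: sqrtr_ge0.
have lam2 : lam * lam = q by rewrite -expr2 sqr_sqrtr.
have [mcc mss msc] := mean_trig T0 pc ps.
have cc : continuous (fun t : R => cos t * cos t) by cont.
have css : continuous (fun t : R => sin t * sin t) by cont.
have csc : continuous (fun t : R => sin t * cos t) by cont.
have corb i : continuous (fun t => orbit t 0 i).
  by apply: cont_rot => // j; exact: cont_cst.
have mq : mean T (fun t => dot (orbit t *m L) (orbit t *m L)) = q / 2.
  have E t : dot (orbit t *m L) (orbit t *m L) =
     \sum_j (L i0 j ^+ 2 * (cos t * cos t) + L i1 j ^+ 2 * (sin t * sin t) + 2 * L i0 j * L i1 j * (sin t * cos t)).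
    by rewrite dotE; apply: eq_bigr => j _; rewrite !orbit_mulmx //; ring.
  have cj j : continuous (fun t : R => L i0 j ^+ 2 * (cos t * cos t) + L i1 j ^+ 2 * (sin t * sin t) + 2 * L i0 j * L i1 j * (sin t * cos t)).
    by cont.
  rewrite (funext E) mean_sum // /q mulr_suml; apply: eq_bigr => j _.
  rewrite mean_add; [|by cont|by cont].
  rewrite mean_add; [|by cont|by cont].
  by rewrite !mean_scale // mcc mss msc; field.
have bd : `|mean T (fun t => dot (orbit t *m L) ((X t - orbit t) *m L))| <= 2 * d%:R ^+ 2 * r * q.
  apply: mean_bound => //.
    apply: cont_dot; first by move=> i; exact: cont_mulmx.
    by apply: cont_mulmx => i; apply: cont_eq (fun t => rowBE (X t) (orbit t) i) _; have cXi := cX i; have coi := corb i; cont.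
  move=> t.
  have -> : 2 * d%:R ^+ 2 * r * q = d%:R * ((lam + lam) * (d%:R * (r * lam))) by rewrite -lam2; ring.
  apply: norm_dot_le.
    move=> j; rewrite orbit_mulmx // (mulrC (cos t)) (mulrC (sin t)).
    by apply: norm_add_le; [exact: norm_mul_cos_le|exact: norm_mul_sin_le].
  by apply: norm_mulmx_le => // i; rewrite rowBE.
have qE : q = - 2 * mean T (fun t => dot (orbit t *m L) ((X t - orbit t) *m L)).
  have E t : dot (orbit t *m L) (X t *m L) =
      dot (orbit t *m L) (orbit t *m L) + dot (orbit t *m L) ((X t - orbit t) *m L).
    by rewrite -dotDr -mulmxDl addrC subrK.
  move: hm; rewrite (funext E) mean_add ?mq; first lra.
    by apply: cont_dot => i; exact: cont_mulmx.
  apply: cont_dot; first by move=> i; exact: cont_mulmx.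
  by apply: cont_mulmx => i; apply: cont_eq (fun t => rowBE (X t) (orbit t) i) _; have cXi := cX i; have coi := corb i; cont.
have qz : q = 0.
  have : `|q| <= 2 * (2 * d%:R ^+ 2 * r * q).
    by rewrite {1}qE normrM normrN (ger0_norm (_ : 0 <= 2)) // ler_pM2l.
  rewrite ger0_norm // => h; apply/eqP; rewrite eq_le q0 andbT leNgt; apply/negP => qp.
  have : 4 * d%:R ^+ 2 * r * q < q * 1.
    rewrite mulrC ltr_pM2l //.
    have r0 : 0 <= d%:R ^+ 2 * r by rewrite mulr_ge0 ?sqr_ge0 //; apply: le_trans (hX 0 i0).
    lra.
  lra.
apply/matrixP => i j; rewrite [RHS]mxE; apply/eqP; rewrite -sqrf_eq0 eq_le sqr_ge0 andbT -qz.
exact: Lq.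
Qed.

End Normalized.

(** * Existence for the normalized problem *)

Section Existence.
Context {R : realType} (d : nat) (i0 i1 : 'I_d) (i01 : i0 != i1).
Context (k T : R) (T0 : 0 < T) (k01 : 0 < k < 1) (ck : cos (k * T) != 1).
Context (pc : Tperiodic T (@cos R)) (ps : Tperiodic T (@sin R)).
Context (W : R -> 'rV[R]_d -> R) (G : R -> 'rV[R]_d -> 'rV[R]_d) (rho Lip : R).
Context (pert : perturbation T W G rho Lip).
Implicit Types (x y e : 'rV[R]_d) (L A O N : 'M[R]_d) (M r s t eps : R).

Notation rot := (rot i0 i1).
Notation orbit := (orbit i0 i1).
Notation e1 := (@e1 R d i1).
Notation phiK := (phiK k).
Notation kinetic := (kinetic k).
Notation phiV := (@phiV R).
Notation potential := (@potential R).
Notation psi := (psi k).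
Notation lagr := (lagrangian k W).
Notation force := (total_force G).

Lemma kinetic_arg_gt0 (q : R) : 0 <= q -> 0 < k ^+ 2 + (1 - k ^+ 2) * q.
Proof.
move=> q0; have /andP[k0 k1] := k01; have k2 : 0 < k ^+ 2 by rewrite exprn_gt0.
have k3 : k ^+ 2 < 1 by rewrite expr_lt1 // ltW.
by rewrite ltr_pwDl // mulr_ge0 // subr_ge0 ltW.
Qed.

Section Curves.
Variables (X P : R -> 'rV[R]_d) (O : 'M[R]_d) (eps : R).
Hypothesis cX : forall i, continuous (fun t => X t 0 i).
Hypothesis cP : forall i, continuous (fun t => P t 0 i).
Hypothesis X0 : forall t, X t != 0.
Hypothesis hO : orthogonal O.

Lemma dot_gt0 x : x != 0 -> 0 < dot x x.
Proof.
move=> xn; rewrite lt_def dot_ge0 andbT; apply: contra_neq xn => x0.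
apply/rowP => i; rewrite mxE; apply/eqP; rewrite -sqrf_eq0 eq_le sqr_ge0 andbT -x0.
exact: sqr_coord_le.
Qed.

Lemma XO_neq0 t : X t *m O != 0.
Proof.
apply: contra_neq (X0 t) => h; have := congr1 (mulmx ^~ O^T) h.
by rewrite /= -mulmxA hO mulmx1 mul0mx.
Qed.

Lemma cont_phiK : continuous (fun t => phiK (dot (P t) (P t))).
Proof.
have cd : continuous (fun t => dot (P t) (P t)) by exact: cont_dot.
apply: cont_inv; first by move=> t; rewrite gt_eqF // sqrtr_gt0 kinetic_arg_gt0 // dot_ge0.
by apply: cont_sqrt; cont.
Qed.

Lemma cont_phiV : continuous (fun t => phiV (dot (X t) (X t))).
Proof.
have cd : continuous (fun t => dot (X t) (X t)) by exact: cont_dot.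
have cs := cont_sqrt cd.
apply: cont_inv; last by cont.
by move=> t; rewrite gt_eqF // mulr_gt0 ?sqrtr_gt0 ?dot_gt0.
Qed.

Lemma cont_psi i : continuous (fun t => psi (P t) 0 i).
Proof.
have c1 := cont_phiK; have c2 := @cP i.
by apply: cont_eq (fun t => psiE k (P t) i) _; cont.
Qed.

Lemma cont_lagr : continuous (fun t => lagr eps O t (X t) (P t)).
Proof.
have cP2 : continuous (fun t => dot (P t) (P t)) by exact: cont_dot.
have cX2 : continuous (fun t => dot (X t) (X t)) by exact: cont_dot.
have c1 := cont_phiK.
have c2 : continuous (fun t => kinetic (dot (P t) (P t))).
  by apply: cont_mul; [apply: cont_sqrt; cont|exact: cont_cst].
have c3 : continuous (fun t => potential (dot (X t) (X t))).
  apply: cont_opp; apply: cont_inv; last exact: cont_sqrt.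
  by move=> t; rewrite gt_eqF // sqrtr_gt0 dot_gt0.
have c4 : continuous (fun t => W t (X t *m O)).
  apply: (pert_contW pert); last exact: XO_neq0.
  exact: cont_mulmx.
by rewrite /lagrangian; cont.
Qed.

Lemma cont_force i : continuous (fun t => force eps O t (X t) 0 i).
Proof.
have c1 := cont_phiV; have c2 := @cX i.
have c3 : continuous (fun t => (G t (X t *m O) *m O^T) 0 i).
  apply: cont_mulmx; apply: (pert_contG pert); last exact: XO_neq0.
  exact: cont_mulmx.
have E t : force eps O t (X t) 0 i = - phiV (dot (X t) (X t)) * X t 0 i + eps * (G t (X t *m O) *m O^T) 0 i.
  by rewrite /total_force mxE; congr (_ + _); rewrite [LHS]mxE.
by apply: cont_eq E _; cont.
Qed.

End Curves.

Lemma normalized_existence rr : 0 < rr -> exists2 eps0, 0 < eps0 & forall eps, `|eps| <= eps0 ->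
  exists X P : R -> 'rV[R]_d, [/\
   forall i t, is_derive t 1 (fun s => X s 0 i) (phiK (dot (P t) (P t)) * P t 0 i),
   forall i t, is_derive t 1 (fun s => P s 0 i)
     (- phiV (dot (X t) (X t)) * X t 0 i + eps * G t (X t) 0 i),
   forall t, X (t + T) = X t &
   forall t, `|dot (X t) (X t) - 1| <= rr].
Proof.
move=> rr0.
have D0 : 0 <= d%:R :> R by exact: ler0n.
have [r1 [C1 [r10 r11 C10 hl]]] := lagr_expand i01 k01 pert.
(* [r * den = mm] yields [8 d^2 r < 1] for the torque, [3 d r <= mm] for nonvanishing and for the
   final bound [rr], and [r <= r1 / 2] for the expansion. *)
pose den : R := 8 * d%:R ^+ 2 + 3 * d%:R + 1.
have d2 : 0 <= d%:R ^+ 2 :> R by exact: sqr_ge0.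
have den0 : 0 < den by rewrite /den; lra.
pose mm := Num.min (Num.min (r1 / 2) (1 / 2)) rr.
have mm0 : 0 < mm by rewrite !lt_min !divr_gt0.
have mm1 : mm <= r1 / 2 by rewrite !ge_min lexx.
have mm2 : mm <= 1 / 2 by rewrite !ge_min lexx orbT.
have mm3 : mm <= rr by rewrite !ge_min lexx !orbT.
pose r := mm / den.
have r0 : 0 < r by rewrite divr_gt0.
have rden : r * den = mm by rewrite /r divfK // gt_eqF.
have p1 : 0 <= r * d%:R by rewrite mulr_ge0 // ltW.
have p2 : 0 <= r * d%:R ^+ 2 by rewrite mulr_ge0 // ltW.
rewrite /den in rden.
have rmm : r <= mm by lra.
have rsm : 8 * d%:R ^+ 2 * r < 1 by lra.
have r3 : d%:R * (r * 3) <= mm by lra.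
have [e0' [CL [e00 CL0 fam]]] := LS_family i01 T0 k01 ck pc ps pert r0.
exists (Num.min e0' 1); first by rewrite lt_min e00 ltr01.
move=> eps; rewrite le_min => /andP[epsle eps1].
have [S [hS lipS]] := fam eps epsle.
pose X O := (S O).1.1; pose P O := (S O).1.2.
have sX O : orthogonal O -> forall t i, `|X O t 0 i - orbit t 0 i| <= r.
  by move=> hO t i; have [_ _ _ _ h] := hS O hO; have [] := h t i.
have sP O : orthogonal O -> forall t i, `|P O t 0 i - rot t e1 0 i| <= r.
  by move=> hO t i; have [_ _ _ _ h] := hS O hO; have [] := h t i.
have dX O : orthogonal O -> forall t i, is_derive t 1 (fun s => X O s 0 i) (psi (P O t) 0 i).
  by move=> hO t i; have [_ [h _] _ _ _] := hS O hO; rewrite psiE; exact: h.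
have dP O : orthogonal O -> forall t i, is_derive t 1 (fun s => P O s 0 i)
    ((force eps O t (X O t) - orbit t *m (S O).2) 0 i).
  move=> hO t i; have [_ [_ h] _ _ _] := hS O hO; rewrite rowBE /total_force mxE.
  by apply: der_eq (h i t) _; congr (_ + _ - _); rewrite [RHS]mxE.
have cX O : orthogonal O -> forall i, continuous (fun t => X O t 0 i).
  by move=> hO i; exact: der_continuous (fun t => dX O hO t i).
have cP O : orthogonal O -> forall i, continuous (fun t => P O t 0 i).
  by move=> hO i; exact: der_continuous (fun t => dP O hO t i).
have nX O : orthogonal O -> forall t, X O t != 0.
  move=> hO t; apply: (near_unit_neq0 (orbit_unit i01 t) _ _ (sX O hO t)); first lra.
  by apply: le_lt_trans r3 _; lra.
have pX O : orthogonal O -> forall t, X O (t + T) = X O t.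
  by move=> hO; have [_ _ [? ?] _ _] := hS O hO.
have pP O : orthogonal O -> forall t, P O (t + T) = P O t.
  by move=> hO; have [_ _ [? ?] _ _] := hS O hO.
have ou t : dot (orbit t) (orbit t) = 1 := orbit_unit i01 t.
have X2 O : orthogonal O -> forall t i, `|X O t 0 i| <= 2.
  move=> hO t; have rl1 : r <= 1 by lra.
  exact: near_unit_bound (ou t) rl1 (sX O hO t).
have pu t : dot (rot t e1) (rot t e1) = 1 by rewrite dot_rot // e1_unit.
have P2 O : orthogonal O -> forall t i, `|P O t 0 i| <= 2.
  move=> hO t; have rl1 : r <= 1 by lra.
  exact: near_unit_bound (pu t) rl1 (sP O hO t).
(* The action, reduced to a function of the rotation alone. *)
pose Phi O := mean T (fun t => lagr eps O t (X O t) (P O t)).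
have oneI : orthogonal (1%:M : 'M[R]_d) by rewrite /orthogonal trmx1 mulmx1.
(* [dist]: the competitor for [N O], rotated back by [N], is close to the solution for [O]. *)
pose Cm := d%:R * CL * d%:R + 2 * d%:R.
have Cm0 : 0 <= Cm by rewrite /Cm addr_ge0 // !mulr_ge0.
have dist O N s : orthogonal O -> orthogonal N -> (forall i j, `|(N - 1%:M) i j| <= s) ->
   [/\ forall t i, `|X (N *m O) t 0 i - X O t 0 i| <= CL * (d%:R * s),
       forall t i, `|(X (N *m O) t *m N) 0 i - X O t 0 i| <= Cm * s
     & forall t i, `|(P (N *m O) t *m N) 0 i - P O t 0 i| <= Cm * s].
  move=> hO hN hs; have hNO := orthogonalM hN hO.
  have hd i j : `|(N *m O) i j - O i j| <= d%:R * s.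
    have -> : (N *m O) i j - O i j = ((N - 1%:M) *m O) i j by rewrite mulmxBl mul1mx !mxE.
    by rewrite -(mulr1 s); apply: norm_mulM_le => //; exact: orthogonal_le1.
  have hl1 := lipS _ _ _ hNO hO hd.
  have comp (x y : 'rV[R]_d) i : (forall i, `|x 0 i - y 0 i| <= CL * (d%:R * s)) -> (forall i, `|y 0 i| <= 2) ->
      `|(x *m N) 0 i - y 0 i| <= Cm * s.
    move=> hx hy; have -> : (x *m N) 0 i - y 0 i = ((x - y) *m N) 0 i + (y *m (N - 1%:M)) 0 i.
      by rewrite mulmxBl mulmxBr mulmx1 !rowBE; ring.
    have -> : Cm * s = d%:R * (CL * (d%:R * s) * 1) + d%:R * (2 * s) by rewrite /Cm; ring.
    apply: norm_add_le; apply: norm_mulmx_le => //.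
      by move=> j; rewrite rowBE.
    exact: orthogonal_le1.
  split=> t i.
  - by have [] := hl1 t i.
  - by apply: comp; [move=> j; have [] := hl1 t j|exact: X2].
  - by apply: comp; [move=> j; have [] := hl1 t j|exact: P2].
(* Solutions stay within [r1 / 2] of the orbit and the competitor is at most [Cm * s <= r1 / 2] away
   from them, so the expansion applies to it. *)
pose s0 := r1 / 2 / (Cm + 1).
have s00 : 0 < s0 by rewrite !divr_gt0 //; lra.
have s0E : s0 * (Cm + 1) = r1 / 2 by rewrite /s0 divfK // gt_eqF //; lra.
have CmM (s : R) : s <= s0 -> Cm * s <= r1 / 2.
  by move=> ss; apply: le_trans (_ : Cm * s0 <= _); [rewrite ler_wpM2l|lra].
have expand O N s : orthogonal O -> orthogonal N -> s <= s0 -> (forall i j, `|(N - 1%:M) i j| <= s) -> forall t,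
   let X' := X (N *m O) t *m N in let P' := P (N *m O) t *m N in
    [/\ `|lagr eps (N *m O) t (X (N *m O) t) (P (N *m O) t) - lagr eps O t (X O t) (P O t)
          - (dot (P O t) (psi P' - psi (P O t)) + dot (force eps O t (X O t)) (X' - X O t))| <= C1 * (Cm * s) ^+ 2
      & `|dot (P O t) (psi P' - psi (P O t)) + dot (force eps O t (X O t)) (X' - X O t)| <= C1 * (Cm * s)].
  move=> hO hN ss hs t X' P'; have [_ hx hp] := dist O N s hO hN hs.
  have Ms := CmM s ss.
  have rr1 : r <= r1 by lra.
  have hX' i : `|X' 0 i - orbit t 0 i| <= r1.
    have -> : X' 0 i - orbit t 0 i = (X' 0 i - X O t 0 i) + (X O t 0 i - orbit t 0 i) by ring.
    by apply: le_trans (norm_add_le (hx t i) (sX O hO t i)) _; lra.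
  have hP' i : `|P' 0 i - rot t e1 0 i| <= r1.
    have -> : P' 0 i - rot t e1 0 i = (P' 0 i - P O t 0 i) + (P O t 0 i - rot t e1 0 i) by ring.
    by apply: le_trans (norm_add_le (hp t i) (sP O hO t i)) _; lra.
  have [h1 h2 _ _] := hl eps t O (X O t) (P O t) X' P' (Cm * s) eps1 hO
    (fun i => le_trans (sX O hO t i) rr1) hX' (fun i => le_trans (sP O hO t i) rr1) hP' (hx t) (hp t).
  by rewrite lagr_mulmx.
have cL O : orthogonal O -> continuous (fun t => lagr eps O t (X O t) (P O t)).
  by move=> hO; apply: cont_lagr => //; [exact: cX|exact: cP|exact: nX].
have lipPhi O O' s : orthogonal O -> orthogonal O' -> s <= s0 / (d%:R + 1) -> (forall i j, `|O i j - O' i j| <= s) ->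
    `|Phi O - Phi O'| <= 2 * C1 * Cm * d%:R * s.
  move=> hO hO' ss hs; have s_ge0 : 0 <= s by apply: le_trans (hs i0 i0).
  (* [N] carries [O'] to [O] and is close to 1, which reduces the comparison to [expand]. *)
  pose N := O *m O'^T.
  have hO't : orthogonal O'^T by rewrite /orthogonal trmxK orthogonal_tr.
  have hN : orthogonal N by exact: orthogonalM.
  have NO : N *m O' = O by rewrite /N -mulmxA orthogonal_tr // mulmx1.
  have hN1 i j : `|(N - 1%:M) i j| <= d%:R * s.
    have -> : N - 1%:M = (O - O') *m O'^T by rewrite mulmxBl hO'.
    rewrite -(mulr1 s); apply: norm_mulM_le; first by move=> a b; rewrite !mxE.
    exact: orthogonal_le1.
  have ds0 : d%:R * s <= s0.
    have : s * (d%:R + 1) <= s0 by rewrite -ler_pdivlMr //; lra.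
    lra.
  have Ms := CmM _ ds0.
  rewrite /Phi -mean_sub //; [|exact: cL|exact: cL].
  apply: mean_bound => //; first by apply: cont_sub; exact: cL.
  move=> t; have [h1 h2] := expand O' N (d%:R * s) hO' hN ds0 hN1 t.
  rewrite NO in h1 h2.
  have := norm_add_le h1 h2; rewrite subrK => /le_trans; apply.
  have M1 : 0 <= Cm * (d%:R * s) by rewrite mulr_ge0 // mulr_ge0.
  have -> : 2 * C1 * Cm * d%:R * s = C1 * (Cm * (d%:R * s)) + C1 * (Cm * (d%:R * s)) by ring.
  rewrite lerD2r ler_wpM2l // expr2 ler_piMl //; lra.
have sd0 : 0 < s0 / (d%:R + 1) by rewrite divr_gt0 //; lra.
have CC0 : 0 <= 2 * C1 * Cm * d%:R by rewrite !mulr_ge0.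
have [Om hOm minOm] := orthogonal_min sd0 CC0 lipPhi.
move: Om hOm minOm => O hO minO.
have [tL _ _ cons _] := hS O hO.
(* Without torque, multiplication by [O] takes the rotation off the perturbation, and invariance of
   the other terms yields the true equation. *)
suff L0 : (S O).2 = 0.
  exists (fun t => X O t *m O), (fun t => P O t *m O); split.
  - move=> i t /=; rewrite -psiE psi_mulmx //.
    exact: (@der_mulmx _ _ (X O) (fun t => psi (P O t)) O t (dX O hO t) i).
  - move=> i t; apply: der_eq (@der_mulmx _ _ (P O) (fun t => force eps O t (X O t) - orbit t *m (S O).2) O t (dP O hO t) i) _ => /=.
    rewrite L0 mulmx0 subr0 dot_orthogonal // /total_force mulmxDl -!scalemxAl -mulmxA orthogonal_tr // mulmx1.
    by rewrite mxE; congr (_ + _); rewrite mxE.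
  - by move=> t; rewrite pX.
  move=> t; rewrite dot_orthogonal //.
  have rle1 : r <= 1 by lra.
  by apply: le_trans (near_unit_normsq (ou t) rle1 (sX O hO t)) _; lra.
set L := (S O).2 in tL *.
apply: (tangent_multiplier0 i01 T0 pc ps rsm tL (cX O hO) (sX O hO)).
have [La _] := tL.
have [lam Llam] : exists lam, forall i j, `|L i j| <= lam.
  exists `|L| => i j; rewrite [leRHS]/Num.Def.normr /= mx_normrE.
  exact: (le_bigmax _ (fun ij : 'I_d * 'I_d => `|L ij.1 ij.2|) (i, j)).
have lam0 : 0 <= lam by apply: le_trans (Llam i0 i0).
set m := mean T _.
pose sg : R := 2 * d%:R * lam.
have sg0 : 0 <= sg by rewrite /sg !mulr_ge0.
(* The summands bound the three pieces of [Err]: the Taylor remainder of the action, the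
   second-order part of the Cayley curve, and the change of the solution multiplied by [N - 1]. *)
pose CC := C1 * (Cm * sg) ^+ 2 + d%:R * ((lam + lam) * (d%:R * (2 * (2 * d%:R ^+ 2 * lam ^+ 2))))
  + d%:R * ((lam + lam) * (d%:R * (CL * (d%:R * sg) * sg))).
have s10 : 0 < s0 / (sg + 1) by rewrite divr_gt0 //; lra.
apply: (quadratic_ge0 (C := CC) s10) => s hs.
have [N [hN hN1 hN2]] := cayley La Llam s; rewrite -/sg in hN1.
have sgs : sg * `|s| <= s0.
  have : `|s| * (sg + 1) <= s0 by rewrite -ler_pdivlMr //; lra.
  have := normr_ge0 s; lra.
have hNO := orthogonalM hN hO.
have [hXX hXh hPh] := dist O N _ hO hN hN1.
pose c t := orbit t *m L.
pose Xh t := X (N *m O) t *m N; pose Ph t := P (N *m O) t *m N.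
(* The derivative of [<P, Xh - X>]. Its mean is 0 by periodicity, which is the integration by
   parts. *)
pose dz t := dot (force eps O t (X O t) - c t) (Xh t - X O t) + dot (P O t) (psi (Ph t) - psi (P O t)).
have dXh t i : is_derive t 1 (fun s => (Xh s - X O s) 0 i) ((psi (Ph t) - psi (P O t)) 0 i).
  have h1 := @der_mulmx _ _ (X (N *m O)) (fun t => psi (P (N *m O) t)) N t (dX _ hNO t) i; have h2 := dX O hO t i.
  rewrite (_ : (fun s => _) = fun s => Xh s 0 i - X O s 0 i); last by apply/funext => u; rewrite rowBE.
  by rewrite rowBE {1}/Ph psi_mulmx //; apply: der_sub.
have hdz t : is_derive t 1 (fun s => dot (P O s) (Xh s - X O s)) (dz t).
  exact: (@der_dot _ _ (P O) (fun s => Xh s - X O s) (fun t => force eps O t (X O t) - c t)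
    (fun t => psi (Ph t) - psi (P O t)) t (dP O hO t) (dXh t)).
have cXh i : continuous (fun t => Xh t 0 i) by apply: cont_mulmx; exact: cX.
have cPh i : continuous (fun t => Ph t 0 i) by apply: cont_mulmx; exact: cP.
have cc i : continuous (fun t => c t 0 i).
  by apply: cont_mulmx; apply: cont_rot => // j; exact: cont_cst.
have cXO := cX O hO; have cPO := cP O hO; have cXN := cX _ hNO.
have cdiff (x y : R -> 'rV[R]_d) i : continuous (fun t => x t 0 i) -> continuous (fun t => y t 0 i) ->
    continuous (fun t => (x t - y t) 0 i).
  by move=> hx hy; apply: cont_eq (fun t => rowBE (x t) (y t) i) _; cont.
have cdz : continuous dz.
  apply: cont_add; apply: cont_dot => // i; apply: cdiff => //.
  - by apply: cont_force => //; exact: nX.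
  - exact: cont_psi.
  - exact: cont_psi.
(* To first order the action difference minus [dz] is [<c, Xh - X>]. The constraints annihilate the
   means of [<c, X O>] and of [<c, X (N O)>], the latter without the factor [N] of [Xh]; this
   factor, [1 + 2 s L] to first order, produces [2 s <c, X L>]. *)
pose Err t := lagr eps (N *m O) t (X (N *m O) t) (P (N *m O) t) - lagr eps O t (X O t) (P O t)
  - dz t - dot (X (N *m O) t) (c t) + dot (X O t) (c t) - 2 * s * dot (c t) (X O t *m L).
have cNO := cL _ hNO; have cO := cL _ hO.
have ccX : continuous (fun t => dot (X (N *m O) t) (c t)) by exact: cont_dot.
have ccO : continuous (fun t => dot (X O t) (c t)) by exact: cont_dot.
have ccL : continuous (fun t => dot (c t) (X O t *m L)) by apply: cont_dot => // i; exact: cont_mulmx.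
have cErr : continuous Err by rewrite /Err; cont.
have consN : mean T (fun t => dot (X (N *m O) t) (c t)) = 0.
  by have [_ _ _ h _] := hS _ hNO; exact: h.
have consO : mean T (fun t => dot (X O t) (c t)) = 0 by exact: cons.
have mz : mean T dz = 0.
  apply: (mean_der hdz cdz) => t; rewrite /Xh !pX // pP //.
have mErr : mean T Err = Phi (N *m O) - Phi O - 2 * s * m.
  rewrite /Err mean_sub; [|cont|cont].
  rewrite mean_add; [|cont|cont].
  rewrite mean_sub; [|cont|cont].
  rewrite mean_sub; [|cont|cont].
  rewrite mean_sub // mz consN consO (mean_scale _ _ ccL) -/(Phi O) -/(Phi (N *m O)) -/m.
  by rewrite !subr0 addr0.
have cb t j : `|c t 0 j| <= lam + lam.
  rewrite orbit_mulmx // (mulrC (cos t)) (mulrC (sin t)).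
  by apply: norm_add_le; [exact: norm_mul_cos_le|exact: norm_mul_sin_le].
have bErr t : `|Err t| <= CC * s ^+ 2.
  have [h1 _] := expand O N _ hO hN sgs hN1 t.
  have -> : Err t = (lagr eps (N *m O) t (X (N *m O) t) (P (N *m O) t) - lagr eps O t (X O t) (P O t)
          - (dot (P O t) (psi (Ph t) - psi (P O t)) + dot (force eps O t (X O t)) (Xh t - X O t)))
     + dot (c t) (X O t *m (N - 1%:M - (2 * s) *: L))
     + dot (c t) ((X (N *m O) t - X O t) *m (N - 1%:M)).
    have E1 : dot (c t) (X O t *m (N - 1%:M - (2 * s) *: L)) =
       dot (c t) (X O t *m N) - dot (c t) (X O t) - 2 * s * dot (c t) (X O t *m L).
      by rewrite !mulmxBr mulmx1 -scalemxAr !dotBr dotZr.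
    have E2 : dot (c t) ((X (N *m O) t - X O t) *m (N - 1%:M)) =
       dot (c t) (Xh t) - dot (c t) (X O t *m N) - (dot (c t) (X (N *m O) t) - dot (c t) (X O t)).
      by rewrite mulmxBr mulmx1 mulmxBl !dotBr.
    have E3 : dot (force eps O t (X O t) - c t) (Xh t - X O t) =
       dot (force eps O t (X O t)) (Xh t - X O t) - (dot (c t) (Xh t) - dot (c t) (X O t)).
      by rewrite dotBl -dotBr.
    by rewrite E1 E2 /Err /dz E3 !(dotC _ (c t)); ring.
  have h2 : `|dot (c t) (X O t *m (N - 1%:M - (2 * s) *: L))|
      <= d%:R * ((lam + lam) * (d%:R * (2 * (2 * d%:R ^+ 2 * lam ^+ 2 * s ^+ 2)))).
    by apply: norm_dot_le => //; apply: norm_mulmx_le => //; exact: X2.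
  have h3 : `|dot (c t) ((X (N *m O) t - X O t) *m (N - 1%:M))|
      <= d%:R * ((lam + lam) * (d%:R * (CL * (d%:R * (sg * `|s|)) * (sg * `|s|)))).
    by apply: norm_dot_le => //; apply: norm_mulmx_le => // i; rewrite rowBE.
  apply: le_trans (norm_add_le (norm_add_le h1 h2) h3) _.
  by rewrite /CC -(real_normK (num_real s)) le_eqVlt; apply/orP; left; apply/eqP; ring.
have hb := mean_bound T0 cErr bErr.
have hmin := minO _ hNO; rewrite mErr in hb.
have := le_trans (ler_norm _) hb; lra.
Qed.

End Existence.

(** * Calculus in space away from the origin *)

Section SpaceCalculus.
Context {R : realType} (d : nat).
Implicit Types (f : 'rV[R]_d -> R) (x y z v : 'rV[R]_d).

Lemma derive_partial f z v : differentiable f z ->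
  'D_v f z = \sum_i v 0 i * partial i f z.
Proof.
move=> df; rewrite deriveE // {1}(row_sum_delta v) linear_sum; apply: eq_bigr => i _.
by rewrite linearZ /partial deriveE.
Qed.

Lemma line_derive f y v (s : R) : differentiable f (y + s *: v) ->
  is_derive s 1 (fun s => f (y + s *: v)) (\sum_i v 0 i * partial i f (y + s *: v)).
Proof.
move=> df; rewrite -(derive_partial v df).
have E : (fun h : R => h^-1 *: (f (y + (h *: (1 : R) + s) *: v) - f (y + s *: v))) =
   (fun h : R => h^-1 *: (f (h *: v + (y + s *: v)) - f (y + s *: v))).
  apply/funext => h; congr (_ *: (f _ - _)).
  by rewrite [h *: (1 : R)]mulr1 scalerDl addrCA.
have dv : derivable f (y + s *: v) v by exact: diff_derivable.
by split; [move: dv; rewrite /derivable -E|rewrite /derive -E].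
Qed.

Lemma cont_row (X : R -> 'rV[R]_d) : (forall i, continuous (fun t => X t 0 i)) -> continuous X.
Proof.
move=> cX t; apply/cvgrPdist_le => e e0; near=> s.
rewrite [leLHS]/Num.Def.normr /= mx_normrE; apply: bigmax_le; first exact: ltW.
move=> -[i j] _ /=; rewrite ord1 rowBE; move: j; near: s; apply: filter_forall => j.
by move/cvgrPdist_le : (cX j t); apply.
Unshelve. all: by end_near. Qed.

Lemma cont_off0_comp (F : R -> 'rV[R]_d -> R) (X : R -> 'rV[R]_d) (phi : R -> R) (r : R) :
  r != 0 -> continuous_off0 F -> continuous phi -> (forall i, continuous (fun t => X t 0 i)) ->
  (forall t, X t != 0) -> continuous (fun t => F (phi t) (r *: X t)).
Proof.
move=> r0 cF cphi cX X0 t.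
have n0 : r *: X t != 0 by rewrite scaler_eq0 negb_or r0 X0.
apply: (@continuous_comp _ _ _ (fun t => (phi t, r *: X t)) (fun q : R * 'rV[R]_d => F q.1 q.2)).
  apply: (@cvg_pair _ _ _ _ (nbhs (phi t)) (nbhs (r *: X t))); first exact: cphi.
  apply: (@cvgZ _ _ _ _ _ (fun=> r) X r (X t)); first exact: cvg_cst.
  exact: cont_row.
exact: (cF (phi t, r *: X t) n0).
Qed.

Lemma partial_congr (f g : 'rV[R]_d -> R) i x : x != 0 ->
  (forall y, y != 0 -> f y = g y) -> partial i f x = partial i g x.
Proof.
move=> x0 fg; apply: near_eq_derive; near=> y; apply: fg; near: y.
have : \forall y \near x, `|x - y| < `|x|.
  by apply/nbhs_normP; exists `|x| => //=; rewrite normr_gt0.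
apply: filterS => y; apply: contraTneq => ->.
by rewrite subr0 ltxx.
Unshelve. all: by end_near. Qed.

(** Periodicity restricts [t] to [[0, T]], and the product of this interval with a closed annulus,
    which misses 0, is compact. *)
Lemma annulus_bound (F : R -> 'rV[R]_d -> R) (T a b : R) : 0 < T -> 0 < a ->
  continuous_off0 F -> (forall x, x != 0 -> forall t, F (t + T) x = F t x) ->
  exists2 B, 0 <= B & forall t x, a <= `|x| -> `|x| <= b -> `|F t x| <= B.
Proof.
move=> T0 a0 cF pF.
pose K : set (R * 'rV[R]_d) := `[0, T]%classic `*` [set x | a <= `|x| /\ `|x| <= b].
have xn0 (x : 'rV[R]_d) : a <= `|x| -> x != 0.
  by move=> ax; rewrite -normr_gt0; exact: lt_le_trans ax.
have Kc : compact K.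
  apply: compact_setX; first exact: segment_compact.
  apply: bounded_closed_compact.
    exists b; split; first exact: num_real.
    by move=> M bM x [_ /le_trans]; apply; exact: ltW.
  have -> : [set x : 'rV[R]_d | a <= `|x| /\ `|x| <= b] =
     (Num.norm @^-1` [set y | a <= y]) `&` (Num.norm @^-1` [set y | y <= b]) by [].
  by apply: closedI; (apply: preimage_closed; [move=> x _; exact: norm_continuous|]);
     [exact: closed_ge|exact: closed_le].
have cK : {within K, continuous (fun q : R * 'rV[R]_d => F q.1 q.2)}.
  apply: continuous_in_subspaceT => q; rewrite inE => -[_ [aq _]].
  by apply: cF; exact: xn0.
have [M [_ hM]] := compact_bounded (continuous_compact cK Kc).
exists (`|M| + 1) => [|t x ax xb]; first by rewrite addr_ge0.
have pz (n : nat) u : F (u + n%:R * T) x = F u x.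
  elim: n u => [|n ih] u; first by rewrite mul0r addr0.
  by rewrite -natr1 mulrDl mul1r addrA pF ?ih //; exact: xn0.
have pzz (z : int) u : F (u + z%:~R * T) x = F u x.
  case: z => n; first exact: pz.
  by rewrite NegzE -(pz n.+1) mulrNz -addrA mulNr addNr addr0.
rewrite -(pzz (- Num.floor (t / T)) t).
apply: hM; first by rewrite ltr_pwDr // ler_norm.
exists (t + (- Num.floor (t / T))%:~R * T, x) => //=; split=> //=.
have h1 := Num.Theory.floor_le (t / T); have h2 := floorD1_gt (t / T).
rewrite intrD in h2.
rewrite ler_pdivlMr // in h1; rewrite ltr_pdivrMr // mulrDl mul1r in h2.
rewrite in_itv /= mulrNz mulNr; apply/andP; split; lra.
Qed.

End SpaceCalculus.

(** * Rescaling the perturbation *)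

Section Scaling.
Context {R : realType} (d : nat).
Variables (U : R -> 'rV[R]_d -> R) (T r w : R).
Hypotheses (T0 : 0 < T) (r0 : 0 < r) (w0 : 0 < w).
Hypotheses (Ucont : continuous_off0 U) (UC2 : C2_in_space U).
Hypothesis Uper : forall x : 'rV[R]_d, x != 0 -> periodic_in_time T (fun t => U t x).
Implicit Types (x y z e : 'rV[R]_d).

Lemma partial_per i x : x != 0 -> forall t, partial i (U (t + T)) x = partial i (U t) x.
Proof. by move=> x0 t; apply: partial_congr => // y y0; exact: Uper. Qed.

Lemma partial2_per i j x : x != 0 -> forall t,
  partial j (partial i (U (t + T))) x = partial j (partial i (U t)) x.
Proof. by move=> x0 t; apply: partial_congr => // y y0; exact: partial_per. Qed.

(** With [a = 1 / (2 (d + 1))], a unit vector has a coordinate of size at least [2 a], as otherwise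
    its squared length is at most [4 d a^2 < 1]; a displacement by [a] leaves [a]. *)
Lemma unit_norm_bounds e x : dot e e = 1 ->
  (forall i, `|x 0 i - e 0 i| <= (2 * (d%:R + 1))^-1) ->
  (2 * (d%:R + 1))^-1 <= `|x| /\ `|x| <= 2.
Proof.
move=> ee hx; have D0 : 0 <= d%:R :> R by exact: ler0n.
set a := (2 * (d%:R + 1))^-1.
have a0 : 0 < a by rewrite invr_gt0; lra.
have aE : a * (2 * (d%:R + 1)) = 1 by rewrite /a mulVf //; lra.
have a1 : a <= 1 by have := mulr_ge0 (ltW a0) D0; lra.
split.
  have [i hi] : exists i, 2 * a <= `|e 0 i|.
    apply/existsP; rewrite -[X in is_true X]negbK negb_exists; apply/negP => /forallP h.
    have hi i : `|e 0 i| <= 2 * a by have := h i; rewrite -ltNge => /ltW.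
    have := norm_dot_le hi hi; rewrite ee normr1 leNgt => /negP; apply.
    have -> : d%:R * (2 * a * (2 * a)) = 2 * a * (2 * (a * d%:R)) by ring.
    have q1 : 2 * (a * d%:R) < 1 by lra.
    have q2 : 0 <= a * d%:R by rewrite mulr_ge0 // ltW.
    by nra.
  apply: le_trans (coord_norm_le x i).
  have := norm_sub_le (lexx `|x 0 i|) (hx i); rewrite opprB addrCA subrr addr0 -/a.
  by move=> h; move: (le_trans hi h); lra.
rewrite [leLHS]/Num.Def.normr /= mx_normrE; apply: bigmax_le => // -[j i] _ /=.
by rewrite ord1; apply: near_unit_bound ee a1 hx i.
Qed.

(** The factor [r] in the force makes it the gradient of the rescaled potential. The estimates are
    mean value bounds along segments, the first and second derivatives of [U] being bounded on an
    annulus. *)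
Lemma scaled_perturbation : exists rho Lip, perturbation (w * T)
  (fun t x => U (t / w) (r *: x)) (fun t x => r *: gradient (U (t / w)) (r *: x)) rho Lip.
Proof.
have [dU cU1 dU1 cU2] := UC2.
have D0 : 0 <= d%:R :> R by exact: ler0n.
have rn : r != 0 by rewrite gt_eqF.
have wn : w != 0 by rewrite gt_eqF.
pose a : R := (2 * (d%:R + 1))^-1.
have a0 : 0 < a by rewrite invr_gt0; lra.
have ra0 : 0 < r * a by exact: mulr_gt0.
have /choice [B1 hB1] : forall i, exists B, 0 <= B /\ forall t x, r * a <= `|x| -> `|x| <= r * 2 -> `|partial i (U t) x| <= B.
  move=> i; have [B B0 hB] := @annulus_bound _ _ (fun t => partial i (U t)) T _ (r * 2) T0 ra0 (cU1 i) (@partial_per i).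
  by exists B.
have /choice [B2 hB2] : forall ij : 'I_d * 'I_d, exists B, 0 <= B /\ forall t x, r * a <= `|x| -> `|x| <= r * 2 ->
    `|partial ij.2 (partial ij.1 (U t)) x| <= B.
  move=> [i j]; have [B B0 hB] := @annulus_bound _ _ (fun t => partial j (partial i (U t))) T _ (r * 2) T0 ra0 (cU2 i j) (@partial2_per i j).
  by exists B.
pose B := \sum_i B1 i + \sum_ij B2 ij.
have sB2 : 0 <= \sum_ij B2 ij by apply: sumr_ge0 => ij _; case: (hB2 ij).
have sB1 : 0 <= \sum_ij B1 ij by apply: sumr_ge0 => ij _; case: (hB1 ij).
have B0 : 0 <= B by exact: addr_ge0.
have bd1 i t x : r * a <= `|x| -> `|x| <= r * 2 -> `|partial i (U t) x| <= B.
  move=> h1 h2; apply: le_trans ((hB1 i).2 t x h1 h2) _.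
  rewrite /B (bigD1 i) //= -addrA lerDl addr_ge0 //; apply: sumr_ge0 => j _; by case: (hB1 j).
have bd2 i j t x : r * a <= `|x| -> `|x| <= r * 2 -> `|partial j (partial i (U t)) x| <= B.
  move=> h1 h2; apply: le_trans ((hB2 (i, j)).2 t x h1 h2) _.
  rewrite /B (bigD1 (i, j)) //= addrCA lerDl addr_ge0 //; apply: sumr_ge0 => l _; by case: (hB2 l).
have ann e x : dot e e = 1 -> (forall i, `|x 0 i - e 0 i| <= a) -> r * a <= `|r *: x| /\ `|r *: x| <= r * 2.
  by move=> ee hx; have [h1 h2] := unit_norm_bounds ee hx; rewrite normrZ (gtr0_norm r0); split; rewrite ler_pM2l.
have ann0 x : r * a <= `|x| -> x != 0 by move=> h; rewrite -normr_gt0; exact: lt_le_trans h.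
have sE t x i : (r *: gradient (U (t / w)) (r *: x)) 0 i = r * partial i (U (t / w)) (r *: x) by rewrite !mxE.
have cw : continuous (fun t : R => t / w) by cont.
have tw t : (t + w * T) / w = t / w + T by rewrite mulrDl mulrAC mulfV // mul1r.
have rx0 x : x != 0 -> r *: x != 0 by move=> x0; rewrite scaler_eq0 negb_or rn.
pose L2 := r * (d%:R * (r * B)).
have L20 : 0 <= L2 by rewrite /L2 !mulr_ge0 // ltW.
(* The box of size [a] around [e] is convex and avoids 0, so the derivatives stay under control
   along the segment. *)
have seg e x y (s : R) : (forall i, `|x 0 i - e 0 i| <= a) -> (forall i, `|y 0 i - e 0 i| <= a) ->
    0 <= s <= 1 -> forall i, `|(y + s *: (x - y)) 0 i - e 0 i| <= a.
  move=> hx hy /andP[s0 s1] i.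
  have -> : (y + s *: (x - y)) 0 i - e 0 i = (1 - s) * (y 0 i - e 0 i) + s * (x 0 i - e 0 i).
    by rewrite !mxE; ring.
  have -> : a = (1 - s) * a + s * a by ring.
  have n1 : `|1 - s| <= 1 - s by rewrite ger0_norm ?subr_ge0.
  have n2 : `|s| <= s by rewrite ger0_norm.
  by apply: norm_add_le; apply: norm_mul_le.
have yxK x y : y + (x - y) = x by rewrite addrC subrK.
have lin x y (s : R) : r *: (y + s *: (x - y)) = r *: y + s *: (r *: (x - y)).
  by rewrite scalerDr scalerA (mulrC r) -scalerA.
have G2 t e x y M i : dot e e = 1 ->
    (forall i, `|x 0 i - e 0 i| <= a) -> (forall i, `|y 0 i - e 0 i| <= a) ->
    (forall i, `|x 0 i - y 0 i| <= M) ->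
    `|r * partial i (U t) (r *: x) - r * partial i (U t) (r *: y)| <= L2 * M.
  move=> ee hx hy hM.
  pose h s := r * partial i (U t) (r *: y + s *: (r *: (x - y))).
  have -> : r * partial i (U t) (r *: x) - r * partial i (U t) (r *: y) = h 1 - h 0.
    by rewrite /h scale1r scale0r addr0 -scalerDr yxK.
  rewrite -[L2 * M]mulr1 -{2}(subr0 1).
  pose h' s := r * \sum_j (r *: (x - y)) 0 j * partial j (partial i (U t)) (r *: y + s *: (r *: (x - y))).
  apply: (@der_lip_seg _ h h') => // s s01.
    have [h1 _] := ann e _ ee (seg e x y s hx hy s01); rewrite lin in h1.
    have dl := line_derive (dU1 i t _ (ann0 _ h1)).
    by rewrite /h /h'; derE; ring.
  have [h1 h2] := ann e _ ee (seg e x y s hx hy s01); rewrite lin in h1 h2.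
  have -> : L2 * M = r * (d%:R * (r * M * B)) by rewrite /L2; ring.
  rewrite /h' normrM (gtr0_norm r0) ler_pM2l //; apply: norm_sum_le => j.
  apply: norm_mul_le; last exact: bd2.
  by rewrite mxE rowBE normrM (gtr0_norm r0) ler_pM2l.
exists a, (r * B + L2 + d%:R * L2); split=> //.
- by rewrite !addr_ge0 // mulr_ge0 // ltW.
- by move=> X cX X0; exact: (cont_off0_comp rn Ucont cw).
- move=> X cX X0 i; apply: cont_eq (fun t => sE t (X t) i) _.
  have c1 := cont_off0_comp rn (cU1 i) cw cX X0.
  by apply: cont_mul; [exact: cont_cst|exact: c1].
- by move=> t x x0; rewrite tw; exact: Uper (rx0 x x0) _.
- move=> t x x0; congr (_ *: _); apply/rowP => i.
  by rewrite !mxE tw partial_per // rx0.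
move=> t e x y M ee hx hy hM.
have [ax1 ax2] := ann e x ee hx.
have rB0 : 0 <= r * B by rewrite mulr_ge0 // ltW.
have dL0 : 0 <= d%:R * L2 by rewrite mulr_ge0.
split.
- move=> i; rewrite sE normrM (gtr0_norm r0); apply: le_trans (_ : r * B <= _).
    by rewrite ler_pM2l // bd1.
  lra.
- move=> i; rewrite !sE; have M0 : 0 <= M by apply: le_trans (hM i).
  by apply: le_trans (G2 _ e x y M i ee hx hy hM) _; rewrite ler_wpM2r //; lra.
have M2 : 0 <= M ^+ 2 by exact: sqr_ge0.
apply: le_trans (_ : d%:R * L2 * M ^+ 2 <= _); last by rewrite ler_wpM2r //; lra.
pose g := r *: gradient (U (t / w)) (r *: y).
pose h s := U (t / w) (r *: y + s *: (r *: (x - y))) - s * dot g (x - y).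
have -> : U (t / w) (r *: x) - U (t / w) (r *: y) - dot (r *: gradient (U (t / w)) (r *: y)) (x - y) = h 1 - h 0.
  by rewrite /h scale1r scale0r addr0 -scalerDr yxK -/g; ring.
rewrite -[d%:R * L2 * M ^+ 2]mulr1 -{3}(subr0 1).
pose h' s := \sum_j (r *: (x - y)) 0 j * partial j (U (t / w)) (r *: y + s *: (r *: (x - y))) - dot g (x - y).
apply: (@der_lip_seg _ h h') => // s s01.
  have [h1 _] := ann e _ ee (seg e x y s hx hy s01); rewrite lin in h1.
  have dl := line_derive (dU (t / w) _ (ann0 _ h1)).
  by rewrite /h /h'; derE; ring.
have sg := seg e x y s hx hy s01.
have -> : h' s = \sum_j (x - y) 0 j * (r * partial j (U (t / w)) (r *: (y + s *: (x - y))) - r * partial j (U (t / w)) (r *: y)).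
  rewrite /h' dotC dotE -sumrB; apply: eq_bigr => j _.
  by rewrite lin /g sE mxE; ring.
have -> : d%:R * L2 * M ^+ 2 = d%:R * (M * (L2 * M)) by ring.
apply: norm_sum_le => j; apply: norm_mul_le; first by rewrite rowBE.
apply: (G2 _ e _ _ M j ee sg hy) => i.
have -> : (y + s *: (x - y)) 0 i - y 0 i = s * (x 0 i - y 0 i) by rewrite !mxE; ring.
have /andP[s0 s1] := s01.
by rewrite -(mul1r M); apply: norm_mul_le => //; rewrite ger0_norm.
Qed.

End Scaling.

(** * Circular orbits and nonresonance *)

Section CircularOrbits.
Context {R : realType}.
Implicit Types (m c al T w u y : R).

(** At speed [c u] and frequency [w] the balance of centripetal and attractive force has this form,
    with [a = m c^3] and [b] the product of [alpha] and [w]. The two sides change order between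
    [u = 0] and [u = 1]. *)
Lemma circular_velocity (a b : R) : 0 < a -> 0 < b ->
  exists u, [/\ 0 < u, u < 1 & a * u ^+ 3 = b * Num.sqrt (1 - u ^+ 2)].
Proof.
move=> a0 b0; pose f (u : R) : R := a * u ^+ 3 - b * Num.sqrt (1 - u ^+ 2).
have c3 : continuous (fun u : R => u ^+ 3) by exact: exprn_continuous.
have c2 : continuous (fun u : R => u ^+ 2) by exact: exprn_continuous.
have cs : continuous (fun u : R => Num.sqrt (1 - u ^+ 2)).
  move=> u; apply: (@continuous_comp _ _ _ (fun u : R => 1 - u ^+ 2)); last exact: sqrt_continuous.
  by apply: (_ : continuous (fun u : R => 1 - u ^+ 2)); cont.
have cf : continuous f by rewrite /f; cont.
have f0 : f 0 = - b by rewrite /f !expr0n /= subr0 sqrtr1; ring.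
have f1 : f 1 = a by rewrite /f !expr1n subrr sqrtr0; ring.
have [|u uI fu] := IVT ler01 (continuous_subspaceT cf) (v := 0).
  by rewrite f0 f1 ge_min le_max oppr_le0 (ltW a0) (ltW b0) orbT.
move: uI; rewrite in_itv /= => /andP[u0 u1].
exists u; split.
- rewrite lt_neqAle u0 andbT eq_sym; apply: contra_eq_neq fu => ->; rewrite f0.
  by rewrite oppr_eq0 gt_eqF.
- by rewrite lt_neqAle u1 andbT; apply: contra_eq_neq fu => ->; rewrite f1 gt_eqF.
- by apply/eqP; rewrite -subr_eq0; apply/eqP.
Qed.

(* [c u / w] is the radius of the circular orbit of frequency [w] and speed [c u]. *)
Lemma circular_radius_lt m c al w w' u u' : 0 < m -> 0 < c -> 0 < al -> 0 < w -> w < w' ->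
  0 < u -> u < 1 -> 0 < u' -> u' < 1 ->
  m * (c * u) ^+ 3 = al * w * Num.sqrt (1 - u ^+ 2) ->
  m * (c * u') ^+ 3 = al * w' * Num.sqrt (1 - u' ^+ 2) -> c * u' / w' < c * u / w.
Proof.
move=> m0 c0 al0 w0 ww u0 u1 u0' u1' e e'; have w0' := lt_trans w0 ww.
rewrite ltNge; apply/negP => rr.
pose r := c * u / w; pose r' := c * u' / w'.
have rE : c * u = r * w by rewrite /r divfK // gt_eqF.
have rE' : c * u' = r' * w' by rewrite /r' divfK // gt_eqF.
have r0 : 0 < r by rewrite divr_gt0 // mulr_gt0.
have r0' : 0 < r' by rewrite divr_gt0 // mulr_gt0.
have rr' : r <= r' by [].
have uu : u < u'.
  rewrite -(ltr_pM2l c0) rE rE'; apply: lt_le_trans (_ : r * w' <= _).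
    by rewrite ltr_pM2l.
  by rewrite ler_pM2r.
have kk : Num.sqrt (1 - u' ^+ 2) <= Num.sqrt (1 - u ^+ 2).
  by rewrite ler_wsqrtr // lerD2l lerN2 ler_pXn2r ?nnegrE ?ltW.
have h : m * r ^+ 3 * w ^+ 2 = al * Num.sqrt (1 - u ^+ 2).
  by apply: (mulIf (lt0r_neq0 w0)); move: e; rewrite rE => h; lra.
have h' : m * r' ^+ 3 * w' ^+ 2 = al * Num.sqrt (1 - u' ^+ 2).
  by apply: (mulIf (lt0r_neq0 w0')); move: e'; rewrite rE' => h'; lra.
have l1 : m * r' ^+ 3 * w' ^+ 2 <= m * r ^+ 3 * w ^+ 2 by rewrite h h' ler_pM2l.
have l2 : m * r ^+ 3 * w ^+ 2 < m * r ^+ 3 * w' ^+ 2.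
  have mr : 0 < m * r ^+ 3 by rewrite mulr_gt0 ?exprn_gt0.
  by rewrite (ltr_pM2l mr) ltr_pXn2r ?nnegrE ?ltW.
have l3 : m * r ^+ 3 * w' ^+ 2 <= m * r' ^+ 3 * w' ^+ 2.
  have w2 : 0 < w' ^+ 2 by rewrite exprn_gt0.
  by rewrite (ler_pM2r w2) (ler_pM2l m0) ler_pXn2r ?nnegrE // ltW.
by have := lt_le_trans l2 (le_trans l3 l1); rewrite ltxx.
Qed.

(** [1 - cos (2 pi y)] is [2 sin^2 (pi (y - n))], and this sine is positive strictly between
    integers. *)
Lemma cos_resonance (n : nat) y : n%:R < y -> y < n%:R + 1 -> cos (y * (pi *+ 2)) != 1.
Proof.
move=> ny yn; have -> : y * (pi *+ 2) = ((y - n%:R) * pi) *+ 2 + (pi *+ 2) *+ n.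
  by rewrite -[(pi *+ 2) *+ n]mulr_natr !mulr2n; ring.
rewrite (periodicn (@cosD2pi R)) cos_mulr2n.
have pi0 := pi_gt0 R.
have s0 : 0 < sin ((y - n%:R) * pi).
  apply: sin_gt0_pi; apply/andP; split; first by rewrite mulr_gt0 // subr_gt0.
  by rewrite gtr_pMl //; lra.
have := cos2Dsin2 ((y - n%:R) * pi); have : 0 < sin ((y - n%:R) * pi) ^+ 2 by rewrite exprn_gt0.
by move=> h1 h2; rewrite lt_eqF // mulr2n; lra.
Qed.

(** [k * sqrt (1 - u k ^ 2) = l * u k ^ 3] stays strictly below [l] and tends to it. With [n] the
    least integer not below [l], it ends up strictly between [n - 1] and [n], even if [l] is an
    integer. *)
Lemma nonresonant_tail (l : R) (u : nat -> R) : 0 < l ->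
  (forall k, (0 < k)%N -> [/\ 0 < u k, u k < 1 & l * u k ^+ 3 = k%:R * Num.sqrt (1 - u k ^+ 2)]) ->
  exists K, forall k, (K <= k)%N -> (0 < k)%N -> cos (Num.sqrt (1 - u k ^+ 2) * (k%:R * (pi *+ 2))) != 1.
Proof.
move=> l0 hu.
have ex : exists n : nat, l <= n%:R.
  by exists (Num.bound l); apply: ltW; apply: le_lt_trans (ler_norm l) _; rewrite -{2}(ger0_norm (ltW l0)) archi_boundP // normr_ge0.
have [n ln nmin] := ex_minnP ex.
have n0 : (0 < n)%N by rewrite lt0n; apply: contraTneq ln => ->; rewrite -ltNge.
have n1l : n.-1%:R < l.
  by rewrite ltNge; apply/negP => /nmin; rewrite leqNgt ltn_predL n0.
(* From [kap^2 <= l^2 / k] and [u^3 >= u^4 = (1 - kap^2)^2 >= 1 - 2 kap^2], the value exceeds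
   [n - 1] once [k (l - n + 1) > 2 l^3]. *)
pose K := Num.bound (2 * l ^+ 3 / (l - n.-1%:R)).
have lK : 2 * l ^+ 3 / (l - n.-1%:R) < K%:R.
  by apply: archi_boundP; rewrite divr_ge0 ?mulr_ge0 ?exprn_ge0 ?subr_ge0 ?ltW.
exists K => k Kk k0; have [u0 u1 eu] := hu k k0.
set kap := Num.sqrt _ in eu *.
have k1 : 1 <= k%:R :> R by rewrite ler1n.
have kR : 0 < k%:R :> R by rewrite ltr0n.
have u2 : 0 < 1 - u k ^+ 2 by rewrite subr_gt0 expr_lt1 // ltW.
have kap0 : 0 < kap by rewrite sqrtr_gt0.
have kap2 : kap ^+ 2 = 1 - u k ^+ 2 by rewrite sqr_sqrtr // ltW.
rewrite mulrCA mulrA; apply: (@cos_resonance n.-1).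
  rewrite -eu.
  have u34 : u k ^+ 4 <= u k ^+ 3 by rewrite [X in X <= _]exprS ler_piMl ?exprn_ge0 ?ltW.
  have u4 : u k ^+ 4 = (1 - kap ^+ 2) ^+ 2 by rewrite kap2 opprB addrCA subrr addr0 -exprM.
  have kl : k%:R * kap < l.
    by rewrite -eu gtr_pMr // exprn_ilt1 // ltW.
  have kl2 : k%:R * (k%:R * kap ^+ 2) <= l ^+ 2.
    have -> : k%:R * (k%:R * kap ^+ 2) = (k%:R * kap) ^+ 2 by rewrite exprMn expr2 mulrA.
    by rewrite ler_pXn2r ?nnegrE ?mulr_ge0 ?ltW.
  have kn : k%:R * (l - n.-1%:R) > 2 * l ^+ 3.
    rewrite -ltr_pdivrMr ?subr_gt0 //; apply: lt_le_trans lK _; by rewrite ler_nat.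
  have q0 : 0 <= kap ^+ 2 by exact: sqr_ge0.
  have q1 : k%:R * kap ^+ 2 <= l ^+ 2.
    by apply: le_trans kl2; rewrite ler_peMl // mulr_ge0 // ltW.
  have q2 : 2 * l * kap ^+ 2 < l - n.-1%:R.
    rewrite -(ltr_pM2l kR); apply: le_lt_trans kn.
    have -> : k%:R * (2 * l * kap ^+ 2) = 2 * l * (k%:R * kap ^+ 2) by ring.
    have -> : 2 * l ^+ 3 = 2 * l * l ^+ 2 by ring.
    by rewrite ler_pM2l // mulr_gt0.
  have q3 : l * (1 - 2 * kap ^+ 2) <= l * u k ^+ 3.
    rewrite ler_pM2l //; apply: le_trans u34; rewrite u4.
    have := sqr_ge0 (kap ^+ 2); rewrite sqrrB; lra.
  lra.
rewrite -eu natr1 prednK //; apply: lt_le_trans ln.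
by rewrite gtr_pMr // exprn_ilt1 // ltW.
Qed.

End CircularOrbits.

(** * Back to the original units *)

Section Denormalization.
Context {R : realType} (d : nat).
Implicit Types (x y : 'rV[R]_d).

Lemma row_derive (x : R -> 'rV[R]_d) (dx : 'rV[R]_d) (t : R) :
  (forall i, is_derive t 1 (fun s => x s 0 i) (dx 0 i)) -> derivable x t 1 /\ derive1 x t = dx.
Proof.
move=> h; have dr : derivable x t 1.
  by apply/derivable_mxP => i j; rewrite ord1; case: (h j).
split=> //; rewrite derive1E derive_mx //; apply/rowP => j; rewrite mxE.
by case: (h j).
Qed.

Lemma enorm_sqr x : enorm x ^+ 2 = dot x x.
Proof.
rewrite /enorm (_ : \sum_(i < d) x 0 i ^+ 2 = dot x x); first by rewrite sqr_sqrtr // dot_ge0.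
by rewrite dotE; apply: eq_bigr => i _; rewrite expr2.
Qed.

Lemma enormE x : enorm x = Num.sqrt (dot x x).
Proof. by rewrite -enorm_sqr sqrtr_sqr ger0_norm // /enorm sqrtr_ge0. Qed.

End Denormalization.

Section OneOrbit.
Context {R : realType} (d : nat) (i0 i1 : 'I_d) (i01 : i0 != i1).
Context (m c al T w u : R) (m0 : 0 < m) (c0 : 0 < c) (al0 : 0 < al) (T0 : 0 < T) (w0 : 0 < w).
Context (u0 : 0 < u) (u1 : u < 1) (circ : m * (c * u) ^+ 3 = al * w * Num.sqrt (1 - u ^+ 2)).
Context (nonres : cos (Num.sqrt (1 - u ^+ 2) * (w * T)) != 1).
Context (pc : Tperiodic (w * T) (@cos R)) (ps : Tperiodic (w * T) (@sin R)).
Context (U : R -> 'rV[R]_d -> R) (Ucont : continuous_off0 U) (UC2 : C2_in_space U).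
Context (Uper : forall x : 'rV[R]_d, x != 0 -> periodic_in_time T (fun t => U t x)).

Lemma one_orbit rr : 0 < rr -> rr < 1 -> exists2 epsN, 0 < epsN & forall eps, `|eps| < epsN ->
  exists x : R -> 'rV[R]_d, [/\ kepler_solution m c al eps U x, periodic_in_time T x &
    forall t, `|dot (x t) (x t) / (c * u / w) ^+ 2 - 1| <= rr].
Proof.
move=> rr0 rr1.
(* [r] and [p0] are the radius and the momentum of the circular orbit, the units of length and
   momentum. *)
pose k := Num.sqrt (1 - u ^+ 2); pose v := c * u; pose r := v / w; pose p0 := m * v / k.
have u2 : 0 < 1 - u ^+ 2 by rewrite subr_gt0 expr_lt1 // ltW.
have k0 : 0 < k by rewrite sqrtr_gt0.
have k2 : k ^+ 2 = 1 - u ^+ 2 by rewrite sqr_sqrtr // ltW.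
have k1 : k < 1 by rewrite -(@ltr_pXn2r _ 2) ?nnegrE ?ltW // k2 expr1n gtrBl exprn_gt0.
have k01 : 0 < k < 1 by rewrite k0 k1.
have v0 : 0 < v by exact: mulr_gt0.
have r0 : 0 < r by exact: divr_gt0.
have p00 : 0 < p0 by rewrite divr_gt0 // mulr_gt0.
have kn : k != 0 by rewrite gt_eqF.
have wn : w != 0 by rewrite gt_eqF.
have rw : r * w = v by rewrite /r divfK.
have balance : p0 * w * r ^+ 2 = al.
  have h : m * v ^+ 3 = al * w * k by exact: circ.
  have -> : p0 * w * r ^+ 2 = m * v ^+ 3 / (w * k) by rewrite /p0 /r; field; rewrite kn wn.
  by rewrite h; field; rewrite kn wn.
have wT0 : 0 < w * T by exact: mulr_gt0.
have [rho [Lip pert]] := scaled_perturbation T0 r0 w0 Ucont UC2 Uper.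
have [e0 e00 ex] := normalized_existence i01 wT0 k01 nonres pc ps pert rr0.
have pwr : 0 < p0 * w * r by apply: mulr_gt0 => //; exact: mulr_gt0.
exists (e0 * (p0 * w * r)); first exact: mulr_gt0.
(* The momentum equation is multiplied by [p0 * w], and the rescaled force already contains the
   factor [r]. *)
move=> eps epsle; pose eps' := eps / (p0 * w * r).
have eps'le : `|eps'| <= e0.
  by rewrite /eps' normrM normfV (gtr0_norm pwr) ler_pdivrMr // ltW.
have epsE : eps' * (p0 * w * r) = eps by rewrite /eps' divfK // gt_eqF.
have [X [P [dX dP pX hX]]] := ex eps' eps'le.
pose x (t : R) : 'rV[R]_d := r *: X (w * t).
have dwt (t : R) : is_derive t 1 (fun s => w * s) w.
  by apply: der_eq (der_mul (der_cst t w) (der_id t)) _; rewrite mulr1 mulr0 addr0.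
have dx (t : R) : derivable x t 1 /\ derive1 x t = v *: (phiK k (dot (P (w * t)) (P (w * t))) *: P (w * t)).
  apply: row_derive => i.
  have -> : (fun s => x s 0 i) = fun s => r * X (w * s) 0 i by apply/funext => s; rewrite mxE.
  apply: der_eq (der_mul (der_cst t r) (@der_comp _ (fun s => X s 0 i) (fun s => w * s) _ _ _ (dX i (w * t)) (dwt t))) _.
  by rewrite !mxE -rw; ring.
have v2 : v ^+ 2 = c ^+ 2 * (1 - k ^+ 2) by rewrite k2 /v; ring.
have kin_gt0 t : 0 < k ^+ 2 + (1 - k ^+ 2) * dot (P t) (P t).
  by apply: kinetic_arg_gt0 => //; exact: dot_ge0.
(* So [1 - |x'|^2 / c^2] is positive whatever the momentum, which gives the speed bound, and its
   root turns [rel_momentum] into [p0 P]. *)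
have speed t : enorm (derive1 x t) ^+ 2 / c ^+ 2 =
    1 - k ^+ 2 / (k ^+ 2 + (1 - k ^+ 2) * dot (P (w * t)) (P (w * t))).
  have g0 := kin_gt0 (w * t).
  rewrite (dx t).2 enorm_sqr !dotZl !dotZr.
  set q := dot _ _ in g0 *; set g := k ^+ 2 + (1 - k ^+ 2) * q in g0 *.
  have phi2 : phiK k q * phiK k q = g^-1.
    by rewrite /phiK -/g -invfM -expr2 sqr_sqrtr // ltW.
  have -> : v * (phiK k q * (v * (phiK k q * q))) = v ^+ 2 * (phiK k q * phiK k q) * q by ring.
  rewrite phi2 v2; have gn : g != 0 by rewrite gt_eqF.
  have cn : c != 0 by rewrite gt_eqF.
  have -> : c ^+ 2 * (1 - k ^+ 2) * g^-1 * q / c ^+ 2 = (g - k ^+ 2) / g by rewrite /g; field; rewrite cn -/g gn.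
  by field.
have momentum t : rel_momentum m c (derive1 x t) = p0 *: P (w * t).
  have g0 := kin_gt0 (w * t).
  rewrite /rel_momentum speed opprB addrCA subrr addr0 (dx t).2 !scalerA.
  congr (_ *: _); rewrite /phiK; set g := k ^+ 2 + _ in g0 *.
  rewrite sqrtrM ?sqr_ge0 // sqrtr_sqr (gtr0_norm k0) sqrtrV ?ltW //.
  have sg : Num.sqrt g != 0 by rewrite gt_eqF // sqrtr_gt0.
  by rewrite /p0; field; rewrite sg kn.
exists x; split.
- move=> t p.
  have pE : p = fun s => p0 *: P (w * s) by apply/funext => s; exact: momentum.
  have XX0 : 0 < dot (X (w * t)) (X (w * t)).
    by have := hX (w * t); rewrite ler_norml => /andP[h _]; lra.
  have Xn : X (w * t) != 0.
    apply: contraTneq XX0 => ->; rewrite dotE big1 ?ltxx // => i _; by rewrite mxE mul0r.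
  have dp : derivable p t 1 /\ derive1 p t = (p0 * w) *:
      (- phiV (dot (X (w * t)) (X (w * t))) *: X (w * t) + eps' *: (r *: gradient (U t) (r *: X (w * t)))).
    apply: row_derive => i.
    have -> : (fun s => p s 0 i) = fun s => p0 * P (w * s) 0 i by apply/funext => s; rewrite pE mxE.
    apply: der_eq (der_mul (der_cst t p0) (@der_comp _ (fun s => P s 0 i) (fun s => w * s) _ _ _ (dP i (w * t)) (dwt t))) _.
    have -> : w * t / w = t by rewrite mulrC mulKf.
    by rewrite !mxE; ring.
  split=> //.
  + by rewrite scaler_eq0 negb_or Xn gt_eqF.
  + by have [] := dx t.
  + have g0 := kin_gt0 (w * t).
    have h : enorm (derive1 x t) ^+ 2 / c ^+ 2 < 1.
      by rewrite speed gtrBl divr_gt0 // exprn_gt0.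
    rewrite ltr_pdivrMr ?exprn_gt0 // mul1r in h.
    by rewrite -(@ltr_pXn2r _ 2) ?nnegrE // ?(ltW c0) // /enorm sqrtr_ge0.
  + by have [] := dp.
  + rewrite dp.2 /perturbed_kepler_force scalerDr !scalerA; congr (_ *: _ + _ *: _).
      have e3 : enorm (x t) ^+ 3 = r ^+ 3 * (dot (X (w * t)) (X (w * t)) * Num.sqrt (dot (X (w * t)) (X (w * t)))).
        rewrite exprS mulrC enorm_sqr enormE dotZl dotZr mulrA -expr2 sqrtrM ?sqr_ge0 // sqrtr_sqr (gtr0_norm r0).
        by ring.
      rewrite e3 -balance /phiV.
      have sn : Num.sqrt (dot (X (w * t)) (X (w * t))) != 0 by rewrite gt_eqF // sqrtr_gt0.
      have dn : dot (X (w * t)) (X (w * t)) != 0 by rewrite gt_eqF.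
      by field; rewrite sn dn gt_eqF.
    by rewrite -epsE; ring.
- by move=> t; rewrite /x mulrDr pX.
move=> t; rewrite /x dotZl dotZr mulrA -expr2 -/v -/r mulrAC mulfV ?mul1r //.
by rewrite gt_eqF // exprn_gt0.
Qed.

End OneOrbit.

(** * Counting the solutions *)

Lemma min_of_positive (R : realDomainType) (e : nat -> R) (n : nat) : (forall j, 0 < e j) ->
  exists2 e0, 0 < e0 & forall j, (j < n)%N -> e0 <= e j.
Proof.
move=> e_gt0; elim: n => [|n [e0 e00 h]]; first by exists 1.
exists (Num.min e0 (e n)); first by rewrite lt_min e00 e_gt0.
move=> j; rewrite ltnS leq_eqVlt => /predU1P[->|/h jn]; first by rewrite ge_min lexx orbT.
by rewrite ge_min jn.
Qed.

Theorem corollary3p5 (R : realType) (d : nat) (hd : d = 2%N \/ d = 3%N)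
  (m c alpha T : R) (hm : 0 < m) (hc : 0 < c) (halpha : 0 < alpha)
  (hT : 0 < T) (U : R -> 'rV[R]_d -> R)
  (hUcont : continuous_off0 U)
  (hUper : forall x : 'rV[R]_d, x != 0 -> periodic_in_time T (fun t => U t x))
  (hUC2 : C2_in_space U) :
  forall N : nat, (1 <= N)%N ->
    exists epsN : R, 0 < epsN /\
      forall eps : R, `|eps| < epsN ->
        exists x : 'I_(4 * N) -> (R -> 'rV[R]_d),
          injective x /\
          forall k : 'I_(4 * N),
            kepler_solution m c alpha eps U (x k) /\
            periodic_in_time T (x k).
Proof.
move=> N _.
have [i0 [i1 i01]] : exists i0 i1 : 'I_d, i0 != i1.
  by case: hd => hd; rewrite hd; exists ord0, ord_max.
pose w (k : nat) : R := k%:R * (pi *+ 2 / T).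
have pi2 : 0 < pi *+ 2 :> R by rewrite pmulrn_lgt0 // pi_gt0.
have w0 k : (0 < k)%N -> 0 < w k by move=> k0; rewrite mulr_gt0 ?ltr0n // divr_gt0.
have wT k : w k * T = k%:R * (pi *+ 2) by rewrite /w -mulrA divfK // gt_eqF.
have /choice [u hu] : forall k : nat, exists u : R, (0 < k)%N ->
    [/\ 0 < u, u < 1 & m * (c * u) ^+ 3 = alpha * w k * Num.sqrt (1 - u ^+ 2)].
  move=> k; have [k0|_] := ltnP 0 k; last by exists 0.
  have [u [u0 u1 eu]] := @circular_velocity R (m * c ^+ 3) (alpha * w k)
    ltac:(by rewrite mulr_gt0 ?exprn_gt0) (mulr_gt0 halpha (w0 k k0)).
  by exists u => _; split=> //; rewrite exprMn mulrA.
(* Chosen so that the circular balance becomes [l * u k ^ 3 = k * sqrt (1 - u k ^ 2)]. *)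
pose l := m * c ^+ 3 * T / (alpha * (pi *+ 2)).
have l0 : 0 < l by rewrite divr_gt0 // !mulr_gt0 // exprn_gt0.
have [K hK] : exists K, forall k, (K <= k)%N -> (0 < k)%N ->
    cos (Num.sqrt (1 - u k ^+ 2) * (k%:R * (pi *+ 2))) != 1.
  apply: (nonresonant_tail l0) => k k0; have [u0 u1 eu] := hu k k0; split=> //.
  have -> : l * u k ^+ 3 = m * (c * u k) ^+ 3 * (T / (alpha * (pi *+ 2))) by rewrite /l exprMn; ring.
  rewrite eu /w; move: pi2; move: (pi *+ 2) => p p0.
  by field; rewrite !gt_eqF.
pose R2 k := (c * u k / w k) ^+ 2.
have R20 k : (0 < k)%N -> 0 < R2 k.
  by move=> k0; have [u0 _ _] := hu k k0; rewrite exprn_gt0 // divr_gt0 ?w0 // mulr_gt0.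
have R2S k : (0 < k)%N -> R2 k.+1 < R2 k.
  move=> k0; have [u0 u1 eu] := hu k k0; have [u0' u1' eu'] := hu k.+1 isT.
  have ww : w k < w k.+1 by rewrite /w ltr_pM2r ?divr_gt0 // ltr_nat.
  have := circular_radius_lt hm hc halpha (w0 k k0) ww u0 u1 u0' u1' eu eu'.
  have pos n (n0 : (0 < n)%N) : 0 <= c * u n / w n.
    by have [un0 _ _] := hu n n0; apply/ltW/divr_gt0; [exact: mulr_gt0|exact: w0].
  by rewrite /R2 ltr_pXn2r // nnegrE pos.
have R2le a b : (0 < a)%N -> (a <= b)%N -> R2 b <= R2 a.
  move=> a0; elim: b => [|b ih]; first by rewrite leqn0 => /eqP h; rewrite h in a0.
  rewrite leq_eqVlt => /predU1P[->//|ab]; apply: le_trans (ih ab).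
  by apply/ltW/R2S; exact: leq_trans a0 ab.
(* Steps of two make the intervals between the squared radii of index [kk j + 1] and [kk j - 1]
   pairwise disjoint; the offset keeps [kk j >= K] and [kk j - 1 > 0]. *)
pose kk j := (K + j.*2).+2.
have /choice [e he] : forall j : nat, exists e : R, 0 < e /\ forall eps, `|eps| < e ->
    exists x : R -> 'rV[R]_d, [/\ kepler_solution m c alpha eps U x, periodic_in_time T x &
      R2 (kk j).+1 < dot (x 0) (x 0) /\ dot (x 0) (x 0) < R2 (kk j).-1].
  move=> j; pose k := kk j; have k0 : (0 < k)%N by [].
  have [u0 u1 eu] := hu k k0.
  have r1 := R2S k k0; have r2 := R2S k.-1 isT; rewrite prednK // in r2.
  have r0 := R20 k k0.
  (* Half the relative gap to each neighbouring squared radius keeps the solution strictly between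
     the two neighbouring orbits. *)
  pose rr := Num.min (1 / 2) (Num.min ((R2 k - R2 k.+1) / (2 * R2 k)) ((R2 k.-1 - R2 k) / (2 * R2 k))).
  have d0 : 0 < 2 * R2 k by rewrite mulr_gt0.
  have rr0 : 0 < rr by rewrite !lt_min !divr_gt0 ?subr_gt0.
  have rr1 : rr < 1 by rewrite gt_min; apply/orP; left; lra.
  have rr2 : rr * (2 * R2 k) <= R2 k - R2 k.+1 by rewrite -ler_pdivlMr // !ge_min lexx !orbT.
  have rr3 : rr * (2 * R2 k) <= R2 k.-1 - R2 k by rewrite -ler_pdivlMr // !ge_min lexx !orbT.
  have pz (f : R -> R) : (forall a, f (a + pi *+ 2) = f a) -> Tperiodic (w k * T) f.
    move=> pf t; rewrite wT mulr_natl; exact: (periodicn pf k t).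
  have [|ee ee0 hee] := one_orbit i01 hm hc hT (w0 k k0) u0 u1 eu _ (pz _ (@cosD2pi R)) (pz _ (@sinD2pi R)) hUcont hUC2 hUper rr0 rr1.
    rewrite wT; apply: hK => //; rewrite /k /kk -addn2 -addnA; exact: leq_addr.
  exists ee; split=> // eps /hee [x [sx px hx]]; exists x; split=> //.
  have := hx 0; rewrite -/(R2 k); set y := dot _ _.
  have yE : y = y / R2 k * R2 k by rewrite divfK // gt_eqF.
  rewrite ler_norml => /andP[h1 h2].
  have h1' : (1 - rr) * R2 k <= y by rewrite {1}yE ler_pM2r //; lra.
  have h2' : y <= (1 + rr) * R2 k by rewrite {1}yE ler_pM2r //; lra.
  have p : 0 < rr * R2 k by exact: mulr_gt0.
  by split; lra.
have [epsN epsN0 hepsN] := min_of_positive (4 * N) (fun j => (he j).1).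
exists epsN; split=> // eps epsle.
have /choice [x hx] : forall j : 'I_(4 * N), exists x : R -> 'rV[R]_d,
    [/\ kepler_solution m c alpha eps U x, periodic_in_time T x &
      R2 (kk j).+1 < dot (x 0) (x 0) /\ dot (x 0) (x 0) < R2 (kk j).-1].
  by move=> j; apply: (he j).2; apply: lt_le_trans epsle _; exact: hepsN.
exists x; split; last by move=> j; have [] := hx j.
have ne (i j : 'I_(4 * N)) : (i < j)%N -> x i <> x j.
  move=> ij xij; have [_ _ [h1 _]] := hx i; have [_ _ [_ h2]] := hx j.
  rewrite xij in h1; have := lt_trans h1 h2; apply/negP; rewrite -leNgt; apply: R2le => //.
  by rewrite /kk /= ltnS -!addnS leq_add2l -doubleS leq_double.
move=> i j xij; apply/val_inj/eqP; case: (ltngtP i j) => // [ij|ji].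
  by case: (ne i j ij xij).
by case: (ne j i ji (esym xij)).
Qed.
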